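(* Let $(S,d)$ be a metric space with a decomposition $S=\bigcup_{s'\in S'}S_{s'}$ into disjoint pieces, with fuzzy map $T:S\to S'$, $T(s)=s'$ for $s\in S_{s'}$, and let $\rho=\sup_{s'}\mathrm{diam}(S_{s'})$ be the fineness of the decomposition. Let $\Phi$ be an interaction potential with $\sup_{i\in G}\sum_{A\ni i}|A|\,\Vert\Phi_A\Vert_\infty<\infty$. Assume the Lipschitz property for the $j$-variation of the initial Hamiltonian: for all $i,j\in G$ and $\sigma_i,a_i\in S$, $$\sup_{\zeta,\bar\zeta\in S^G:\ \zeta_{j^c}=\bar\zeta_{j^c}}\Bigl|H_i(\sigma_i\zeta_{i^c})-H_i(\sigma_i\bar\zeta_{i^c})-\bigl(H_i(a_i\zeta_{i^c})-H_i(a_i\bar\zeta_{i^c})\bigr)\Bigr|\leq L_{ij}\,d(\sigma_i,a_i).$$ Suppose that $$\frac\rho2\,\sup_{i\in G}\sum_{j\in G}\exp\Bigl(\frac12\sum_{A\supset\{i,j\}}\delta(\Phi_A)\Bigr)L_{ij}<1.$$ 1. Then, for any initial Gibbs measure $\mu$ of the specification for $\Phi$ with an arbitrary a priori measure $\alpha$, the transformed measure $T(\mu)$ is Gibbs for a specification $\gamma'$. 2. The entries $C'_{ij}$ of the Dobrushin interdependence matrix of $\gamma'$ are bounded by $$Q_{ij}=4\,e^{2\sum_{A\ni i}\Vert\Phi_A\Vert_\infty}\Bigl(\sum_{k\in G\setminus i}\delta_k\Bigl(\sum_{A\supset\{i,k\}}\Phi_A\Bigr)\bar D_{kj}\Bigr)e^{\sum_{A\ni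 j}\delta_j(\Phi_A)},\qquad\bar D=\sum_{n=0}^\infty\bar C^n,$$ where $$\bar C_{ij}=\frac\rho2\exp\Bigl(\frac12\sum_{A\supset\{i,j\}}\delta(\Phi_A)\Bigr)L_{ij}.$$
   Context: $G$ is a countable set; $S$ and $S'$ are standard Borel ($S'$ finite or infinite). An interaction potential $\Phi=(\Phi_A)$ is a family of measurable functions $\Phi_A:S^G\to\mathbb R$, indexed by finite $A\subset G$, with $\Phi_A$ depending only on the coordinates in $A$. $i^c=G\setminus\{i\}$; $\sigma_\Lambda\bar\sigma_{\Lambda^c}$ is concatenation; $H_V=\sum_{A\cap V\ne\emptyset}\Phi_A$, $H_i=H_{\{i\}}$. A Gibbs measure $\mu$ for $\Phi$ and a priori probability measure $\alpha$ on $S$ is a probability measure on $S^G$ whose conditional distribution in each finite $\Lambda$ given $\bar\sigma_{\Lambda^c}$ has density proportional to $e^{-H_\Lambda(\sigma_\Lambda\bar\sigma_{\Lambda^c})}$ with respect to $\prod_{i\in\Lambda}\alpha(d\sigma_i)$. $T(\mu)$ is the image of $\mu$ on $(S')^G$ under applying $T$ at every site. A specification is a consistent family of finite-volume conditional probability kernels depending on the conditioning in a continuous (essentially local) way; a measure is Gibbs for it if it has these kernels as conditional distributions. The Dobrushin interdependence matrix of $\gamma'$ is $C'_{ij}=\sup_{\zeta,\eta\in(S')^G:\,\zeta_{j^c}=\eta_{j^c}}\Vert\gamma'_i(\cdot|\zeta)-\gamma'_i(\cdot|\eta)\Vert$, with $\Vert\nu_1-\nu_2\Vert=\frac12\int|h_1-h_2|d\lambda$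 for $\lambda$-densities $h_1,h_2$. $\delta(\Phi_A)=\sup_{w,\bar w}|\Phi_A(w)-\Phi_A(\bar w)|$; $\delta_j(F)=\sup_{\zeta_{j^c}=\eta_{j^c}}|F(\eta)-F(\zeta)|$. *)

(* Defs.v *)
From HB Require Import structures.
From mathcomp Require Import all_boot all_order all_algebra finmap.
From mathcomp Require Import all_classical all_reals all_analysis.
From mathcomp Require Import measurable_realfun.

Set Implicit Arguments.
Unset Strict Implicit.
Unset Printing Implicit Defensive.
Import Order.TTheory GRing.Theory Num.Theory.
Import numFieldNormedType.Exports.

Local Open Scope classical_set_scope.
Local Open Scope ring_scope.

(* A measurable space that also carries a metric [mdist].  The sigma-algebra is
   not required to be the Borel sigma-algebra of [mdist]. *)
#[short(type="metricMeasurableType")]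
HB.structure Definition MetricMeasurable (K : numDomainType)
    (d : measure_display) := { T of Measurable d T & Metric K T }.

(* Complete + Hausdorff + second countable = Polish. *)
Definition standard_borel (R : realType) (d : measure_display)
    (T : measurableType d) : Prop :=
  exists (P : completePseudoMetricType R) (f : T -> P),
    [/\ hausdorff_space P, @second_countable P, bijective f &
        forall A : set T, measurable A <->
          exists2 B : set P, <<s [set U : set P | open U] >> B & A = f @^-1` B].

Definition cylinders (G : Type) (d : measure_display) (S : measurableType d)
    (V : set G) : set (set (G -> S)) :=
  \bigcup_(i in V) preimage_set_system setT (fun w : G -> S => w i) measurable.
Arguments cylinders {G d} S V.

(* S^G with the product sigma-algebra. *)
Notation config G S := (g_sigma_algebraType (@cylinders G _ S setT)).

(* S^G with the sigma-algebra F_{L^c} generated by the sites outside L. *)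
Notation config_off L S :=
  (g_sigma_algebraType (cylinders S (~` [set` L]))).

Section Configurations.
Variables (G : countType) (d : measure_display) (S : measurableType d).

Definition update (w : config G S) (i : G) (s : S) : config G S :=
  fun k => if k == i then s else w k.

Definition agree_on (V : set G) (w w' : config G S) : Prop :=
  forall i, V i -> w i = w' i.

Definition agree_off (j : G) := agree_on [set k | k != j].

End Configurations.

Section Sitewise.
Variables (G : countType) (d d' : measure_display).
Variables (S : measurableType d) (S' : measurableType d').

Definition sitewise (T : {mfun S >-> S'}) (w : config G S) : config G S' :=
  fun i => T (w i).

Lemma measurable_sitewise (T : {mfun S >-> S'}) :
  measurable_fun [set: config G S] (sitewise T).
Proof.
apply: measurability => // _ [_ [i _ [B mB <-]] <-].
rewrite !setTI; apply: sub_sigma_algebra; exists i => //.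
exists (T @^-1` B); last by rewrite setTI.
by rewrite -[X in measurable X]setTI; apply: (@measurable_funPT _ _ _ _ T).
Qed.

HB.instance Definition _ (T : {mfun S >-> S'}) :=
  isMeasurableFun.Build _ _ _ _ (sitewise T) (measurable_sitewise T).

End Sitewise.

Section Variation.
Variables (R : realType) (G : countType) (d : measure_display).
Variable S : measurableType d.
Implicit Type F : config G S -> R.
Local Open Scope ereal_scope.

Definition supnorm F : \bar R :=
  ereal_sup [set `|F w|%:E | w in [set: config G S]].

Definition osc F : \bar R :=
  ereal_sup [set t | exists w w' : config G S, t = `|F w - F w'|%:E].

Definition osc_at (j : G) F : \bar R :=
  ereal_sup [set t | exists2 ze : config G S * config G S,
    agree_off j ze.1 ze.2 & t = `|F ze.2 - F ze.1|%:E].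

Definition local_fun F : Prop := exists V : {fset G},
  forall w w' : config G S, agree_on [set` V] w w' -> F w = F w'.

Definition quasilocal F : Prop :=
  forall e : R, (0 < e)%R -> exists V : {fset G},
    forall w w' : config G S, agree_on [set` V] w w' -> (`|F w - F w'| <= e)%R.

End Variation.

(* Sum of an absolutely summable (not necessarily nonnegative) real family. *)
Definition rsum (R : realType) (I : choiceType) (D : set I) (f : I -> R) : R :=
  fine (\esum_(x in D) (EFin \o f)^\+ x - \esum_(x in D) (EFin \o f)^\- x)%E.

(* 1/2 int |h1 - h2| d la does not depend on the dominating measure la nor on the
   densities h1, h2 of nu1, nu2, and such a choice exists for finite measures
   (la = nu1 + nu2): the supremum is over a singleton. *)
Definition tv_dist (R : realType) (d : measure_display) (T : measurableType d)
    (nu1 nu2 : set T -> \bar R) : \bar R :=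
  ereal_sup [set t | exists (la : {measure set T -> \bar R}) (h1 h2 : T -> R),
    [/\ la.-integrable setT (EFin \o h1), la.-integrable setT (EFin \o h2),
        forall B, measurable B -> nu1 B = (\int[la]_(x in B) (h1 x)%:E)%E,
        forall B, measurable B -> nu2 B = (\int[la]_(x in B) (h2 x)%:E)%E &
        t = ((2^-1)%:E * \int[la]_x `|h1 x - h2 x|%:E)%E]].

Section Specifications.
Variables (R : realType) (G : countType) (d : measure_display).
Variable S : measurableType d.
Local Open Scope ereal_scope.

(* The kernels k L are the conditional distributions of mu given F_{L^c}. *)
Definition gibbs_for (k : {fset G} -> config G S -> set (config G S) -> \bar R)
    (mu : probability (config G S) R) : Prop :=
  forall (L : {fset G}) (B E : set (config G S)),
    measurable B -> measurable (E : set (config_off L S)) ->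
    mu (B `&` E) = \int[mu]_(w in E) k L w B.

(* Kernels live on the whole of S^G (and leave the configuration outside L
   unchanged).  Continuity in the conditioning is quasilocality. *)
Record specification
    (gam : {fset G} -> R.-pker (config G S) ~> (config G S)) : Prop := {
  spec_measurable : forall (L : {fset G}) (B : set (config G S)),
    measurable B ->
    measurable_fun [set: config_off L S] (gam L ^~ B) ;
  spec_proper : forall (L : {fset G}) (E : set (config G S)) w,
    measurable (E : set (config_off L S)) -> gam L w E = (\1_E w)%:E ;
  spec_consistent : forall (L D : {fset G}) w (B : set (config G S)),
    (L `<=` D)%fset -> measurable B ->
    \int[gam D w]_v gam L v B = gam D w B ;
  spec_quasilocal : forall (L : {fset G}) (f : config G S -> R),
    measurable_fun setT f -> supnorm f < +oo -> local_fun f ->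
    quasilocal (fun w => (\int[gam L w]_v f v)%R) }.

(* The single-site measure on S: the image of gam_{i} under w |-> w i. *)
Definition single_site (gam : {fset G} -> R.-pker (config G S) ~> (config G S))
    (i : G) (w : config G S) : set S -> \bar R :=
  fun A => gam [fset i]%fset w [set v | A (v i)].

Definition dobrushin_matrix
    (gam : {fset G} -> R.-pker (config G S) ~> (config G S)) (i j : G) : \bar R :=
  ereal_sup [set t | exists2 ze : config G S * config G S,
    agree_off j ze.1 ze.2 &
    t = tv_dist (single_site gam i ze.1) (single_site gam i ze.2)].

End Specifications.

Section Potentials.
Variables (R : realType) (G : countType) (d : measure_display).
Variable S : measurableType d.
Variable Phi : {fset G} -> config G S -> R.

Definition interaction_potential : Prop := forall A : {fset G},
  measurable_fun setT (Phi A) /\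
  forall w w', agree_on [set` A] w w' -> Phi A w = Phi A w'.

Definition hamiltonian (V : {fset G}) (w : config G S) : R :=
  rsum [set A : {fset G} | (A `&` V)%fset != fset0] (fun A => Phi A w).

(* Iterated integral of f >= 0 over the sites of L, i.e. (Tonelli) against the product of the
   alpha(d s_i), i in L; the configuration outside L is that of w. *)
Definition site_integral (alpha : probability S R) (L : {fset G})
    (f : config G S -> \bar R) : config G S -> \bar R :=
  foldr (fun i (F : config G S -> \bar R) w => (\int[alpha]_s F (update w i s))%E)
    f (enum_fset L).

Definition gibbs_kernel (alpha : probability S R) (L : {fset G})
    (w : config G S) (B : set (config G S)) : \bar R :=
  (site_integral alpha L (fun v => (\1_B v * expR (- hamiltonian L v))%:E) w
   / site_integral alpha L (fun v => (expR (- hamiltonian L v))%:E) w)%E.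

Definition gibbs_measure (alpha : probability S R)
    (mu : probability (config G S) R) : Prop :=
  gibbs_for (gibbs_kernel alpha) mu.

End Potentials.

Section Bounds.
Variables (R : realType) (G : countType) (d : measure_display).
Variable S : measurableType d.
Variable Phi : {fset G} -> config G S -> R.
Local Open Scope ereal_scope.

Definition containing (i : G) : set {fset G} := [set A | i \in A].

Definition containing2 (i j : G) : set {fset G} :=
  [set A | ([fset i; j] `<=` A)%fset].

Definition weight (L : G -> G -> R) (i j : G) : \bar R :=
  expeR ((2^-1)%:E * \esum_(A in containing2 i j) osc (Phi A)) * (L i j)%:E.

(* The fineness rho may be +oo; products follow the convention 0 * +oo = 0. *)
Definition Cbar (rho : \bar R) (L : G -> G -> R) (i j : G) : \bar R :=
  rho * (2^-1)%:E * weight L i j.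

Fixpoint mxpow (C : G -> G -> \bar R) (n : nat) (i j : G) : \bar R :=
  if n is n'.+1 then \esum_(k in [set: G]) (C i k * mxpow C n' k j)
  else (i == j)%:R%:E.

Definition Dbar (rho : \bar R) (L : G -> G -> R) (i j : G) : \bar R :=
  \sum_(0 <= n <oo) mxpow (Cbar rho L) n i j.

Definition Qbound (rho : \bar R) (L : G -> G -> R) (i j : G) : \bar R :=
  4%:E * expeR (2%:E * \esum_(A in containing i) supnorm (Phi A))
  * (\esum_(k in [set k | k != i])
       (osc_at k (fun w => rsum (containing2 i k) (fun A => Phi A w))
        * Dbar rho L k j))
  * expeR (\esum_(A in containing j) osc_at j (Phi A)).

End Bounds.

Section Fineness.
Variables (R : realType) (d : measure_display) (S : metricMeasurableType R d).

(* -oo on the empty set, which does not affect the fineness below. *)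
Definition diam (A : set S) : \bar R :=
  ereal_sup [set (mdist p.1 p.2)%:E | p in A `*` A].

Definition fineness (I : Type) (piece : I -> set S) : \bar R :=
  ereal_sup [set diam (piece s) | s in [set: I]].

End Fineness.

(* Main.v *)
(* Disintegrate alpha along T into probabilities q s' carried by the pieces.  Averaging
   exp(- H_V) over spins sigma_k drawn from q (o k), k in V, gives a constrained partition
   function Z_V(o).  Within the pieces the spins are weakly dependent: by the Lipschitz
   condition the constrained finite-volume Gibbs measures satisfy Dobrushin's condition with
   matrix Cbar, uniformly in o.  Hence, for o and o' equal off L, the ratio Z_V(o) / Z_V(o')
   converges uniformly as V grows.  The limits g_L are quasilocal, satisfy a cocycle identity
   (whence consistency), and are up to normalization the densities of the conditional
   distributions of the image measure with respect to the product of the image of alpha.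
   The comparison theorem also bounds the cross ratio of g_i under a change of the spin at j by
   exp(2 e^{2 |H_i|} sum_k delta_k(H_i) Dbar_kj), and a cross ratio at most e^K keeps the total
   variation distance at most K. *)

From HB Require Import structures.
Require Import Defs.
From mathcomp Require Import all_boot all_order all_algebra finmap.
From mathcomp Require Import all_classical all_reals all_analysis.
From mathcomp Require Import measurable_realfun.
From mathcomp Require Import lra.

Set Implicit Arguments.
Unset Strict Implicit.
Unset Printing Implicit Defensive.
Import Order.TTheory GRing.Theory Num.Theory.
Import numFieldNormedType.Exports.

Local Open Scope classical_set_scope.
Local Open Scope ring_scope.

(** * Bounded measurable functions and iterated site integrals *)

(** A specification consists of kernels given at every configuration, whereas conditioning
    determines laws only up to null sets. Hence the densities are everywhere convergent limits of
    ratios of partition functions, and on the null set of constraints where the disintegration says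
    nothing the spin law is a Dirac mass, which still sits inside one piece. The quantity under
    control is the cross ratio Z(o,w) Z(o',w') / (Z(o,w') Z(o',w)) for boundary conditions w, w'. It
    multiplies along chains of one-site changes of w, and a bound on it survives averaging, since
    both sides are bilinear. A change at site j costs 2 e^{2 M_L} times the sum over k of
    delta_k(H_L) D_kj, with M_L the bound on |H_L|. Summability in j has two sources: the weight |A|
    in the norm of the potential makes the sum over k of delta_k(H_L) at most 2 |L| K, with K the
    bound on that norm, and the rows of D sum to at most 1/(1-c). So distant sites barely influence
    the ratio. The 1/2 in front of rho is that of tanh(t/2) <= t/2, where t is a mixed variation of
    the energy within a piece, at most rho L_ij. *)

Section BoundedMeasurable.
Context {R : realType} {d : measure_display} {X : measurableType d}.
Implicit Types (f g : X -> R) (P : probability X R).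

(** This class is stable under all operations used below, including averages over sites, so
    integrability never has to be discussed. *)
Definition bmeas f := measurable_fun setT f /\ exists M : R, forall x, `|f x| <= M.

Lemma bmeas_cst c : bmeas (cst c).
Proof. by split; [exact: measurable_cst|exists `|c|]. Qed.

Lemma bmeasD f g : bmeas f -> bmeas g -> bmeas (fun x => f x + g x).
Proof.
move=> [mf [M hM]] [mg [N hN]]; split; first exact: measurable_funD.
by exists (M + N) => x; rewrite (le_trans (ler_normD _ _))// lerD.
Qed.

Lemma bmeasM f g : bmeas f -> bmeas g -> bmeas (fun x => f x * g x).
Proof.
move=> [mf [M hM]] [mg [N hN]]; split; first exact: measurable_funM.
by exists (M * N) => x; rewrite normrM ler_pM.
Qed.

Lemma bmeasN f : bmeas f -> bmeas (fun x => - f x).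
Proof.
move=> [mf [M hM]]; split; first exact: measurableT_comp.
by exists M => x; rewrite normrN.
Qed.

Lemma bmeasB f g : bmeas f -> bmeas g -> bmeas (fun x => f x - g x).
Proof. by move=> ? /bmeasN; exact: bmeasD. Qed.

Lemma bmeasZ c f : bmeas f -> bmeas (fun x => c * f x).
Proof. by move=> ?; apply: bmeasM => //; exact: bmeas_cst. Qed.

Lemma bmeas_exp f : bmeas f -> bmeas (fun x => expR (f x)).
Proof.
move=> [mf [M hM]]; split; first by apply: measurableT_comp => //; exact: measurable_expR.
exists (expR M) => x; rewrite ger0_norm ?expR_ge0// ler_expR.
by rewrite (le_trans (ler_norm _)).
Qed.

Lemma bmeas_inv f c : 0 < c -> (forall x, c <= f x) -> bmeas f ->
  bmeas (fun x => (f x)^-1).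
Proof.
move=> c0 cf [mf _]; split.
  have f0 x : f x != 0 by rewrite gt_eqF// (lt_le_trans c0).
  rewrite (_ : (fun x => (f x)^-1) = (fun x => expR (- ln (f x)))); last first.
    by apply/funext => x; rewrite expRN lnK// posrE (lt_le_trans c0).
  apply: measurableT_comp; first exact: measurable_expR.
  by apply: measurableT_comp => //; apply: measurableT_comp => //; exact: measurable_ln.
exists c^-1 => x; have fx := lt_le_trans c0 (cf x).
by rewrite ger0_norm ?invr_ge0 ?(ltW fx)// lef_pV2.
Qed.

Lemma bmeas_indic (A : set X) : measurable A -> bmeas (\1_A : X -> R).
Proof.
move=> mA; split; first exact: measurable_indic.
by exists 1 => x; rewrite indicE; case: (x \in A); rewrite /= ?normr1 ?normr0.
Qed.

Lemma bmeas_int P f : bmeas f -> P.-integrable setT (EFin \o f).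
Proof.
move=> [mf [M hM]]; apply/integrableP; split; first exact/measurable_EFinP.
apply: (@le_lt_trans _ _ (\int[P]_x (cst M%:E x))%E).
  apply: ge0_le_integral => //.
  - by apply: measurableT_comp => //; exact/measurable_EFinP.
  - by move=> x _; rewrite lee_fin.
by rewrite integral_cst// [X in (_ * X)%E](@probability_setT _ _ _ P) mule1 ltry.
Qed.

Lemma EFin_mean P f : bmeas f ->
  (\int[P]_x f x)%:E = (\int[P]_x (f x)%:E)%E.
Proof.
by move=> /(bmeas_int P) iP; rewrite /Rintegral fineK// integrable_fin_num.
Qed.

Lemma mean_cst P c : \int[P]_x c = c.
Proof.
by rewrite Rintegral_cst// [X in fine X](@probability_setT _ _ _ P) mulr1.
Qed.

Lemma meanD P f g : bmeas f -> bmeas g ->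
  \int[P]_x (f x + g x) = \int[P]_x f x + \int[P]_x g x.
Proof. by move=> /(bmeas_int P) ? /(bmeas_int P) ?; rewrite RintegralD. Qed.

Lemma meanB P f g : bmeas f -> bmeas g ->
  \int[P]_x (f x - g x) = \int[P]_x f x - \int[P]_x g x.
Proof. by move=> /(bmeas_int P) ? /(bmeas_int P) ?; rewrite RintegralB. Qed.

Lemma meanZ P f c : bmeas f -> \int[P]_x (c * f x) = c * \int[P]_x f x.
Proof. by move=> /(bmeas_int P) ?; rewrite RintegralZl. Qed.

Lemma le_mean P f g : bmeas f -> bmeas g -> (forall x, f x <= g x) ->
  \int[P]_x f x <= \int[P]_x g x.
Proof.
by move=> /(bmeas_int P) ? /(bmeas_int P) ? fg; rewrite le_Rintegral.
Qed.

Lemma norm_mean P f M : bmeas f -> (forall x, `|f x| <= M) ->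
  `|\int[P]_x f x| <= M.
Proof.
move=> bf fM; rewrite -(mean_cst P M) ler_norml -(mean_cst P (- _)) !mean_cst.
rewrite -[- M](mean_cst P) -{2}[M](mean_cst P) !le_mean//;
  [exact: bmeas_cst|..].
- by move=> x; have := fM x; rewrite ler_norml => /andP[].
- exact: bmeas_cst.
- by move=> x; have := fM x; rewrite ler_norml => /andP[].
Qed.

Lemma mean_indic P (A : set X) : measurable A ->
  (\int[P]_x (\1_A x : R))%:E = P A.
Proof.
move=> mA; rewrite EFin_mean; last exact: bmeas_indic.
by rewrite integral_indic// setIT.
Qed.

(** Almost sure statements are carried by a measurable set of full measure, inserted into integrals
    as an indicator. *)
Lemma mean_restrict P (A : set X) f : measurable A -> P A = 1%E -> bmeas f ->
  \int[P]_x f x = \int[P]_x (f x * \1_A x).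
Proof.
move=> mA PA bf; apply/eqP; rewrite -subr_eq0 -meanB//; last first.
  by apply: bmeasM => //; exact: bmeas_indic.
have [M fM] := bf.2.
have b1 := @bmeas_indic _ mA; have bC := @bmeas_indic _ (measurableC mA).
have PC : \int[P]_x (\1_(~` A) x : R) = 0.
  apply/eqP; rewrite -eqe mean_indic; last exact: measurableC.
  by rewrite probability_setC// PA subee.
have E x : f x - f x * \1_A x = f x * \1_(~` A) x.
  by rewrite !indicE in_setC; case: (x \in A) => /=; lra.
rewrite (_ : (fun x => _) = fun x => f x * \1_(~` A) x); last exact/funext.
have bnd x : `|f x * \1_(~` A) x| <= M * \1_(~` A) x.
  have i0 : 0 <= \1_(~` A) x :> R by [].
  by rewrite normrM (ger0_norm i0) ler_wpM2r.
rewrite -normr_le0 -[X in _ <= X](mulr0 M) -PC -meanZ// ler_norml.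
have bMC : bmeas (fun x => M * (\1_(~` A) x : R)) by exact: bmeasZ.
have bfC : bmeas (fun x => f x * (\1_(~` A) x : R)) by exact: bmeasM.
rewrite -mulN1r -meanZ//; apply/andP; split; apply: le_mean => //.
- exact: bmeasZ.
- by move=> x; have := bnd x; rewrite ler_norml mulN1r => /andP[].
- by move=> x; have := bnd x; rewrite ler_norml => /andP[].
Qed.

End BoundedMeasurable.

Lemma bmeas_comp {R : realType} {d d'} {X : measurableType d}
    {Y : measurableType d'} (h : Y -> X) (f : X -> R) :
  measurable_fun setT h -> bmeas f -> bmeas (f \o h).
Proof.
move=> mh [mf [M hM]]; split; first exact: measurableT_comp.
by exists M => y; exact: hM.
Qed.

Section ParametricMean.
Context {R : realType} {d d' : measure_display}.
Context {X : measurableType d} {Y : measurableType d'}.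
Implicit Types f : X * Y -> R.

Lemma bmeas_section f x : bmeas f -> bmeas (fun y => f (x, y)).
Proof. by move=> bf; exact: (bmeas_comp (measurable_pair1 x) bf). Qed.

Lemma bmeas_mean (P : probability Y R) f : bmeas f ->
  bmeas (fun x => \int[P]_y f (x, y)).
Proof.
move=> bf; have [mf [M fM]] := bf; split; last first.
  by exists M => x; apply: norm_mean => //; exact: bmeas_section.
(* The shift by [M] makes the integrand nonnegative, as Tonelli's theorem requires. *)
have bfM : bmeas (fun z => f z + M) by apply: bmeasD => //; exact: bmeas_cst.
rewrite (_ : (fun x => _) = fun x => \int[P]_y (f (x, y) + M) - M); last first.
  apply/funext => x; rewrite meanD ?mean_cst ?addrK//; last exact: bmeas_cst.
  exact: bmeas_section.
apply: measurable_funB; last exact: measurable_cst.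
apply/measurable_EFinP.
rewrite (_ : EFin \o _ = fun x => (\int[P]_y (f (x, y) + M)%:E)%E); last first.
  apply/funext => x /=; rewrite EFin_mean//.
  exact: (bmeas_section x bfM).
apply: (measurable_fun_fubini_tonelli_F (m2 := P) (fun z => (f z + M)%:E)).
  by apply/measurable_EFinP; exact: bfM.1.
by move=> z /=; rewrite lee_fin -lerBlDr sub0r; have := fM z; rewrite ler_norml => /andP[].
Qed.

End ParametricMean.

Lemma mean_swap {R : realType} {d d' : measure_display}
    {X : measurableType d} {Y : measurableType d'}
    (P : probability X R) (Q : probability Y R) (f : X * Y -> R) : bmeas f ->
  \int[P]_x \int[Q]_y f (x, y) = \int[Q]_y \int[P]_x f (x, y).
Proof.
move=> bf.
have bfs : bmeas (fun z : Y * X => f (z.2, z.1)).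
  exact: (@bmeas_comp _ _ _ _ _ (fun z : Y * X => (z.2, z.1)) f
    (measurable_fun_pair measurable_snd measurable_fst) bf).
have b1 := bmeas_mean Q bf; have b2 := bmeas_mean P bfs.
apply: EFin_inj; rewrite !EFin_mean//.
have E1 x : (\int[Q]_y f (x, y))%:E = (\int[Q]_y (f (x, y))%:E)%E.
  by rewrite EFin_mean//; exact: bmeas_section.
have E2 y : (\int[P]_x f (x, y))%:E = (\int[P]_x (f (x, y))%:E)%E.
  by rewrite EFin_mean//; exact: (bmeas_section y bfs).
under eq_integral do rewrite E1.
under [RHS]eq_integral do rewrite E2.
apply: (@Fubini _ _ _ _ _ P Q (EFin \o f)).
exact: (bmeas_int (P \x Q)%E bf).
Qed.

Section SiteOperators.
Context {R : realType} {G : countType} {d : measure_display}.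
Context {S : measurableType d}.
Implicit Types (f g : config G S -> R) (w : config G S) (P Q : probability S R).
Implicit Types (PP : G -> probability S R) (k : G) (V : seq G).

Lemma measurable_coord k : measurable_fun setT (fun w : config G S => w k).
Proof.
move=> _ B mB; rewrite setTI; apply: sub_sigma_algebra; exists k => //.
by exists B => //; rewrite setTI.
Qed.

Lemma measurable_config {dY} {Y : measurableType dY} (h : Y -> config G S) :
  (forall i, measurable_fun setT (fun y => h y i)) -> measurable_fun setT h.
Proof.
move=> hi; apply: measurability => // _ [_ [i _ [B mB <-]] <-].
by rewrite setTI; exact: hi.
Qed.

Lemma measurable_update k :
  measurable_fun setT (fun z : config G S * S => update z.1 k z.2).
Proof.
apply: measurable_config => i; rewrite /update.
case: (i == k); first exact: measurable_snd.
by apply: (measurableT_comp (measurable_coord i)); exact: measurable_fst.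
Qed.

Lemma measurable_update1 w k :
  measurable_fun setT (fun s : S => update w k s).
Proof.
exact: (measurableT_comp (measurable_update k) (measurable_pair1 w)).
Qed.

Definition site_mean P k f : config G S -> R :=
  fun w => \int[P]_s f (update w k s).

(** Averaging over finitely many sites is an operator on functions of the whole configuration: the
    boundary condition stays the argument, and no measure on S^V has to be formed. *)
Definition site_means PP V f : config G S -> R :=
  foldr (fun k F => site_mean (PP k) k F) f V.

Definition indep k f := forall w s, f (update w k s) = f w.

Lemma updateK w k s t : update (update w k s) k t = update w k t.
Proof. by apply/funext => i; rewrite /update; case: eqP. Qed.

Lemma updateC w i j s t : i != j ->
  update (update w i s) j t = update (update w j t) i s.
Proof.
move=> ij; apply/funext => k; rewrite /update.
by case: eqP => // ->; rewrite eq_sym (negbTE ij).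
Qed.

Lemma bmeas_update f w k : bmeas f -> bmeas (fun s => f (update w k s)).
Proof. by move=> bf; exact: (bmeas_comp (measurable_update1 w k) bf). Qed.

Lemma bmeas_site_mean P k f : bmeas f -> bmeas (site_mean P k f).
Proof.
move=> bf; apply: (bmeas_mean P (f := fun z => f (update z.1 k z.2))).
exact: (bmeas_comp (measurable_update k) bf).
Qed.

Lemma bmeas_site_means PP V f : bmeas f -> bmeas (site_means PP V f).
Proof. by elim: V => //= k V IH bf; apply: bmeas_site_mean; exact: IH. Qed.

Lemma site_mean_comm P Q i j f : i != j -> bmeas f ->
  site_mean P i (site_mean Q j f) = site_mean Q j (site_mean P i f).
Proof.
move=> ij bf; apply/funext => w; rewrite /site_mean.
have := mean_swap P Q (f := fun z => f (update (update w i z.1) j z.2)).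
move=> ->; last first.
  have := @bmeas_comp _ _ _ _ _ (fun z : S * S => update (update w i z.1) j z.2) f.
  apply=> //.
  apply: (measurableT_comp (measurable_update j)
    (g := fun z : S * S => (update w i z.1, z.2))).
  apply: measurable_fun_pair; last exact: measurable_snd.
  exact: (measurableT_comp (measurable_update1 w i) measurable_fst).
by apply: eq_Rintegral => t _; apply: eq_Rintegral => s _ /=; rewrite updateC.
Qed.

Lemma site_meanMl P k g f : indep k g -> bmeas f ->
  site_mean P k (fun w => g w * f w) = fun w => g w * site_mean P k f w.
Proof.
move=> ig bf; apply/funext => w; rewrite /site_mean.
under eq_Rintegral do rewrite ig.
by rewrite meanZ//; exact: bmeas_update.
Qed.

Lemma indep_site_mean P k f : indep k (site_mean P k f).
Proof.
by move=> w s; apply: eq_Rintegral => t _; rewrite updateK.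
Qed.

Lemma site_mean_indep P k f : indep k f -> site_mean P k f = f.
Proof.
move=> kf; apply/funext => w; rewrite /site_mean.
by under eq_Rintegral do rewrite kf; rewrite mean_cst.
Qed.

Lemma indep_site_mean_neq P j k f : j != k -> indep k f -> indep k (site_mean P j f).
Proof.
move=> jk kf w s; apply: eq_Rintegral => t _.
by rewrite updateC 1?eq_sym// kf.
Qed.

Lemma site_means_cat PP V W f :
  site_means PP (V ++ W) f = site_means PP V (site_means PP W f).
Proof. by rewrite /site_means foldr_cat. Qed.

(** By Fubini the one-site averages commute, so a transposition argument on lists suffices. *)
Lemma site_means_perm PP V W f : perm_eq V W -> bmeas f ->
  site_means PP V f = site_means PP W f.
Proof.
elim: V W => [|k V IH] W VW bf.
  by have /perm_size/esym/size0nil -> := VW.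
have kW : k \in W by rewrite -(perm_mem VW) mem_head.
have [W1 [W2 WE]] : exists W1 W2, W = W1 ++ k :: W2.
  by case/splitPr: kW => W1 W2; exists W1, W2.
have {VW} VW : perm_eq V (W1 ++ W2).
  by rewrite perm_sym -(perm_cons k) perm_sym (permPl VW) WE -cat1s perm_catCA.
have E1 W' : site_means PP (W' ++ k :: W2) f = site_mean (PP k) k (site_means PP (W' ++ W2) f).
  elim: W' => //= j W' ->; case: (eqVneq j k) => [->//|jk].
  by rewrite site_mean_comm//; exact: bmeas_site_means.
by rewrite WE E1 /= (IH (W1 ++ W2)).
Qed.

End SiteOperators.

Section SiteMeans.
Context {R : realType} {G : countType} {d : measure_display}.
Context {S : measurableType d}.
Implicit Types (f g : config G S -> R) (w x : config G S).
Implicit Types (PP : G -> probability S R) (k : G) (V W : seq G).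

(** The averaged spins are coupled so as to be equal on both sides, while the sites outside [V] keep
    the values of [w] and [w']. Comparisons of integrands and of boundary conditions both take this
    form. *)
Lemma le_site_means2 PP V f g w w' : bmeas f -> bmeas g ->
  (forall x x', (forall k, k \notin V -> x k = w k) ->
    (forall k, k \notin V -> x' k = w' k) ->
    (forall k, k \in V -> x k = x' k) -> f x <= g x') ->
  site_means PP V f w <= site_means PP V g w'.
Proof.
move=> bf bg; elim: V w w' => [|k V IH] w w' fg /=.
  by apply: fg => // i; rewrite in_nil.
apply: le_mean.
- by apply: bmeas_update; exact: bmeas_site_means.
- by apply: bmeas_update; exact: bmeas_site_means.
move=> s; apply: IH => x x' xw xw' xx'; apply: fg.
- by move=> i; rewrite inE negb_or => /andP[ik iV]; rewrite xw// /update (negbTE ik).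
- by move=> i; rewrite inE negb_or => /andP[ik iV]; rewrite xw'// /update (negbTE ik).
- move=> i; have [iV _|iV] := boolP (i \in V); first exact: xx'.
  by rewrite inE (negbTE iV) orbF => /eqP ik; rewrite xw// xw'// /update ik eqxx.
Qed.

Lemma le_site_means PP V f g w : bmeas f -> bmeas g ->
  (forall x, (forall k, k \notin V -> x k = w k) -> f x <= g x) ->
  site_means PP V f w <= site_means PP V g w.
Proof.
move=> bf bg fg; apply: le_site_means2 => // x x' xw x'w xx'.
suff -> : x' = x by apply: fg => k /xw.
by apply/funext => k; have [/xx'|kV] := boolP (k \in V) => //; rewrite xw ?x'w.
Qed.

Lemma eq_site_means PP QQ V f : (forall k, k \in V -> PP k = QQ k) ->
  site_means PP V f = site_means QQ V f.
Proof.
elim: V => //= k V IH PQ; rewrite PQ ?mem_head// IH// => j jV.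
by rewrite PQ// inE jV orbT.
Qed.

Lemma site_meansD PP V f g w : bmeas f -> bmeas g ->
  site_means PP V (fun x => f x + g x) w = site_means PP V f w + site_means PP V g w.
Proof.
move=> bf bg; elim: V w => //= k V IH w.
rewrite /site_mean; under eq_Rintegral do rewrite IH.
by rewrite meanD//; apply: bmeas_update; exact: bmeas_site_means.
Qed.

Lemma site_meansMl PP V g f : (forall k, k \in V -> indep k g) ->
  bmeas f -> site_means PP V (fun w => g w * f w) = fun w => g w * site_means PP V f w.
Proof.
move=> + bf; elim: V => //= k V IH ig.
rewrite IH => [|j jV]; last by apply: ig; rewrite inE jV orbT.
by rewrite site_meanMl//; [apply: ig; exact: mem_head|exact: bmeas_site_means].
Qed.

Lemma site_meansZ PP V c f w : bmeas f ->
  site_means PP V (fun x => c * f x) w = c * site_means PP V f w.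
Proof. by move=> bf; rewrite (site_meansMl PP (V := V) (g := cst c)). Qed.

Lemma site_means_indep PP V f : (forall k, k \in V -> indep k f) ->
  site_means PP V f = f.
Proof.
elim: V => //= k V IH ig; rewrite IH => [|j jV]; last by apply: ig; rewrite inE jV orbT.
by rewrite site_mean_indep//; apply: ig; exact: mem_head.
Qed.

Lemma site_means_cst PP V c w : site_means PP V (cst c) w = c.
Proof. by rewrite site_means_indep. Qed.

Lemma indep_site_means PP V f k : (k \in V) \/ indep k f -> indep k (site_means PP V f).
Proof.
elim: V => /= [[//|//]|j V IH] kVf.
have [->|jk] := eqVneq j k; first exact: indep_site_mean.
apply: indep_site_mean_neq => //; apply: IH.
by case: kVf; [rewrite inE eq_sym (negbTE jk); left|right].
Qed.

(** After the inner average nothing depends on the sites of [W], so averaging over them again has no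
    effect. The tower property of Gibbs averages rests on this. *)
Lemma site_means_sub PP V W f : uniq V -> uniq W -> {subset W <= V} -> bmeas f ->
  site_means PP V (site_means PP W f) = site_means PP V f.
Proof.
move=> uV uW WV bf.
have p : perm_eq V ([seq k <- V | k \notin W] ++ W).
  apply: uniq_perm => //.
    rewrite cat_uniq filter_uniq// uW andbT/=; apply/hasPn => k kW.
    by rewrite mem_filter kW.
  move=> k; rewrite mem_cat mem_filter; have [kW|kW] := boolP (k \in W); rewrite ?orbF//=.
  by rewrite WV.
rewrite !(site_means_perm PP p)//; last exact: bmeas_site_means.
rewrite !site_means_cat; congr site_means; apply: site_means_indep => k kW.
by apply: indep_site_means; left.
Qed.

Lemma le_site_means_cst PP V f c w : bmeas f ->
  (forall x, (forall k, k \notin V -> x k = w k) -> f x <= c) ->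
  site_means PP V f w <= c.
Proof.
move=> bf fc; rewrite -(site_means_cst PP V c w); apply: le_site_means => //.
exact: bmeas_cst.
Qed.

Lemma ge_site_means_cst PP V f c w : bmeas f ->
  (forall x, (forall k, k \notin V -> x k = w k) -> c <= f x) ->
  c <= site_means PP V f w.
Proof.
move=> bf fc; rewrite -(site_means_cst PP V c w); apply: le_site_means => //.
exact: bmeas_cst.
Qed.

Definition override V (s w : config G S) : config G S :=
  fun k => if k \in V then s k else w k.

Lemma measurable_override V s : measurable_fun setT (override V s).
Proof.
apply: measurable_config => i; rewrite /override.
by case: (i \in V); [exact: measurable_cst|exact: measurable_coord].
Qed.

Lemma override_update V s w k t : k \notin V ->
  override V s (update w k t) = update (override V s w) k t.
Proof.
move=> kV; apply/funext => i; rewrite /override /update.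
by case: (eqVneq i k) => // ->; rewrite (negbTE kV).
Qed.

Lemma override_updateK V s w k t : k \in V ->
  override V s (update w k t) = override V s w.
Proof.
move=> kV; apply/funext => i; rewrite /override /update.
by case: ifPn => // iV; case: eqP iV kV => // -> /negbTE ->.
Qed.

Lemma site_means_override PP V W s f w : (forall k, k \in W -> k \notin V) ->
  site_means PP W (fun x => f (override V s x)) w = site_means PP W f (override V s w).
Proof.
elim: W w => //= k W IH w WV; apply: eq_Rintegral => t _.
rewrite IH => [|j jW]; last by apply: WV; rewrite inE jW orbT.
by rewrite override_update// WV// mem_head.
Qed.

End SiteMeans.

(** * Positive linear functionals on bounded functions *)

Record positive_linear {R : realType} {d} {X : measurableType d}
    (F : (X -> R) -> R) : Prop := PositiveLinear {
  plD : forall f g, bmeas f -> bmeas g -> F (fun x => f x + g x) = F f + F g ;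
  plZ : forall c f, bmeas f -> F (fun x => c * f x) = c * F f ;
  pl_le : forall f g, bmeas f -> bmeas g -> (forall x, f x <= g x) -> F f <= F g }.

(** The sum counts the levels 1, ..., n that lie below t: it is t rounded down, capped at n. *)
Lemma count_levels {R : realType} (t : R) (n : nat) : 0 <= t ->
  let N := \sum_(k < n) ((k.+1%:R <= t)%R)%:R in
  [/\ t - 1 <= N \/ n%:R <= N, N <= t & N <= n%:R].
Proof.
move=> t0; elim: n => [|n [l u v]] /=; first by rewrite big_ord0; split => //; right.
rewrite big_ord_recr/= -natr1; have [h|h] := lerP (n%:R + 1) t; rewrite ?mulr1n ?mulr0n ?addr0.
  by split; [right; case: l => ?; lra|lra|lra].
by split; [left; case: l => ?; lra|lra|lra].
Qed.

Section FunctionalEquality.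
Context {R : realType} {d : measure_display} {X : measurableType d}.
Implicit Types (F H : (X -> R) -> R).

Lemma pl0 F : positive_linear F -> F (fun=> 0) = 0.
Proof.
move=> pF; have := plZ pF 0 (bmeas_cst 0); rewrite mul0r => E.
by rewrite -[RHS]E; congr F; apply/funext => x; rewrite mul0r.
Qed.

Lemma pl_sum F n (u : nat -> X -> R) : positive_linear F -> (forall k, bmeas (u k)) ->
  bmeas (fun x => \sum_(k < n) u k x) /\
  F (fun x => \sum_(k < n) u k x) = \sum_(k < n) F (u k).
Proof.
move=> pF bu; elim: n => [|n [b E]].
  under [X in bmeas X]funext do rewrite big_ord0.
  under [X in F X]funext do rewrite big_ord0.
  rewrite big_ord0; split; first exact: bmeas_cst.
  exact: pl0.
under [X in bmeas X]funext do rewrite big_ord_recr.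
under [X in F X]funext do rewrite big_ord_recr.
rewrite big_ord_recr/= -E; split; first exact: bmeasD.
by rewrite (plD pF).
Qed.

(** Identities between averages (for the disintegration, the Gibbs property and measures built from
    functionals) are checked on indicators and extended by this. *)
Lemma eq_positive_linear F H : positive_linear F -> positive_linear H ->
  (forall A, measurable A -> F \1_A = H \1_A) -> forall f, bmeas f -> F f = H f.
Proof.
move=> pF pH FH.
have F1 : F (cst 1) = H (cst 1).
  by have := FH _ measurableT; rewrite indicT.
have F1_ge0 : 0 <= F (cst 1).
  have := pl_le pF (bmeas_cst 0) (bmeas_cst 1) (fun _ => ler01).
  by rewrite [F (cst 0)]pl0.
(* The layers [h >= k / n] give a uniform approximation of h by indicators. *)
have key h : bmeas h -> (forall x, 0 <= h x <= 1) -> forall n, (0 < n)%N ->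
    `|F h - H h| <= F (cst 1) / n%:R.
  move=> bh h01 n n0.
  pose u k x : R := \1_[set x | k.+1%:R <= n%:R * h x] x.
  have mA k : measurable [set x | k.+1%:R <= n%:R * h x].
    rewrite -[X in measurable X]setTI; apply: measurable_fun_le => //.
    by apply: measurable_funM => //; exact: bh.1.
  have bu k : bmeas (u k) by apply: bmeas_indic.
  pose s x := n%:R^-1 * \sum_(k < n) u k x.
  have [bs Fs] := pl_sum n pF bu; have [_ Hs] := pl_sum n pH bu.
  have FsHs : F s = H s.
    rewrite /s (plZ pF) ?(plZ pH)// Fs Hs; congr (_ * _).
    by apply: eq_bigr => k _; exact: FH.
  have n0' : 0 < n%:R :> R by rewrite ltr0n.
  have sh x : s x <= h x <= s x + n%:R^-1 * 1.
    have /andP[h0 h1] := h01 x.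
    have := count_levels n (mulr_ge0 (ltW n0') h0).
    rewrite (eq_bigr (fun k : 'I_n => u k x)) => [/= [l r _]|k _]; last first.
      by rewrite /u indicE; congr ((_ : bool)%:R); apply/idP/idP; rewrite inE.
    rewrite /s -mulrDr ler_pdivrMl// ler_pdivlMl//; apply/andP; split => //.
    have : n%:R * h x <= n%:R by rewrite ler_piMr// ltW.
    by case: l; lra.
  have bS : bmeas s by exact: bmeasZ.
  have b1 : bmeas (fun x : X => n%:R^-1 * cst 1 x : R) by apply: bmeasZ; exact: bmeas_cst.
  have bnd K : positive_linear K -> K s <= K h <= K s + n%:R^-1 * K (cst 1).
    move=> pK; rewrite -(plZ pK) -?(plD pK)//; last exact: bmeas_cst.
    apply/andP; split; apply: (pl_le pK) => //; try exact: bmeasD.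
      by move=> x; have /andP[] := sh x.
    by move=> x; have /andP[] := sh x.
  have /andP[a1 a2] := bnd _ pF; have /andP[a3 a4] := bnd _ pH.
  by rewrite -FsHs -F1 in a3 a4; rewrite ler_norml mulrC; apply/andP; split; lra.
have key0 h : bmeas h -> (forall x, 0 <= h x <= 1) -> F h = H h.
  move=> bh h01; apply/eqP; rewrite -subr_eq0 -normr_le0; apply/ler_addgt0Pl => e e0.
  rewrite addr0; pose n := (Num.trunc (F (cst 1) / e)).+1.
  apply: le_trans (key h bh h01 n isT) _.
  rewrite ler_pdivrMr// mulrC -ler_pdivrMr// ltW//.
  by rewrite /n truncnS_gt.
move=> f bf; have [M fM] := bf.2.
(* Adding |M| + 1 and dividing by [c] maps the range of [f] into [0, 1]; the summand 1 keeps [c]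
   positive. *)
pose c := 2 * (`|M| + 1).
have c0 : 0 < c by rewrite mulr_gt0// ltr_pwDr.
pose h x := c^-1 * (f x + (`|M| + 1)).
have bM : bmeas (cst (`|M| + 1) : X -> R) by exact: bmeas_cst.
have bfM : bmeas (fun x => f x + (`|M| + 1)) by exact: bmeasD.
have bh : bmeas h by exact: bmeasZ.
have : F h = H h.
  apply: key0 => // x; rewrite /h; have := fM x; rewrite ler_norml => /andP[].
  have := ler_norm M => *; rewrite ler_pdivrMl// mulr_ge0 ?invr_ge0 ?(ltW c0)//=.
    by rewrite /c; lra.
  by lra.
have E K : positive_linear K -> K h = c^-1 * (K f + (`|M| + 1) * K (cst 1)).
  move=> pK; rewrite -(plZ pK (`|M| + 1) (bmeas_cst 1)).
  rewrite /h (plZ pK c^-1 bfM); congr (_ * _); rewrite -(plD pK)//.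
    by congr K; apply/funext => x /=; rewrite mulr1.
  by apply: bmeasZ; exact: bmeas_cst.
rewrite !E// F1 => /(mulfI _) -/(_ _)/addIr; apply.
by rewrite invr_eq0 gt_eqF.
Qed.

End FunctionalEquality.

Ltac lr := intros; lra.
Ltac bm := repeat first [assumption | exact: bmeas_cst | apply: bmeasD
  | apply: bmeasB | apply: bmeasN | apply: bmeasM].

(** This is exp(-c) >= 1 - c multiplied by exp c. The expression is the derivative of the auxiliary
    function in the next lemma. *)
Lemma expR_ge_tangent {R : realType} (c : R) : 0 <= 1 + (c - 1) * expR c.
Proof.
have := expR_ge1Dx (- c); rewrite expRN -(ler_pM2l (expR_gt0 c)).
by rewrite divff ?gt_eqF ?expR_gt0// => h; lra.
Qed.

(* This is [tanh t <= t]. *)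
Lemma expR_sub1_le {R : realType} (t : R) : 0 <= t ->
  expR t - 1 <= t / 2 * (expR t + 1).
Proof.
move=> t0; pose f (x : R) := x * (expR x + 1) - 2 * expR x.
have df x : is_derive x (1 : R) f (1 + (x - 1) * expR x).
  by apply: is_derive_eq; rewrite /GRing.scale/= /GRing.scale/=; lr.
have cf : {within `[0, t], continuous f}.
  by apply: derivable_within_continuous => x _; exact: ex_derive.
have [c _ ftc] := MVT_segment t0 (fun x _ => df x) cf.
have : 0 <= f t - f 0 by rewrite ftc mulr_ge0 ?expR_ge_tangent// subr0.
by rewrite /f expR0 mul0r sub0r mulr1 => h; lra.
Qed.

(** The quotient of |exp x - exp y| by exp x + exp y is tanh(|x - y| / 2), hence at most |x - y| /
    2. *)
Lemma expR_dist_le {R : realType} (x y K : R) : `|x - y| <= 2 * K ->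
  `|expR x - expR y| <= K * (expR x + expR y).
Proof.
wlog xy : x y / y <= x.
  move=> h; have [xy|/ltW xy] := leP y x; first exact: h.
  by rewrite distrC => /(h _ _ xy); rewrite distrC [expR y + _]addrC.
rewrite ger0_norm ?subr_ge0// ger0_norm ?subr_ge0 ?ler_expR// => xyK.
have xy0 : 0 <= x - y by rewrite subr_ge0.
have := expR_sub1_le xy0; rewrite -(ler_pM2l (expR_gt0 y)).
have -> : expR x = expR y * expR (x - y) by rewrite -expRD; congr expR; lr.
have e0 := expR_gt0 (x - y); have e1 := expR_gt0 y.
move=> h; rewrite -[X in _ - X]mulr1 -mulrBr (le_trans h)//.
rewrite [leRHS](_ : _ = expR y * (K * (expR (x - y) + 1))); last lr.
by rewrite ler_wpM2l ?ler_wpM2r; lr.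
Qed.

(** * Dobrushin comparison in finite volume *)

Section Tilting.
Context {R : realType} {d : measure_display} {X : measurableType d}.
Variables (P : probability X R) (p q g : X -> R) (A : set X) (K delta c : R).
Hypotheses (bp : bmeas p) (bq : bmeas q) (bg : bmeas g).
Hypotheses (c0 : 0 < c) (cp : forall x, c <= p x) (cq : forall x, c <= q x).
Hypotheses (mA : measurable A) (PA : P A = 1%E).
Hypotheses (g_osc : forall s t, `|g s - g t| <= delta).
Hypothesis (pqK : forall s t, A s -> A t ->
  `|q s * p t - q t * p s| <= K * (q s * p t + q t * p s)).

Let b1 : bmeas (\1_A : X -> R). Proof. exact: bmeas_indic. Qed.
Let p' x := p x * \1_A x. Let q' x := q x * \1_A x.
Let bp' : bmeas p'. Proof. exact: bmeasM. Qed.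
Let bq' : bmeas q'. Proof. exact: bmeasM. Qed.

Let pqK' s t : `|q' s * p' t - q' t * p' s| <= K * (q' s * p' t + q' t * p' s).
Proof.
rewrite /p' /q' !indicE; have [As|As] := boolP (s \in A); last first.
  by rewrite !(mulr0, mul0r) subrr normr0 addr0 mulr0.
have [At|At] := boolP (t \in A); last first.
  by rewrite !(mulr0, mul0r) subrr normr0 addr0 mulr0.
by rewrite !mulr1; apply: pqK; exact/set_mem.
Qed.

(* [2 (int gq int p - int gp int q)] is the double integral of
   [(g s - g t) (q s p t - q t p s)]. *)
Lemma tilted_mean_le :
  (\int[P]_x (g x * q x)) / \int[P]_x q x - (\int[P]_x (g x * p x)) / \int[P]_x p x
  <= K * delta.
Proof.
have bgp' : bmeas (fun x => g x * p' x) by exact: bmeasM.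
have bgq' : bmeas (fun x => g x * q' x) by exact: bmeasM.
have mp : \int[P]_x p x = \int[P]_x p' x by exact: mean_restrict.
have mq : \int[P]_x q x = \int[P]_x q' x by exact: mean_restrict.
have mgp : \int[P]_x (g x * p x) = \int[P]_x (g x * p' x).
  rewrite (mean_restrict mA PA); last exact: bmeasM.
  by apply: eq_Rintegral => x _; rewrite mulrA.
have mgq : \int[P]_x (g x * q x) = \int[P]_x (g x * q' x).
  rewrite (mean_restrict mA PA); last exact: bmeasM.
  by apply: eq_Rintegral => x _; rewrite mulrA.
have p0 : 0 < \int[P]_x p x.
  rewrite (lt_le_trans c0)// -{1}(mean_cst P c) le_mean//; exact: bmeas_cst.
have q0 : 0 < \int[P]_x q x.
  rewrite (lt_le_trans c0)// -{1}(mean_cst P c) le_mean//; exact: bmeas_cst.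
rewrite mp mq mgp mgq in p0 q0 *.
set ip := \int[P]_x p' x in p0 *; set iq := \int[P]_x q' x in q0 *.
set igp := \int[P]_x (g x * p' x); set igq := \int[P]_x (g x * q' x).
have -> : igq / iq - igp / ip = (igq * ip - igp * iq) / (iq * ip).
  have e1 : ip / ip = 1 by rewrite divff ?gt_eqF.
  have e2 : iq / iq = 1 by rewrite divff ?gt_eqF.
  rewrite mulrBl invfM mulrACA e1 mulr1; congr (_ - _).
  by rewrite [iq^-1 * _]mulrC mulrACA e2 mulr1.
rewrite ler_pdivrMr ?mulr_gt0//.
have inner s : (g s * q' s) * ip + (- (g s * p' s)) * iq + (- q' s) * igp + p' s * igq
    <= K * delta * (q' s * ip + p' s * iq).
  rewrite -!meanZ// -!meanD//; try by bm.
  rewrite -meanZ; last by bm.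
  apply: le_mean => [||t]; try by bm.
  have h1 := pqK' s t; have h2 := g_osc s t.
  have h3 : `|(g s - g t) * (q' s * p' t - q' t * p' s)| <= delta * (K * (q' s * p' t + q' t * p' s)).
    by rewrite normrM ler_pM.
  by move: (le_trans (ler_norm _) h3); lr.
have outer : \int[P]_s ((g s * q' s) * ip + (- (g s * p' s)) * iq + (- q' s) * igp + p' s * igq)
    <= \int[P]_s (K * delta * (q' s * ip + p' s * iq)).
  by apply: le_mean => //; bm.
move: outer.
have E1 : \int[P]_s ((g s * q' s) * ip + (- (g s * p' s)) * iq + (- q' s) * igp + p' s * igq)
  = 2 * (igq * ip - igp * iq).
  rewrite (_ : (fun s => _) = fun s => ip * (g s * q' s) + (- iq) * (g s * p' s)
     + (- igp) * q' s + igq * p' s); last by apply/funext => s; lr.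
  rewrite !meanD ?meanZ//; try by bm.
  by rewrite -/ip -/iq -/igp -/igq; lr.
have E2 : \int[P]_s (K * delta * (q' s * ip + p' s * iq)) = 2 * (K * delta * (iq * ip)).
  rewrite meanZ; last by bm.
  rewrite (_ : (fun s => _) = fun s => ip * q' s + iq * p' s); last first.
    by apply/funext => s; lr.
  rewrite meanD ?meanZ//; try by bm.
  by rewrite -/ip -/iq; lr.
by rewrite E1 E2 ler_pM2l.
Qed.

End Tilting.

(** A constant added to an energy is invisible after normalization, so only the oscillation of
    [b - a] counts, and only on a set [A] of full measure. This is where confinement of the spin to
    one piece enters. *)
Lemma tilted_mean_diff {R : realType} {d} {X : measurableType d}
    (P : probability X R) (a b g : X -> R) (A : set X) (K delta : R) :
  bmeas a -> bmeas b -> bmeas g -> measurable A -> P A = 1%E ->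
  (forall s t, `|g s - g t| <= delta) ->
  (forall s t, A s -> A t -> `|b s - a s - (b t - a t)| <= 2 * K) ->
  `|(\int[P]_x (g x * expR (- b x))) / \int[P]_x expR (- b x)
    - (\int[P]_x (g x * expR (- a x))) / \int[P]_x expR (- a x)| <= K * delta.
Proof.
move=> ba bb bg mA PA gd abK.
have [M aM] := ba.2; have [N bN] := bb.2.
have be (f : X -> R) : bmeas f -> bmeas (fun x => expR (- f x)) by move=> bf; apply: bmeas_exp; bm.
have ca x : expR (- (`|M| + `|N|)) <= expR (- a x).
  rewrite ler_expR lerN2; have := aM x; rewrite ler_norml => /andP[_ h].
  by have := ler_norm M; have := normr_ge0 N; lr.
have cb x : expR (- (`|M| + `|N|)) <= expR (- b x).
  rewrite ler_expR lerN2; have := bN x; rewrite ler_norml => /andP[_ h].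
  by have := ler_norm N; have := normr_ge0 M; lr.
have pq s t : A s -> A t ->
    `|expR (- b s) * expR (- a t) - expR (- b t) * expR (- a s)| <=
    K * (expR (- b s) * expR (- a t) + expR (- b t) * expR (- a s)).
  move=> As At; rewrite -!expRD; apply: expR_dist_le.
  rewrite distrC (_ : _ - _ = b s - a s - (b t - a t)); first exact: abK.
  by lra.
have up g' : bmeas g' -> (forall s t, `|g' s - g' t| <= delta) ->
    (\int[P]_x (g' x * expR (- b x))) / \int[P]_x expR (- b x)
    - (\int[P]_x (g' x * expR (- a x))) / \int[P]_x expR (- a x) <= K * delta.
  move=> bg' g'd.
  exact: (tilted_mean_le (be _ ba) (be _ bb) bg' (expR_gt0 _) ca cb mA PA g'd pq).
rewrite ler_norml; apply/andP; split; last exact: up.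
have := up (fun x => - g x) (bmeasN bg).
have N1 (f : X -> R) : bmeas f -> \int[P]_x (- g x * f x) = - \int[P]_x (g x * f x).
  move=> bf; rewrite -mulN1r -meanZ; last by bm.
  by apply: eq_Rintegral => x _; rewrite mulN1r mulNr.
rewrite !N1; try exact: be.
move=> h; have : forall s t, `|- g s - - g t| <= delta.
  by move=> s t; rewrite -opprD normrN; exact: gd.
by move=> /h; rewrite !mulNr => h1; lra.
Qed.

Section FiniteVolume.
Context {R : realType} {G : countType} {d : measure_display}.
Context {S : measurableType d}.
Implicit Types (f : config G S -> R) (w x : config G S) (k l : G).
Variables (PP : G -> probability S R) (E : config G S -> R).
Hypothesis bE : bmeas E.

Definition boltzmann x := expR (- E x).

Definition gibbs_mean W f w : R :=
  site_means PP W (fun x => f x * boltzmann x) w / site_means PP W boltzmann w.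

Definition bounded_var (V : seq G) (D : G -> R) f : Prop :=
  forall l, l \in V -> forall w w', agree_off l w w' -> `|f w - f w'| <= D l.

Let bB : bmeas boltzmann.
Proof. by apply: bmeas_exp; exact: bmeasN. Qed.

Lemma boltzmann_lb : exists2 c : R, 0 < c & forall x, c <= boltzmann x.
Proof.
have [M EM] := bE.2; exists (expR (- M)); first exact: expR_gt0.
by move=> x; rewrite ler_expR lerN2; have := EM x; rewrite ler_norml => /andP[].
Qed.

Lemma partition_lb : exists2 c : R, 0 < c & forall W x, c <= site_means PP W boltzmann x.
Proof.
have [c c0 cB] := boltzmann_lb; exists c => // W x.
exact: ge_site_means_cst.
Qed.

Lemma partition_gt0 W x : 0 < site_means PP W boltzmann x.
Proof. by have [c c0 cB] := partition_lb; exact: lt_le_trans (cB W x). Qed.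

Lemma bmeas_gibbs_mean W f : bmeas f -> bmeas (gibbs_mean W f).
Proof.
move=> bf; have [c c0 cB] := partition_lb.
apply: bmeasM; first by apply: bmeas_site_means; exact: bmeasM.
by apply: (bmeas_inv c0) => //; exact: bmeas_site_means.
Qed.

(** The normalization of the one-site average does not depend on the spin at [k], so it comes out of
    the average over [k] and cancels: resampling one site preserves the Gibbs average. *)
Lemma gibbs_mean_sub W k f : uniq W -> k \in W -> bmeas f ->
  gibbs_mean W (gibbs_mean [:: k] f) = gibbs_mean W f.
Proof.
move=> uW kW bf; have bfB : bmeas (fun x => f x * boltzmann x) by exact: bmeasM.
have sW : {subset [:: k] <= W} by move=> j; rewrite inE => /eqP ->.
apply/funext => w; congr (_ / _).
rewrite -(site_means_sub PP (W := [:: k]))//; last first.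
  by apply: bmeasM => //; exact: bmeas_gibbs_mean.
rewrite -[in RHS](site_means_sub PP (W := [:: k]))//.
congr (site_means PP W _ w); rewrite site_meansMl//; last first.
  move=> j; rewrite inE => /eqP -> {}w s; rewrite /gibbs_mean.
  by rewrite !indep_site_means//; left; rewrite mem_head.
by apply/funext => x; rewrite /gibbs_mean divfK// gt_eqF// partition_gt0.
Qed.

Lemma le_gibbs_mean_cst W f w a : bmeas f ->
  (forall x, (forall k, k \notin W -> x k = w k) -> f x <= a) ->
  gibbs_mean W f w <= a.
Proof.
move=> bf fa; rewrite ler_pdivrMr ?partition_gt0// -site_meansZ//.
apply: le_site_means => [||x xw]; [exact: bmeasM|exact: bmeasZ|].
by rewrite ler_wpM2r ?expR_ge0// fa.
Qed.

Lemma ge_gibbs_mean_cst W f w a : bmeas f ->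
  (forall x, (forall k, k \notin W -> x k = w k) -> a <= f x) ->
  a <= gibbs_mean W f w.
Proof.
move=> bf fa; rewrite ler_pdivlMr ?partition_gt0// -site_meansZ//.
apply: le_site_means => [||x xw]; [exact: bmeasZ|exact: bmeasM|].
by rewrite ler_wpM2r ?expR_ge0// fa.
Qed.

Lemma bounded_var_sum V D f w w' : bounded_var V D f ->
  (forall k, k \notin V -> w k = w' k) -> `|f w - f w'| <= \sum_(l <- V) D l.
Proof.
elim: V w w' => [|l V IH] w w' fD ww'.
  rewrite big_nil (_ : w = w') ?subrr ?normr0//.
  by apply/funext => k; exact: ww'.
rewrite big_cons -(subrK (f (update w l (w' l))) (f w)) -addrA.
rewrite (le_trans (ler_normD _ _))// lerD//.
  by apply: fD; [exact: mem_head|move=> k /= kl; rewrite /update (negbTE kl)].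
apply: IH => [k kV|k kV]; first by apply: fD; rewrite inE kV orbT.
rewrite /update; case: eqVneq => [->//|kl].
by apply: ww'; rewrite inE negb_or kl.
Qed.

Variables (A : G -> set S) (C : G -> G -> R) (W : seq G) (j : G).
Hypotheses (mA : forall k, measurable (A k)) (PA : forall k, PP k (A k) = 1%E).
Hypothesis C0 : forall k l, 0 <= C k l.
Hypothesis E_lip : forall k l w w' s t, k \in W -> k != l -> agree_off l w w' ->
  A k s -> A k t ->
  `|E (update w k s) - E (update w' k s) - (E (update w k t) - E (update w' k t))|
    <= 2 * C k l.

(** A change at [l] acts twice: on the integrand, by at most [D l], and on the law at [k], which
    shifts by at most [C k l] times the oscillation [D k] of the integrand. The spin at [k] itself
    is integrated out. *)
Lemma gibbs_mean1_var k D f : k \in W -> bmeas f -> (forall l, 0 <= D l) ->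
  bounded_var (j :: W) D f ->
  bounded_var (j :: W) (fun l => if l == k then 0 else D l + C k l * D k)
    (gibbs_mean [:: k] f).
Proof.
move=> kW bf D0 fD l lW w w' ww'; case: (eqVneq l k) => [lk|lk].
  have -> : w = update w' k (w k).
    by apply/funext => i; rewrite /update; case: (eqVneq i k) => [->//|ik];
      apply: ww'; rewrite /= lk.
  rewrite {1}/gibbs_mean.
  have ii h : site_means PP [:: k] h (update w' k (w k)) = site_means PP [:: k] h w'.
    by apply: indep_site_means; left; rewrite mem_head.
  by rewrite !ii subrr normr0.
have upd s : agree_off l (update w k s) (update w' k s).
  by move=> i il; rewrite /update; case: eqP => // _; exact: ww'.
pose g s := f (update w' k s).
have bB1 v : bmeas (fun s => E (update v k s)) by exact: bmeas_update.
have bB2 v : bmeas (fun s => boltzmann (update v k s)) by exact: bmeas_update.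
have bf1 v : bmeas (fun s => f (update v k s)) by exact: bmeas_update.
have bg : bmeas g by exact: bf1.
have fg s : `|f (update w k s) - g s| <= D l by exact: fD.
have i0 : 0 < \int[PP k]_s boltzmann (update w k s) := partition_gt0 [:: k] w.
have h1 : `|gibbs_mean [:: k] f w - (\int[PP k]_s (g s * boltzmann (update w k s)))
    / \int[PP k]_s boltzmann (update w k s)| <= D l.
  rewrite /gibbs_mean/= /site_mean -mulrBl normf_div (gtr0_norm i0).
  rewrite ler_pdivrMr// -meanB; [|exact: bmeasM|exact: bmeasM].
  have -> : (fun s => f (update w k s) * boltzmann (update w k s) - g s * boltzmann (update w k s))
    = fun s => (f (update w k s) - g s) * boltzmann (update w k s).
    by apply/funext => s; rewrite mulrBl.
  rewrite -meanZ// ler_norml -mulN1r -meanZ; last exact: bmeasZ.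
  have bfg : bmeas (fun s => f (update w k s) - g s) by exact: bmeasB.
  apply/andP; split; apply: le_mean; try (by do ?apply: bmeasZ);
    try exact: bmeasM; move=> s; have := fg s; rewrite ler_norml => /andP[? ?].
    by rewrite mulrA ler_wpM2r ?expR_ge0// mulN1r.
  by rewrite ler_wpM2r ?expR_ge0.
have h2 : `|(\int[PP k]_s (g s * boltzmann (update w k s)))
    / \int[PP k]_s boltzmann (update w k s) - gibbs_mean [:: k] f w'| <= C k l * D k.
  apply: (tilted_mean_diff (bB1 w') (bB1 w) (bf1 w') (mA k) (PA k)) => s t.
    apply: fD; first by rewrite inE kW orbT.
    by move=> i /= ik; rewrite /update (negbTE ik).
  by apply: E_lip => //; rewrite eq_sym.
by move: (lerD h1 h2); apply: le_trans; apply: le_trans (ler_normD _ _); rewrite subrKA.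
Qed.

Variables (b : G -> R) (c : R).
Hypotheses (uW : uniq (j :: W)) (b0 : forall l, 0 <= b l) (bj : 1 <= b j).
Hypothesis b_super : forall k, k \in W -> \sum_(i <- j :: W) C k i * b i <= b k.
Hypotheses (c0 : 0 <= c) (c1 : c < 1).
Hypothesis C_row : forall k, k \in W -> \sum_(i <- W) C k i <= c.

Variables (w w' : config G S).
Hypothesis ww' : agree_off j w w'.

(** Quantifying over all observables allows an estimate to be applied to the one-site average of an
    observable, and thereby to be improved. *)
Definition estimate (a : G -> R) : Prop := forall f D, bmeas f ->
  (forall l, 0 <= D l) -> bounded_var (j :: W) D f ->
  `|gibbs_mean W f w - gibbs_mean W f w'| <= \sum_(l <- j :: W) a l * D l.

Lemma estimate_le a a' : (forall l, l \in j :: W -> a l <= a' l) ->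
  estimate a -> estimate a'.
Proof.
move=> aa' ea f D bf D0 fD; apply: le_trans (ea f D bf D0 fD) _.
rewrite big_seq [leRHS]big_seq; apply: ler_sum => l lW.
by rewrite ler_wpM2r// aa'.
Qed.

(** Apply the estimate to the average of [f] over [k]: the coefficient of [k] drops out, and the
    variation [D k] reappears at each site [i] that influences [k], with weight [C k i]. *)
Lemma estimate_update a k : k \in W -> estimate a ->
  estimate (fun l => if l == k then \sum_(i <- j :: W | i != k) C k i * a i else a l).
Proof.
move=> kW ea f D bf D0 fD.
have uW' : uniq W by case/andP: uW.
rewrite -(gibbs_mean_sub uW' kW bf).
have := ea _ _ (bmeas_gibbs_mean [:: k] bf) _ (gibbs_mean1_var kW bf D0 fD).
have D'0 l : 0 <= (if l == k then 0 else D l + C k l * D k).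
  by case: ifP => // _; rewrite addr_ge0// mulr_ge0.
move=> /(_ D'0) /le_trans; apply.
have kjW : k \in j :: W by rewrite inE kW orbT.
rewrite [leRHS](bigD1_seq k)//= [leLHS](bigD1_seq k)//= eqxx mulr0 add0r.
rewrite mulr_suml -big_split/= ler_sum// => l lk; rewrite (negbTE lk).
by rewrite mulrDr addrC mulrCA mulrA [a l * _]mulrC -mulrA [a l * D k]mulrC mulrA.
Qed.

(** Updating every site of [W] once is a Gauss-Seidel sweep. As [b] is a supersolution it is
    reproduced by each update, while the excess [e] is multiplied by a row sum, at most [c]. The
    boundary site [j] is never updated and carries no excess. *)
Lemma estimate_sweep (e : R) : 0 <= e ->
  estimate (fun l => b l + if l \in W then e else 0) ->
  estimate (fun l => b l + if l \in W then c * e else 0).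
Proof.
move=> e0 ee.
(* [V] is the set of sites already updated in this sweep. *)
suff : forall V : seq G, {subset V <= W} -> estimate (fun l => b l +
    if l \in V then c * e else if l \in W then e else 0).
  move=> /(_ W) h; apply: estimate_le (h _) => // l _.
  by case: (l \in W).
elim=> [_|k V IH VW].
  by apply: estimate_le ee => l _; rewrite in_nil.
have kW : k \in W by apply: VW; exact: mem_head.
have {}IH : estimate (fun l => b l + (if l \in V then c * e else if l \in W then e else 0)).
  by apply: IH => l lV; apply: VW; rewrite inE lV orbT.
have ce : c * e <= e by rewrite ler_piMl// ltW.
have ce0 : 0 <= c * e by rewrite mulr_ge0.
apply: estimate_le (estimate_update kW IH) => l lW.
case: (eqVneq l k) => [->|lk]; last first.
  by rewrite inE (negbTE lk) /= lexx.
rewrite mem_head.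
apply: (@le_trans _ _ (\sum_(i <- j :: W) C k i * (b i + if i \in W then e else 0))).
  rewrite [leLHS]big_mkcond ler_sum// => i _; case: (i != k).
    rewrite ler_wpM2l// lerD2l; have [iV|iV] := boolP (i \in V).
      by rewrite VW// inE iV orbT.
    exact: lexx.
  by rewrite mulr_ge0// addr_ge0//; case: ifP.
under eq_bigr do rewrite mulrDr.
rewrite big_split/= lerD//; first exact: b_super.
rewrite big_cons; have /andP[/negbTE -> _] := uW; rewrite mulr0 add0r.
rewrite (eq_big_seq (fun i => C k i * e)); last by move=> i ->.
by rewrite -mulr_suml ler_wpM2r// C_row.
Qed.

Lemma dobrushin_comparison f D : bmeas f -> (forall l, 0 <= D l) ->
  bounded_var (j :: W) D f ->
  `|gibbs_mean W f w - gibbs_mean W f w'| <= \sum_(l <- j :: W) b l * D l.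
Proof.
move=> bf D0 fD.
(* Crude starting point: each of the two Gibbs averages differs from a value of [f] by at most the
   total variation over [W], whence the excess 2. *)
have start : estimate (fun l => b l + if l \in W then 2 else 0).
  move=> {D0 fD bf}f {}D bf D0 fD.
  have fDW : bounded_var W D f by move=> l lW; apply: fD; rewrite inE lW orbT.
  have near v : `|gibbs_mean W f v - f v| <= \sum_(l <- W) D l.
    have l : f v - \sum_(l <- W) D l <= gibbs_mean W f v.
      apply: ge_gibbs_mean_cst => // x xv.
      by have := bounded_var_sum fDW xv; rewrite ler_norml => /andP[? _]; lra.
    have u : gibbs_mean W f v <= f v + \sum_(l <- W) D l.
      apply: le_gibbs_mean_cst => // x xv.
      by have := bounded_var_sum fDW xv; rewrite ler_norml => /andP[_ ?]; lra.
    by rewrite ler_norml; apply/andP; split; lra.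
  have h1 := near w; have h2 := near w'; rewrite distrC in h2.
  have h3 : `|f w - f w'| <= D j by apply: fD => //; exact: mem_head.
  have h : `|gibbs_mean W f w - gibbs_mean W f w'| <= D j + 2 * \sum_(l <- W) D l.
    by move: h1 h2 h3; rewrite !ler_norml => /andP[? ?] /andP[? ?] /andP[? ?];
      apply/andP; split; lra.
  apply: (le_trans h); rewrite big_cons; have /andP[/negbTE -> _] := uW.
  rewrite addr0 lerD//; first by rewrite ler_peMl.
  rewrite mulr_sumr big_seq [leRHS]big_seq ler_sum// => l lW.
  by rewrite lW ler_wpM2r// lerDr.
have iter n : estimate (fun l => b l + if l \in W then c ^+ n * 2 else 0).
  elim: n => [|n IH].
    by apply: estimate_le start => l _; rewrite expr0 mul1r.
  apply: estimate_le (estimate_sweep _ IH) => [l _|]; last by rewrite mulr_ge0// exprn_ge0.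
  by rewrite exprS mulrA.
apply/ler_addgt0Pr => e e0.
(* After n sweeps the remaining error is [c ^+ n * K]. Dividing by [K + 1] below covers the case K =
   0. *)
pose K := 2 * \sum_(l <- W) D l.
have K0 : 0 <= K by rewrite mulr_ge0// sumr_ge0.
have /cvgrPdist_lt /(_ (e / (K + 1))) : (GRing.exp c : R^nat) @ \oo --> (0 : R).
  by apply: cvg_expr; rewrite ger0_norm.
have eK : 0 < e / (K + 1) by rewrite divr_gt0// ltr_wpDl.
move=> /(_ eK) [n _ /(_ n (leqnn n))] /=.
rewrite sub0r normrN ger0_norm ?exprn_ge0// => cn.
apply: le_trans (iter n f D bf D0 fD) _.
under [leLHS]eq_bigr do rewrite mulrDl.
rewrite big_split/= lerD2l big_cons; have /andP[/negbTE -> _] := uW.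
rewrite mul0r add0r (eq_big_seq (fun i => c ^+ n * 2 * D i)); last by move=> i ->.
rewrite -mulr_sumr -mulrA -/K (@le_trans _ _ (c ^+ n * (K + 1)))//.
  by rewrite ler_wpM2l ?exprn_ge0// lerDl.
by rewrite -ler_pdivlMr ?ltr_wpDl// ltW.
Qed.

End FiniteVolume.

Lemma expR_lip {R : realType} (M x y : R) : x <= M -> y <= M ->
  `|expR x - expR y| <= expR M * `|x - y|.
Proof.
wlog xy : x y / y <= x.
  move=> h xM yM; have [xy|/ltW xy] := leP y x; first exact: h.
  by rewrite (distrC (expR x)) (distrC x) h.
move=> xM yM; rewrite !ger0_norm ?subr_ge0 ?ler_expR//.
have -> : expR x - expR y = expR x * (1 - expR (y - x)).
  by rewrite mulrBr mulr1 -expRD; congr (_ - expR _); lra.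
apply: ler_pM => //; rewrite ?expR_ge0 ?ler_expR//.
  by rewrite subr_ge0 -expR0 ler_expR subr_le0.
by have := expR_ge1Dx (y - x) => h; lra.
Qed.

(** * Constrained partition functions *)

Section CrossRatio.
Context {R : realType} {G : countType} {d : measure_display}.
Context {S : measurableType d}.
Implicit Types (w x : config G S) (k l j : G) (F W L : seq G).

Variable same_piece : S -> S -> Prop.
Variable H : {fset G} -> config G S -> R.

(* [H V] stands for the Hamiltonian H_V.  [C] bounds half of its mixed variations within
   pieces, and [D] is a supersolution of D = 1 + C D, such as the Neumann series of C.
   [Delta V k] bounds the variation of [H V] at the site k, and [kappa V j] the sum over k of
   [Delta V k * D k j]. *)
Record dobrushin_model (C D : G -> G -> R) (c : R) (M : {fset G} -> R)
    (Delta kappa : {fset G} -> G -> R) : Prop := {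
  dm_meas : forall V, bmeas (H V) ;
  dm_local : forall (L V : {fset G}) w w', (L `<=` V)%fset ->
    (forall k, k \notin L -> w k = w' k) -> H V w - H V w' = H L w - H L w' ;
  dm_quasilocal : forall V, quasilocal (H V) ;
  dm_lip : forall k l w w' s t, k != l -> agree_off l w w' -> same_piece s t ->
    `|H [fset k]%fset (update w k s) - H [fset k]%fset (update w' k s)
      - (H [fset k]%fset (update w k t) - H [fset k]%fset (update w' k t))| <= 2 * C k l ;
  dm_C0 : forall k l, 0 <= C k l ;
  dm_D0 : forall k l, 0 <= D k l ;
  dm_c : 0 <= c < 1 ;
  dm_row : forall k F, uniq F -> \sum_(i <- F) C k i <= c ;
  dm_super : forall k j F, uniq F ->
    (k == j)%:R + \sum_(i <- F) C k i * D i j <= D k j ;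
  dm_bound : forall V w, `|H V w| <= M V ;
  dm_Delta0 : forall V k, 0 <= Delta V k ;
  dm_Delta : forall (V : {fset G}) k w w', k \notin V -> agree_off k w w' ->
    `|H V w - H V w'| <= Delta V k ;
  dm_kappa : forall (V : {fset G}) j F, uniq F -> (forall k, k \in F -> k \notin V) ->
    \sum_(k <- F) Delta V k * D k j <= kappa V j ;
  dm_tail : forall (V : {fset G}) e, 0 < e -> exists V0 : {fset G}, forall F,
    uniq F -> (forall k, k \in F -> k \notin V0) -> \sum_(j <- F) kappa V j <= e }.

Context {C D : G -> G -> R} {c : R} {M : {fset G} -> R}.
Context {Delta kappa : {fset G} -> G -> R}.
Hypothesis model : dobrushin_model C D c M Delta kappa.

Variables (PP : G -> probability S R) (A : G -> set S).
Hypotheses (mA : forall k, measurable (A k)) (PA : forall k, PP k (A k) = 1%E).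
Hypothesis A_piece : forall k s t, A k s -> A k t -> same_piece s t.

(** [W] may be smaller than [V]: the sites of [V] outside [W] are frozen at the argument. Freezing
    [L] first separates the influence of the boundary from the choice of laws in [L]. *)
Definition free_partition (V : {fset G}) (W : seq G) : config G S -> R :=
  site_means PP W (fun x => expR (- H V x)).

Lemma bmeas_expNH V : bmeas (fun x => expR (- H V x)).
Proof. by apply: bmeas_exp; apply: bmeasN; exact: (dm_meas model). Qed.

Lemma bmeas_free_partition V W : bmeas (free_partition V W).
Proof. by apply: bmeas_site_means; exact: bmeas_expNH. Qed.

Lemma free_partition_gt0 V W x : 0 < free_partition V W x.
Proof. exact: (partition_gt0 PP (dm_meas model V) W x). Qed.

(** The exponential turns an additive comparison into a multiplicative one: one factor exp M is the
    Lipschitz constant of exp on [-M, M], the other comes from dividing by an average that is at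
    least exp(-M). *)
Definition osc_rate (V : {fset G}) j : R := expR (2 * M V) * kappa V j.

Lemma kappa_ge0 V j : 0 <= kappa V j.
Proof.
by have := dm_kappa model (V := V) j (F := [::]) isT; rewrite big_nil; apply.
Qed.

Section OneSite.
Variables (L W : {fset G}) (j : G) (s t w w' : config G S).
Hypotheses (LW : [disjoint L & W]%fset) (jW : j \notin W) (jL : j \notin L).
Hypothesis ww' : agree_off j w w'.

Let V := (L `|` W)%fset.
Let os := override L s.
Let ot := override L t.
Let LV : (L `<=` V)%fset. Proof. exact: fsubsetUl. Qed.

(* Freezing L at the midpoint of the two energies makes the comparison symmetric in s, t;
   the Lipschitz condition survives because it is convex in the energy. *)
Let E x := 2^-1 * (H V (os x) + H V (ot x)).
Let U x := 2^-1 * (H V (os x) - H V (ot x)).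

Let bHo u : bmeas (fun x => H V (override L u x)).
Proof. exact: (bmeas_comp (measurable_override L u) (dm_meas model V)). Qed.
Let bE : bmeas E. Proof. by apply: bmeasZ; exact: (bmeasD (bHo s) (bHo t)). Qed.
Let bU : bmeas U. Proof. by apply: bmeasZ; exact: (bmeasB (bHo s) (bHo t)). Qed.

Let UE x : U x = 2^-1 * (H L (os x) - H L (ot x)).
Proof.
congr (_ * _); apply: (dm_local model LV) => k kL.
by rewrite /os /ot /override (negbTE kL).
Qed.

Let UM x : `|U x| <= M L.
Proof.
have h1 := dm_bound model L (os x); have h2 := dm_bound model L (ot x).
rewrite UE ler_norml; move: h1 h2; rewrite !ler_norml => /andP[? ?] /andP[? ?].
by apply/andP; split; lra.
Qed.

Let agree_override (u : config G S) l (v v' : config G S) : agree_off l v v' -> agree_off l (override L u v) (override L u v').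
Proof. by move=> vv' k kl; rewrite /override; case: ifP => // _; exact: vv'. Qed.

Let inV k : k \in W -> ([fset k] `<=` V)%fset.
Proof. by move=> kW; rewrite fsub1set in_fsetU kW orbT. Qed.

Let notL k : k \in W -> k \notin L.
Proof. by move=> kW; apply/negP => kL; move/fdisjointP: LW => /(_ _ kL); rewrite kW. Qed.

Let E_lip k l (v v' : config G S) (a b : S) : k \in enum_fset W -> k != l -> agree_off l v v' -> A k a -> A k b ->
  `|E (update v k a) - E (update v' k a) - (E (update v k b) - E (update v' k b))|
    <= 2 * C k l.
Proof.
move=> kW kl vv' Aa Ab.
have key u : `|H V (override L u (update v k a)) - H V (override L u (update v' k a))
    - (H V (override L u (update v k b)) - H V (override L u (update v' k b)))| <= 2 * C k l.
  rewrite !override_update ?notL//.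
  set x := override L u v; set x' := override L u v'.
  have e y : H V (update y k a) - H V (update y k b) =
      H [fset k]%fset (update y k a) - H [fset k]%fset (update y k b).
    apply: (dm_local model (inV kW)) => i; rewrite in_fset1 => ik.
    by rewrite /update (negbTE ik).
  have := dm_lip model kl (agree_override u vv') (A_piece Aa Ab).
  rewrite -/x -/x'; have := e x; have := e x' => e1 e2.
  congr (`|_| <= _); lra.
have h1 := key s; have h2 := key t.
move: h1 h2; rewrite /E -/os -/ot !ler_norml => /andP[? ?] /andP[? ?].
by apply/andP; split; lra.
Qed.

Let U_var l x x' : l \in j :: enum_fset W -> agree_off l x x' -> `|U x - U x'| <= Delta L l.
Proof.
move=> lW xx'.
have lL : l \notin L by move: lW; rewrite inE => /orP[/eqP ->//|/notL].
have h1 := dm_Delta model lL (agree_override s xx').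
have h2 := dm_Delta model lL (agree_override t xx').
rewrite !UE; move: h1 h2; rewrite /os /ot !ler_norml => /andP[? ?] /andP[? ?].
by apply/andP; split; lra.
Qed.

Let uW : uniq (j :: enum_fset W).
Proof. by rewrite cons_uniq jW/= fset_uniq. Qed.

Let compare (f : config G S -> R) : bmeas f -> (forall x, `|f x| <= M L) ->
  (forall l x x', l \in j :: enum_fset W -> agree_off l x x' -> `|f x - f x'| <= Delta L l) ->
  forall v v', agree_off j v v' ->
  gibbs_mean PP E (enum_fset W) (fun x => expR (f x)) v <= expR (osc_rate L j) *
  gibbs_mean PP E (enum_fset W) (fun x => expR (f x)) v'.
Proof.
move=> bf fM fD v v' vv'.
have bef : bmeas (fun x => expR (f x)) by exact: bmeas_exp.
have fM' x : f x <= M L by rewrite (le_trans (ler_norm _)).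
have b0 l : 0 <= D l j by exact: (dm_D0 model).
have bj : 1 <= D j j.
  by have := dm_super model j j (F := [::]) isT; rewrite eqxx big_nil addr0.
have bs k : k \in enum_fset W -> \sum_(i <- j :: enum_fset W) C k i * D i j <= D k j.
  by move=> _; apply: le_trans (dm_super model k j uW); rewrite lerDr.
have /andP[c0 c1] := dm_c model.
have cr k : k \in enum_fset W -> \sum_(i <- enum_fset W) C k i <= c.
  by move=> _; apply: (dm_row model); exact: fset_uniq.
have D'0 l : 0 <= expR (M L) * Delta L l by rewrite mulr_ge0 ?expR_ge0 ?(dm_Delta0 model).
have bv : bounded_var (j :: enum_fset W) (fun l => expR (M L) * Delta L l) (fun x => expR (f x)).
  move=> l lW x x' xx'; apply: le_trans (expR_lip (fM' x) (fM' x')) _.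
  by rewrite ler_wpM2l ?expR_ge0// fD.
have := dobrushin_comparison bE mA PA (dm_C0 model) E_lip uW b0 bj bs c0 c1 cr vv' bef D'0 bv.
set X := gibbs_mean _ _ _ _ v; set X' := gibbs_mean _ _ _ _ v' => XX'.
have X'M : expR (- M L) <= X'.
  apply: ge_gibbs_mean_cst => // x _; rewrite ler_expR.
  by have := fM x; rewrite ler_norml => /andP[].
have kap : \sum_(l <- j :: enum_fset W) D l j * (expR (M L) * Delta L l) <= expR (M L) * kappa L j.
  under eq_bigr do rewrite mulrCA [D _ _ * _]mulrC.
  rewrite -mulr_sumr ler_wpM2l ?expR_ge0//; apply: (dm_kappa model) => // k.
  by rewrite inE => /orP[/eqP ->//|/notL].
have : X <= X' + expR (M L) * kappa L j.
  by rewrite -lerBlDl (le_trans (ler_norm _))// (le_trans XX').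
move=> /le_trans; apply.
apply: (@le_trans _ _ (X' * (1 + osc_rate L j))); last first.
  rewrite mulrC ler_wpM2r ?expR_ge1Dx//.
  by rewrite (le_trans _ X'M) ?expR_ge0.
rewrite mulrDr mulr1 lerD2l /osc_rate mulrA ler_wpM2r ?kappa_ge0//.
have -> : expR (M L) = expR (- M L) * expR (2 * M L) by rewrite -expRD; congr expR; lra.
by rewrite ler_wpM2r ?expR_ge0.
Qed.

(** Relative to the midpoint energy [E], freezing [L] at [s] contributes the factor exp(-U), and
    freezing it at [t] the factor exp U. *)
Let part_s v : free_partition V (enum_fset W) (os v) =
  gibbs_mean PP E (enum_fset W) (fun x => expR (- U x)) v
  * site_means PP (enum_fset W) (boltzmann E) v.
Proof.
rewrite /gibbs_mean divfK ?gt_eqF ?partition_gt0//.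
rewrite /free_partition -site_means_override; last by move=> k; exact: notL.
by congr (site_means _ _ _ v); apply/funext => x; rewrite /boltzmann -expRD; congr expR;
  rewrite /U /E -/os; lra.
Qed.

Let part_t v : free_partition V (enum_fset W) (ot v) =
  gibbs_mean PP E (enum_fset W) (fun x => expR (U x)) v
  * site_means PP (enum_fset W) (boltzmann E) v.
Proof.
rewrite /gibbs_mean divfK ?gt_eqF ?partition_gt0//.
rewrite /free_partition -site_means_override; last by move=> k; exact: notL.
by congr (site_means _ _ _ v); apply/funext => x; rewrite /boltzmann -expRD; congr expR;
  rewrite /U /E -/ot; lra.
Qed.

(** The partition functions of the midpoint energy at [w] and [w'] occur on both sides and cancel.
    What remains are the averages of exp(-U) and exp U, and each costs one factor exp(osc_rate) when
    [w] and [w'] are exchanged. *)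
Lemma cross_ratio1 :
  free_partition V (enum_fset W) (os w) * free_partition V (enum_fset W) (ot w') <=
  expR (2 * osc_rate L j) *
  (free_partition V (enum_fset W) (os w') * free_partition V (enum_fset W) (ot w)).
Proof.
have bNU : bmeas (fun x => - U x) by exact: bmeasN.
have w'w : agree_off j w' w by move=> k kj; rewrite ww'.
have c1 : gibbs_mean PP E (enum_fset W) (fun x => expR (- U x)) w <= expR (osc_rate L j) *
    gibbs_mean PP E (enum_fset W) (fun x => expR (- U x)) w'.
  apply: (compare bNU) => // [x|l x x' lW xx']; first by rewrite normrN.
  by rewrite -opprD normrN; exact: U_var.
have c2 := compare bU UM U_var w'w.
rewrite !part_s !part_t.
set I := site_means _ _ _ w; set I' := site_means _ _ _ w'.
have I0 : 0 < I by exact: partition_gt0.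
have I'0 : 0 < I' by exact: partition_gt0.
have p0 (f : config G S -> R) (v : config G S) : bmeas f -> 0 <= gibbs_mean PP E (enum_fset W) (fun x => expR (f x)) v.
  move=> bf; apply: ge_gibbs_mean_cst => //; exact: bmeas_exp.
have h := ler_pM (p0 _ _ bNU) (p0 _ _ bU) c1 c2.
have := ler_wpM2r (mulr_ge0 (ltW I0) (ltW I'0)) h.
have -> : 2 * osc_rate L j = osc_rate L j + osc_rate L j by lra.
rewrite expRD; by congr (_ <= _); lra.
Qed.

End OneSite.
End CrossRatio.
Arguments osc_rate {R G} M kappa V j.

(** Both sides are bilinear in the two functions of [s] and [t], so the pointwise bound can be
    integrated over [s] and [t] independently and with different laws. This replaces frozen spins in
    [L] by constrained ones. *)
Lemma cross_ratio_means {R : realType} {G : countType} {d}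
    {S : measurableType d} (PP QQ : G -> probability S R) (L : seq G)
    (Z : config G S -> R) (w w' : config G S) (K : R) : bmeas Z ->
  (forall s t, Z (override L s w) * Z (override L t w') <=
     K * (Z (override L s w') * Z (override L t w))) ->
  site_means PP L Z w * site_means QQ L Z w' <=
  K * (site_means PP L Z w' * site_means QQ L Z w).
Proof.
move=> bZ ZK.
have ov (x v : config G S) : (forall k, k \notin L -> x k = v k) -> x = override L x v.
  by move=> xv; apply/funext => k; rewrite /override; case: ifPn => // /xv.
have ov2 (x x' v : config G S) : (forall k, k \notin L -> x k = v k) ->
    (forall k, k \in L -> x k = x' k) -> x = override L x' v.
  by move=> xv xx'; apply/funext => k; rewrite /override; case: ifPn => [/xx'|/xv].
have h t : site_means PP L Z w * Z (override L t w') <=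
    K * (site_means PP L Z w' * Z (override L t w)).
  rewrite mulrC [_ * Z _]mulrC mulrA -!site_meansZ//.
  apply: le_site_means2 => [||x x' xw x'w xx']; try exact: bmeasZ.
  rewrite (ov _ _ xw); have -> : x' = override L x w'.
    by apply: ov2 => // k /xx'.
  by have := ZK x t; rewrite mulrC [Z _ * Z (override L t w)]mulrC mulrA.
rewrite -site_meansZ// mulrA -site_meansZ//.
apply: le_site_means2 => [||x x' xw x'w xx']; try exact: bmeasZ.
rewrite (ov _ _ xw); have -> : x' = override L x w.
  by apply: ov2 => // k /xx'.
by rewrite -mulrA.
Qed.

Section Telescope.
Context {R : realType} {G : countType} {d : measure_display}.
Context {S : measurableType d} {same_piece : S -> S -> Prop}.
Context {H : {fset G} -> config G S -> R}.
Context {C D : G -> G -> R} {c : R} {M : {fset G} -> R}.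
Context {Delta kappa : {fset G} -> G -> R}.
Hypothesis model : dobrushin_model same_piece H C D c M Delta kappa.
Variables (PP : G -> probability S R) (A : G -> set S).
Hypotheses (mA : forall k, measurable (A k)) (PA : forall k, PP k (A k) = 1%E).
Hypothesis A_piece : forall k s t, A k s -> A k t -> same_piece s t.
Variables (L W : {fset G}).
Hypothesis (LW : [disjoint L & W]%fset).
Local Notation Z := (free_partition H PP (L `|` W)%fset (enum_fset W)).
Local Notation rate := (osc_rate M kappa L).

Let Z0 x : 0 < Z x. Proof. exact: (free_partition_gt0 model). Qed.

(** Cross ratios multiply along a chain of boundary conditions: [w] is moved to [w'] one site of [F]
    at a time, and the rates add up in the exponent. *)
Lemma cross_ratio_finite (F : seq G) (s t w w' : config G S) :
  (forall k, k \in F -> k \notin (L `|` W)%fset) ->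
  (forall k, k \notin F -> w k = w' k) ->
  Z (override L s w) * Z (override L t w') <=
  expR (\sum_(j <- F) 2 * rate j) * (Z (override L s w') * Z (override L t w)).
Proof.
elim: F w => [|j F IH] w FLW ww'.
  rewrite big_nil expR0 mul1r (_ : w = w')//.
  by apply/funext => k; exact: ww'.
have /FLW : j \in j :: F by exact: mem_head.
rewrite in_fsetU negb_or => /andP[jL jW].
set v := update w j (w' j).
have wv : agree_off j w v by move=> k /= kj; rewrite /v /update (negbTE kj).
have h1 := cross_ratio1 model mA PA A_piece s t LW jW jL wv.
have h2 : Z (override L s v) * Z (override L t w') <= expR (\sum_(j <- F) 2 * rate j)
    * (Z (override L s w') * Z (override L t v)).
  apply: IH => k kF; first by apply: FLW; rewrite inE kF orbT.
  rewrite /v /update; case: eqVneq => [->//|kj].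
  by apply: ww'; rewrite inE negb_or kj.
rewrite big_cons expRD.
have a0 := Z0 (override L s v); have b0 := Z0 (override L t v).
have h := ler_pM (mulr_ge0 (ltW (Z0 _)) (ltW (Z0 _))) (mulr_ge0 (ltW (Z0 _)) (ltW (Z0 _))) h1 h2.
rewrite -(ler_pM2r (mulr_gt0 a0 b0)); move: h.
by congr (_ <= _); lra.
Qed.

(** [w] and [w'] may differ at infinitely many sites. Quasilocality of the energy allows [w'] to be
    replaced by a configuration that differs from [w] at finitely many sites only, at a cost of exp
    e for each of the two partition functions evaluated at [w']. *)
Lemma cross_ratio_tail (tau e : R) (s t w w' : config G S) : 0 < e ->
  (forall F, uniq F -> (forall k, k \in F -> k \notin (L `|` W)%fset) ->
    \sum_(j <- F) rate j <= tau) ->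
  Z (override L s w) * Z (override L t w') <=
  expR (2 * tau + 2 * e) * (Z (override L s w') * Z (override L t w)).
Proof.
move=> e0 Ftau.
have [V1 V1e] := dm_quasilocal model (L `|` W)%fset e0.
pose F := [seq k <- enum_fset V1 | k \notin (L `|` W)%fset].
have FLW k : k \in F -> k \notin (L `|` W)%fset by rewrite mem_filter => /andP[].
pose v := override F w' w.
have vw k : k \notin F -> w k = v k by move=> kF; rewrite /v /override (negbTE kF).
have h1 := cross_ratio_finite s t FLW vw.
have near u x y : (forall k, k \notin L -> k \notin W -> k \in V1 -> x k = y k) ->
    Z (override L u x) <= expR e * Z (override L u y).
  move=> xy; rewrite -site_meansZ; last exact: (bmeas_expNH model).
  apply: le_site_means2 => [||x1 y1 x1x y1y x1y1].
  - exact: (bmeas_expNH model).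
  - by apply: bmeasZ; exact: (bmeas_expNH model).
  rewrite -expRD ler_expR; have : `|H (L `|` W)%fset x1 - H (L `|` W)%fset y1| <= e.
    apply: V1e => k kV1; have [kW|kW] := boolP (k \in W); first exact: x1y1.
    rewrite x1x// y1y// /override; case: ifPn => // kL; exact: xy.
  by rewrite ler_norml => /andP[? ?]; lra.
have vw' k : k \notin L -> k \notin W -> k \in V1 -> v k = w' k.
  move=> kL kW kV1; rewrite /v /override ifT// mem_filter kV1 andbT in_fsetU negb_or.
  by rewrite kL.
have h2 := near t w' v (fun k kL kW kV1 => esym (vw' k kL kW kV1)).
have h3 := near s v w' vw'.
have a0 := Z0 (override L s w); have b0 := Z0 (override L t w).
apply: le_trans (ler_wpM2l (ltW a0) h2) _.
rewrite mulrCA; apply: le_trans (ler_wpM2l (expR_ge0 e) h1) _.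
have -> : 2 * tau + 2 * e = e + (2 * tau + e) by lra.
rewrite [in leRHS]expRD -!mulrA ler_wpM2l ?expR_ge0//.
rewrite [in leRHS]expRD -!mulrA; apply: ler_pM; rewrite ?expR_ge0 ?mulr_ge0 ?(ltW (Z0 _))//.
  rewrite ler_expR -mulr_sumr ler_wpM2l// Ftau//.
  by apply: filter_uniq; exact: fset_uniq.
by rewrite mulrA ler_wpM2r// ltW.
Qed.

End Telescope.

Lemma enum_fset1E {G : choiceType} (j : G) : enum_fset [fset j]%fset = [:: j].
Proof.
apply: perm_small_eq => //; apply: uniq_perm => [||k]; rewrite ?fset_uniq//.
by rewrite mem_seq1; exact: in_fset1.
Qed.

Section Constrained.
Context {R : realType} {G : countType} {d d' : measure_display}.
Context {S : measurableType d} {S' : measurableType d'} {same_piece : S -> S -> Prop}.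
Context {H : {fset G} -> config G S -> R}.
Context {C D : G -> G -> R} {c : R} {M : {fset G} -> R}.
Context {Delta kappa : {fset G} -> G -> R}.
Hypothesis model : dobrushin_model same_piece H C D c M Delta kappa.
Variables (q : S' -> probability S R) (A : S' -> set S).
Hypotheses (mA : forall s', measurable (A s')) (qA : forall s', q s' (A s') = 1%E).
Hypothesis A_piece : forall s' s t, A s' s -> A s' t -> same_piece s t.
Implicit Types (V L : {fset G}) (o z : config G S') (w x : config G S).

(* [cpart V o] averages exp(- H_V) over spins k in V with laws [q (o k)]; it depends on its
   last argument only off V. *)
Definition cpart V o : config G S -> R :=
  free_partition H (fun k => q (o k)) V (enum_fset V).

Lemma bmeas_cpart V o : bmeas (cpart V o).
Proof. exact: (bmeas_free_partition model). Qed.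

Lemma cpart_gt0 V o x : 0 < cpart V o x.
Proof. exact: (free_partition_gt0 model). Qed.

Lemma perm_enum_fsetD V L : (L `<=` V)%fset ->
  perm_eq (enum_fset V) (enum_fset L ++ enum_fset (V `\` L)%fset).
Proof.
move=> LV; apply: uniq_perm; first exact: fset_uniq.
  rewrite cat_uniq !fset_uniq andbT/=; apply/hasPn => k.
  by rewrite in_fsetD => /andP[].
move=> k; rewrite mem_cat; change ((k \in V) = (k \in L) || (k \in (V `\` L)%fset)).
rewrite in_fsetD; have [kL|//] := boolP (k \in L).
by rewrite (fsubsetP LV).
Qed.

Lemma cpart_split V L o : (L `<=` V)%fset ->
  cpart V o = site_means (fun k => q (o k)) (enum_fset L)
    (free_partition H (fun k => q (o k)) V (enum_fset (V `\` L)%fset)).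
Proof.
move=> LV; rewrite /cpart /free_partition -site_means_cat.
apply: site_means_perm; first exact: perm_enum_fsetD.
exact: (bmeas_expNH model).
Qed.

Lemma eq_free_partition V W o o' : (forall k, k \in W -> o k = o' k) ->
  free_partition H (fun k => q (o k)) V W = free_partition H (fun k => q (o' k)) V W.
Proof. by move=> oo'; apply: eq_site_means => k kW; rewrite oo'. Qed.

Lemma eq_cpart V o o' : agree_on [set` V] o o' -> cpart V o = cpart V o'.
Proof. by move=> oo'; apply: eq_free_partition => k kV; exact: oo'. Qed.

(** [H V' - H V] does not depend on the spins in [V] and leaves the average over them. Thus the
    larger partition function is a weighted average of the smaller one over boundary conditions. *)
Lemma cpart_grow V V' o : (V `<=` V')%fset ->
  cpart V' o = site_means (fun k => q (o k)) (enum_fset (V' `\` V)%fset)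
    (fun x => expR (- (H V' x - H V x)) * cpart V o x).
Proof.
move=> VV'; have bV := bmeas_expNH model V.
rewrite /cpart /free_partition.
rewrite (site_means_perm _ (W := enum_fset (V' `\` V)%fset ++ enum_fset V)); last 2 first.
- by rewrite (perm_trans (perm_enum_fsetD VV'))// perm_catC.
- exact: (bmeas_expNH model).
rewrite site_means_cat; congr site_means.
rewrite -site_meansMl//; last first.
  move=> k kV w s; congr (expR (- _)).
  have e := dm_local model (w := update w k s) (w' := w) VV'.
  have {}e : H V' (update w k s) - H V' w = H V (update w k s) - H V w.
    apply: e => i iV; rewrite /update; case: eqP => // ik.
    by move: iV; rewrite ik kV.
  lra.
by congr site_means; apply/funext => x; rewrite -expRD; congr expR; lra.
Qed.

Lemma agree_offL_D V L o o' : (forall k, k \notin L -> o k = o' k) ->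
  forall k, k \in enum_fset (V `\` L)%fset -> o' k = o k.
Proof.
move=> oo' k; change (k \in (V `\` L)%fset -> o' k = o k).
by rewrite in_fsetD => /andP[kL _]; rewrite oo'.
Qed.

Lemma cpart_tail V L tau e oa ob w w' : (L `<=` V)%fset -> 0 < e ->
  (forall F, uniq F -> (forall k, k \in F -> k \notin V) ->
    \sum_(j <- F) osc_rate M kappa L j <= tau) ->
  (forall k, k \notin L -> oa k = ob k) ->
  cpart V oa w * cpart V ob w' <=
  expR (2 * tau + 2 * e) * (cpart V oa w' * cpart V ob w).
Proof.
move=> LV e0 Ftau ab; rewrite !(cpart_split _ LV).
rewrite (eq_free_partition V (agree_offL_D ab)).
apply: cross_ratio_means; first exact: (bmeas_free_partition model).
move=> s t; have LVE : (L `|` (V `\` L) = V)%fset by rewrite fsetUDl fsetDv fsetD0; exact/fsetUidPr.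
have dLV : [disjoint L & (V `\` L)]%fset by apply/fdisjointP => k kL; rewrite in_fsetD kL.
have := cross_ratio_tail model (PP := fun k => q (oa k)) (A := fun k => A (oa k))
  (fun k => mA (oa k)) (fun k => qA (oa k)) (fun k => @A_piece (oa k)) dLV
  (tau := tau) s t w w' e0.
by rewrite LVE; exact.
Qed.

Lemma cpart_one V L j oa ob w w' : (L `<=` V)%fset -> j \notin V -> agree_off j w w' ->
  (forall k, k \notin L -> oa k = ob k) ->
  cpart V oa w * cpart V ob w' <=
  expR (2 * osc_rate M kappa L j) * (cpart V oa w' * cpart V ob w).
Proof.
move=> LV jV ww' ab; rewrite !(cpart_split _ LV).
rewrite (eq_free_partition V (agree_offL_D ab)).
apply: cross_ratio_means; first exact: (bmeas_free_partition model).
move=> s t; have LVE : (L `|` (V `\` L) = V)%fset by rewrite fsetUDl fsetDv fsetD0; exact/fsetUidPr.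
have dLV : [disjoint L & (V `\` L)]%fset by apply/fdisjointP => k kL; rewrite in_fsetD kL.
have jL : j \notin L by apply: contra jV; exact: (fsubsetP LV).
have jVL : j \notin (V `\` L)%fset by rewrite in_fsetD negb_and jV orbT.
have := cross_ratio1 model (PP := fun k => q (oa k)) (A := fun k => A (oa k))
  (fun k => mA (oa k)) (fun k => qA (oa k)) (fun k => @A_piece (oa k)) s t dLV jVL jL ww'.
by rewrite LVE.
Qed.

(** Off [L] the constraints agree, so the weights that average the partition function of [V] into
    that of [V'] are the same for [oa] and [ob]. A cross ratio bound valid for all pairs of boundary
    conditions then survives averaging one of them. *)
Lemma cpart_avg V V' L K oa ob w x' : (L `<=` V)%fset -> (V `<=` V')%fset ->
  (forall k, k \notin L -> oa k = ob k) -> 0 <= K ->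
  (forall x x', cpart V oa x * cpart V ob x' <= K * (cpart V oa x' * cpart V ob x)) ->
  cpart V' oa w * cpart V ob x' <= K * (cpart V oa x' * cpart V' ob w).
Proof.
move=> LV VV' ab K0 VK; rewrite !(cpart_grow _ VV').
rewrite (eq_site_means (PP := fun k => q (ob k)) (QQ := fun k => q (oa k)))//; last first.
  move=> k kV; congr q; apply: (agree_offL_D (V := V') (L := L)) => //.
  move: kV; change (k \in (V' `\` V)%fset -> k \in (V' `\` L)%fset).
  by rewrite !in_fsetD => /andP[kV ->]; rewrite andbT; apply: contra kV; exact: (fsubsetP LV).
have be : bmeas (fun x => expR (- (H V' x - H V x))).
  by apply: bmeas_exp; apply: bmeasN; apply: bmeasB; exact: (dm_meas model).
have bp o : bmeas (cpart V o) by exact: bmeas_cpart.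
have bm1 o : bmeas (fun x => expR (- (H V' x - H V x)) * cpart V o x) by exact: bmeasM.
rewrite [leLHS]mulrC [leRHS]mulrA.
rewrite -(site_meansZ _ _ (cpart V ob x') _ (bm1 oa)).
rewrite -(site_meansZ _ _ (K * cpart V oa x') _ (bm1 ob)).
apply: le_site_means => [||x _]; try exact: bmeasZ.
rewrite mulrCA [leRHS]mulrCA ler_wpM2l ?expR_ge0//.
by have := VK x x'; congr (_ <= _); lra.
Qed.

(** Changing the constraint at [j] changes the law of the spin at [j], which is a boundary spin for
    [V] without [j]. The one-site bound in that smaller volume is integrated over two independent
    copies of this spin, one for each constraint. *)
Lemma cpart_change V L j oa ob za zb w : (L `<=` V)%fset -> j \in V -> j \notin L ->
  (forall k, k \notin L -> oa k = ob k) -> (forall k, k \notin L -> za k = zb k) ->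
  agree_off j oa za -> agree_off j ob zb ->
  cpart V oa w * cpart V zb w <=
  expR (2 * osc_rate M kappa L j) * (cpart V za w * cpart V ob w).
Proof.
move=> LV jV jL ab zab oz obz.
pose V1 := (V `\ j)%fset.
have VV1 : (V1 `<=` V)%fset by exact: fsubD1set.
have LV1 : (L `<=` V1)%fset by rewrite fsubsetD1 LV.
have jV1 : j \notin V1 by rewrite in_fsetD1 eqxx.
have VD : (V `\` V1 = [fset j])%fset.
  by apply/fsetP => k; rewrite !inE; case: eqVneq => [->|kj] /=; rewrite ?jV// andNb.
have enumD : enum_fset (V `\` V1)%fset = [:: j] by rewrite VD enum_fset1E.
rewrite !(cpart_grow _ VV1) enumD /=.
have agr (o z : config G S') : agree_off j o z -> agree_on [set` V1] o z.
  move=> ooz k /= kV1; apply: ooz => /=; apply: contraNneq jV1 => <-; exact: kV1.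
rewrite (eq_cpart (agr _ _ obz)) (eq_cpart (agr _ _ oz)) -(ab _ jL) -(zab _ jL).
have be : bmeas (fun x => expR (- (H V x - H V1 x))).
  by apply: bmeas_exp; apply: bmeasN; apply: bmeasB; exact: (dm_meas model).
have bm1 o : bmeas (fun x => expR (- (H V x - H V1 x)) * cpart V1 o x).
  by apply: bmeasM => //; exact: bmeas_cpart.
rewrite /site_mean.
pose fa x := expR (- (H V x - H V1 x)) * cpart V1 za x.
pose fb x := expR (- (H V x - H V1 x)) * cpart V1 zb x.
change ((\int[q (oa j)]_s fa (update w j s)) * (\int[q (za j)]_s fb (update w j s)) <=
  expR (2 * osc_rate M kappa L j) *
  ((\int[q (za j)]_s fa (update w j s)) * (\int[q (oa j)]_s fb (update w j s)))).
have bfa : bmeas fa by exact: bm1.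
have bfb : bmeas fb by exact: bm1.
have pt s t : fa (update w j s) * fb (update w j t) <=
    expR (2 * osc_rate M kappa L j) * (fa (update w j t) * fb (update w j s)).
  have wst : agree_off j (update w j s) (update w j t).
    by move=> k /= kj; rewrite /update (negbTE kj).
  have := ler_wpM2l (mulr_ge0 (expR_ge0 (- (H V (update w j s) - H V1 (update w j s))))
    (expR_ge0 (- (H V (update w j t) - H V1 (update w j t))))) (cpart_one LV1 jV1 wst zab).
  by rewrite /fa /fb; congr (_ <= _); lra.
have bu (f : config G S -> R) : bmeas f -> bmeas (fun s => f (update w j s)).
  exact: bmeas_update.
set K := expR (2 * _) in pt *.
set Ia := \int[q (za j)]_t fa _; set Ib := \int[q (za j)]_t fb _.
have mZ (P : probability S R) (a : R) (f : config G S -> R) : bmeas f ->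
    a * \int[P]_t f (update w j t) = \int[P]_t (a * f (update w j t)).
  by move=> bf; rewrite meanZ//; exact: bu.
have h s : fa (update w j s) * Ib <= K * Ia * fb (update w j s).
  rewrite [leRHS]mulrAC /Ia /Ib !mZ//.
  apply: le_mean => [||t]; try by (apply: bmeasZ; exact: bu).
  by apply: le_trans (pt s t) _; rewrite le_eqVlt; apply/orP; left; apply/eqP; lra.
rewrite [leLHS]mulrC [leRHS]mulrA (mZ _ Ib)// (mZ _ (K * Ia))//.
apply: le_mean => [||t]; try by (apply: bmeasZ; exact: bu).
by rewrite (mulrC Ib); exact: h.
Qed.

(** Changing spins in [L] alters [H V] by at most 2 M_L. Both sides are compared with the partition
    function in which the spins in [L] are frozen at those of [w], so the factor exp(2 M_L) appears
    twice. *)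
Lemma cpart_ratio V L oa ob w : (L `<=` V)%fset -> (forall k, k \notin L -> oa k = ob k) ->
  cpart V oa w <= expR (4 * M L) * cpart V ob w.
Proof.
move=> LV ab; rewrite !(cpart_split _ LV) (eq_free_partition V (agree_offL_D ab)).
set Z := free_partition _ _ _ _.
have bZ : bmeas Z by exact: (bmeas_free_partition model).
have Zxy x y : (forall k, k \notin L -> x k = y k) -> Z x <= expR (2 * M L) * Z y.
  move=> xy; rewrite /Z /free_partition -site_meansZ; last exact: (bmeas_expNH model).
  apply: le_site_means2 => [||x1 y1 x1x y1y x1y1].
  - exact: (bmeas_expNH model).
  - by apply: bmeasZ; exact: (bmeas_expNH model).
  rewrite -expRD ler_expR.
  have x1y1L k : k \notin L -> x1 k = y1 k.
    move=> kL; have [|kV] := boolP (k \in enum_fset (V `\` L)%fset); first exact: x1y1.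
    by rewrite x1x// y1y//; exact: xy.
  have := dm_local model LV x1y1L.
  have := dm_bound model L x1; have := dm_bound model L y1.
  by rewrite !ler_norml => /andP[? ?] /andP[? ?] ?; lra.
apply: (@le_trans _ _ (expR (2 * M L) * Z w)).
  apply: le_site_means_cst => // x xw; exact: Zxy.
have -> : 4 * M L = 2 * M L + 2 * M L by lra.
rewrite expRD -mulrA ler_wpM2l ?expR_ge0// -site_meansZ//.
apply: ge_site_means_cst => [|x xw]; first exact: bmeasZ.
by apply: Zxy => k kL; rewrite xw.
Qed.

End Constrained.

(** * Measurable dependence on the constraint *)

Section KernelMean.
Context {R : realType} {d d' : measure_display}.
Context {X : measurableType d} {Y : measurableType d'}.

(** An identity whose discarded argument records the measurability in [x], so that the kernel
    structure has something to attach to. *)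
Definition prob_family (l : X -> probability Y R)
    of (forall U, measurable U -> measurable_fun setT (fun x => l x U)) :
  X -> {measure set Y -> \bar R} := l.

Variable l : X -> probability Y R.
Hypothesis ml : forall U, measurable U -> measurable_fun setT (fun x => l x U).

HB.instance Definition _ := isKernel.Build _ _ X Y R (prob_family ml) ml.

Let prob_family1 x : prob_family ml x setT = 1%E.
Proof. exact: probability_setT. Qed.

HB.instance Definition _ :=
  Kernel_isProbability.Build _ _ X Y R (prob_family ml) prob_family1.

Lemma bmeas_kernel_mean (f : X * Y -> R) : bmeas f ->
  bmeas (fun x => \int[l x]_y f (x, y)).
Proof.
move=> bf; have [mf [M fM]] := bf; split; last first.
  by exists M => x; apply: norm_mean => //; exact: bmeas_section.
have bfM : bmeas (fun z => f z + M) by apply: bmeasD => //; exact: bmeas_cst.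
rewrite (_ : (fun x => _) = fun x => \int[l x]_y (f (x, y) + M) - M); last first.
  apply/funext => x; rewrite meanD ?mean_cst ?addrK//; last exact: bmeas_cst.
  exact: bmeas_section.
apply: measurable_funB; last exact: measurable_cst.
apply/measurable_EFinP.
rewrite (_ : EFin \o _ = fun x => (\int[l x]_y (f (x, y) + M)%:E)%E); last first.
  apply/funext => x /=; rewrite EFin_mean//.
  exact: (bmeas_section x bfM).
apply: (@measurable_fun_integral_finite_kernel _ _ _ _ _ (fun z => (f z + M)%:E) (prob_family ml)).
  by move=> z /=; rewrite lee_fin -lerBlDr sub0r; have := fM z; rewrite ler_norml => /andP[].
by apply/measurable_EFinP; exact: bfM.1.
Qed.

End KernelMean.

Section JointMeasurability.
Context {R : realType} {G : countType} {d d' : measure_display}.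
Context {S : measurableType d} {S' : measurableType d'}.
Variable q : S' -> probability S R.
Hypothesis mq : forall U, measurable U -> measurable_fun setT (fun s' => q s' U).

Lemma bmeas_site_mean_kernel k (f : config G S' * config G S -> R) : bmeas f ->
  bmeas (fun z : config G S' * config G S => site_mean (q ((z.1 : config G S') k)) k (fun w => f (z.1, w)) z.2).
Proof.
move=> bf; pose l (z : config G S' * config G S) := q ((z.1 : config G S') k).
have ml U : measurable U -> measurable_fun setT (fun z => l z U).
  move=> mU; apply: (measurableT_comp (mq mU) (g := fun z : config G S' * config G S => (z.1 : config G S') k)).
  exact: (measurableT_comp (measurable_coord k) measurable_fst).
apply: (bmeas_kernel_mean ml (f := fun z : (config G S' * config G S) * S => f (z.1.1, update z.1.2 k z.2))).
apply: (bmeas_comp (h := fun z : (config G S' * config G S) * S =>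
  (z.1.1, update z.1.2 k z.2))) bf.
apply: measurable_fun_pair.
  exact: (measurableT_comp measurable_fst measurable_fst).
apply: (measurableT_comp (measurable_update k)
  (g := fun z : (config G S' * config G S) * S => (z.1.2, z.2))).
apply: measurable_fun_pair; last exact: measurable_snd.
exact: (measurableT_comp measurable_snd measurable_fst).
Qed.

Lemma bmeas_site_means_kernel (V : seq G) (f : config G S -> R) : bmeas f ->
  bmeas (fun z : config G S' * config G S =>
    site_means (fun k => q ((z.1 : config G S') k)) V f z.2).
Proof.
move=> bf; elim: V => [|k V IH] /=.
  exact: (bmeas_comp (h := fun z : config G S' * config G S => z.2) measurable_snd bf).
exact: (bmeas_site_mean_kernel k IH).
Qed.

End JointMeasurability.

Section SequenceBounds.
Context {R : realType}.
Implicit Types (u v : nat -> R) (a l : R).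

Lemma cvgn_ge u l a N : u @ \oo --> l -> (forall n, (N <= n)%N -> a <= u n) -> a <= l.
Proof.
move=> ul au; rewrite -(cvg_lim _ ul)//; apply: limr_ge; first by apply/cvg_ex; exists l.
by exists N.
Qed.

Lemma cvgn_le u l a N : u @ \oo --> l -> (forall n, (N <= n)%N -> u n <= a) -> l <= a.
Proof.
move=> ul ua; rewrite -(cvg_lim _ ul)//; apply: limr_le; first by apply/cvg_ex; exists l.
by exists N.
Qed.

End SequenceBounds.

Section Exhaustion.
Variable G : countType.

Definition volume (n : nat) : {fset G} := [fset k in pmap choice.unpickle (iota 0 n)]%fset.

Lemma volume_cofinal (V : {fset G}) : exists N, forall n, (N <= n)%N ->
  (V `<=` volume n)%fset.
Proof.
exists (\max_(k <- enum_fset V) (choice.pickle k).+1)%N => n Vn; apply/fsubsetP => k kV.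
rewrite in_fset /= mem_pmap; apply/mapP; exists (choice.pickle k); last by rewrite choice.pickleK.
rewrite mem_iota add0n /=; apply: leq_trans Vn.
by apply: (leq_bigmax_seq (F := fun k => (choice.pickle k).+1) (P := xpredT)).
Qed.

End Exhaustion.

(** * Infinite-volume densities *)

Section LimitDensity.
Context {R : realType} {G : countType} {d d' : measure_display}.
Context {S : measurableType d} {S' : measurableType d'} {same_piece : S -> S -> Prop}.
Context {H : {fset G} -> config G S -> R}.
Context {C D : G -> G -> R} {c : R} {M : {fset G} -> R}.
Context {Delta kappa : {fset G} -> G -> R}.
Hypothesis model : dobrushin_model same_piece H C D c M Delta kappa.
Variables (q : S' -> probability S R) (A : S' -> set S).
Hypothesis mq : forall U, measurable U -> measurable_fun setT (fun s' => q s' U).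
Hypotheses (mA : forall s', measurable (A s')) (qA : forall s', q s' (A s') = 1%E).
Hypothesis A_piece : forall s' s t, A s' s -> A s' t -> same_piece s t.
Variables (w0 : config G S) (s0 : S').
Implicit Types (V L : {fset G}) (o z : config G S') (w x : config G S).
Local Notation cpart := (cpart (H := H) q).

Definition base L o : config G S' := override (enum_fset L) (fun=> s0) o.

Definition cratio L n o : R := cpart (volume G n) o w0 / cpart (volume G n) (base L o) w0.

(* Dividing by the value at the reference configuration [base L o] makes the limit exist; the
   normalization in L is left to [tilt]. *)
Definition cdens L o : R := limn (fun n => cratio L n o).

Lemma base_off L o k : k \notin L -> base L o k = o k.
Proof. by move=> kL; rewrite /base /override (negbTE kL). Qed.

Let pos V o x : 0 < cpart V o x. Proof. exact: (cpart_gt0 model). Qed.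

Lemma cpart_close L e : 0 < e -> exists2 V0, (L `<=` V0)%fset &
  forall V, (V0 `<=` V)%fset -> forall oa ob w w', (forall k, k \notin L -> oa k = ob k) ->
  cpart V oa w * cpart V ob w' <= expR e * (cpart V oa w' * cpart V ob w).
Proof.
(* Rates are [kappa] times exp(2 M_L), so with this tail they sum to at most e / 4. Doubled, this
   uses half of the exponent; quasilocality uses the other half. *)
move=> e0; pose e' := e / 4 / expR (2 * M L).
have e'0 : 0 < e' by rewrite !divr_gt0// expR_gt0.
have [V0 V0e] := dm_tail model L e'0.
exists (L `|` V0)%fset; first exact: fsubsetUl.
move=> V; rewrite fsubUset => /andP[LV V0V] oa ob w w' ab.
have e4 : 0 < e / 4 by rewrite divr_gt0.
have -> : e = 2 * (e / 4) + 2 * (e / 4) by lra.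
apply: (cpart_tail model mA qA A_piece _ _ LV e4 _ ab) => F uF FV.
rewrite -mulr_sumr mulrC -ler_pdivlMr ?expR_gt0//.
apply: V0e => // k /FV; apply: contra; exact: (fsubsetP V0V).
Qed.

Lemma cpart_close2 L e : 0 < e -> exists2 V0, (L `<=` V0)%fset &
  forall V V', (V0 `<=` V)%fset -> (V `<=` V')%fset ->
  forall oa ob w x, (forall k, k \notin L -> oa k = ob k) ->
  cpart V' oa w * cpart V ob x <= expR e * (cpart V oa x * cpart V' ob w) /\
  cpart V oa x * cpart V' ob w <= expR e * (cpart V' oa w * cpart V ob x).
Proof.
move=> e0; have [V0 LV0 V0e] := cpart_close L e0; exists V0 => // V V' V0V VV' oa ob w x ab.
have LV := fsubset_trans LV0 V0V; split.
  have h y y' := V0e _ V0V oa ob y y' ab.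
  exact: (cpart_avg model w x LV VV' ab (expR_ge0 _) h).
rewrite mulrC [X in _ <= _ * X]mulrC.
have ba k : k \notin L -> ob k = oa k by move=> kL; rewrite ab.
have h y y' := V0e _ V0V ob oa y y' ba.
exact: (cpart_avg model w x LV VV' ba (expR_ge0 _) h).
Qed.

(** One fixed [V] serves all large n, all constraints and all boundary conditions. This yields the
    Cauchy property and, after n tends to infinity, both quasilocality of the limit and its link
    with the Gibbs measure in [V]. *)
Lemma cratio_close L e : 0 < e -> exists2 V0, (L `<=` V0)%fset &
  forall V, (V0 `<=` V)%fset -> exists N, forall n, (N <= n)%N -> forall o x,
  cratio L n o * cpart V (base L o) x <= expR e * cpart V o x /\
  cpart V o x <= expR e * (cratio L n o * cpart V (base L o) x).
Proof.
move=> e0; have [V0 LV0 V0e] := cpart_close2 L e0; exists V0 => // V V0V.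
have [N VN] := volume_cofinal V; exists N => n Nn o x.
have ob k : k \notin L -> o k = base L o k by move=> kL; rewrite base_off.
have [h1 h2] := V0e _ _ V0V (VN n Nn) o (base L o) w0 x ob.
rewrite /cratio; split.
  by rewrite mulrAC ler_pdivrMr// -mulrA.
by rewrite mulrAC mulrA ler_pdivlMr.
Qed.

Lemma cratio_bound L : exists N, forall n, (N <= n)%N -> forall o,
  expR (- (4 * M L)) <= cratio L n o <= expR (4 * M L).
Proof.
have [N VN] := volume_cofinal L; exists N => n Nn o; rewrite /cratio.
have ob k : k \notin L -> o k = base L o k by move=> kL; rewrite base_off.
rewrite ler_pdivlMr// ler_pdivrMr//; apply/andP; split; last first.
  exact: (cpart_ratio model q w0 (VN n Nn) ob).
rewrite expRN mulrC ler_pdivrMr ?expR_gt0// mulrC.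
by apply: (cpart_ratio model q _ (VN n Nn)) => k kL; exact: base_off.
Qed.

Lemma cratio_cvg L o : cratio L ^~ o @ \oo --> cdens L o.
Proof.
apply: R_complete; apply: cauchy_exP => e e0.
pose B := expR (4 * M L); have B0 : 0 < B := expR_gt0 _.
(* A factor exp a changes a number in (0, B] by at most e / 2. *)
pose a := ln (1 + e / (2 * B)).
have eB : 0 < e / (2 * B) by rewrite divr_gt0// mulr_gt0.
have ea : expR a = 1 + e / (2 * B) by rewrite lnK// posrE; lra.
have a0 : 0 < a by rewrite -expR_gt1 ea; lra.
have [V0 LV0 V0e] := cratio_close L a0.
have [N Nr] := V0e V0 (fsubset_refl _).
have ob k : k \notin L -> o k = base L o k by move=> kL; rewrite base_off.
pose r := cpart V0 o w0 / cpart V0 (base L o) w0; exists r.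
have r0 : 0 < r by rewrite divr_gt0.
have rB : r <= B by rewrite ler_pdivrMr//; exact: (cpart_ratio model q w0 LV0 ob).
have [N' NB] := cratio_bound L.
exists (maxn N N') => // n /=; rewrite geq_max => /andP[Nn N'n].
have [h1 h2] := Nr n Nn o w0; have /andP[_ uB] := NB n N'n o.
rewrite -ler_pdivlMr// -mulrA -/r in h1.
rewrite mulrA -ler_pdivrMr// -/r in h2.
rewrite ea in h1 h2; rewrite /ball/=.
have hr : e / (2 * B) * r <= e / 2.
  rewrite (le_trans (ler_wpM2l (ltW eB) rB))// invfM mulrA mulrVK//.
  by rewrite unitfE gt_eqF.
have hq : e / (2 * B) * cratio L n o <= e / 2.
  rewrite (le_trans (ler_wpM2l (ltW eB) uB))// invfM mulrA mulrVK//.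
  by rewrite unitfE gt_eqF.
by rewrite ltr_norml; apply/andP; split; lra.
Qed.

Lemma cdens_bound L o : expR (- (4 * M L)) <= cdens L o <= expR (4 * M L).
Proof.
have [N NB] := cratio_bound L; apply/andP; split.
  apply: (cvgn_ge (N := N) (@cratio_cvg L o)) => n Nn.
  by have /andP[] := NB n Nn o.
apply: (cvgn_le (N := N) (@cratio_cvg L o)) => n Nn.
by have /andP[] := NB n Nn o.
Qed.

Lemma measurable_base L : measurable_fun setT (base L).
Proof. exact: measurable_override. Qed.

Lemma bmeas_cpart_left V w : bmeas (fun o => cpart V o w).
Proof.
have b := bmeas_site_means_kernel mq (enum_fset V) (bmeas_expNH model V).
apply: (bmeas_comp (h := fun o : config G S' => (o, w)) _ b).
by apply: measurable_fun_pair; [exact: measurable_id|exact: measurable_cst].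
Qed.

Lemma bmeas_cdens L : bmeas (cdens L).
Proof.
split; last first.
  exists (expR (4 * M L)) => o; have /andP[l u] := cdens_bound L o.
  by rewrite ger0_norm// (le_trans _ l)// expR_ge0.
apply: (measurable_fun_cvg (h := fun n => cratio L n)) => [n|o _]; last exact: cratio_cvg.
have b1 := bmeas_cpart_left (volume G n) w0.
have b2 := bmeas_comp (measurable_base L) b1.
have lb o : expR (- M (volume G n)) <= cpart (volume G n) o w0.
  apply: ge_site_means_cst => [|x _]; first exact: (bmeas_expNH model).
  by rewrite ler_expR lerN2 (le_trans (ler_norm _))// (dm_bound model).
have b3 := bmeas_inv (expR_gt0 _) (fun o => lb (base L o)) b2.
exact: (bmeasM b1 b3).1.
Qed.

Lemma cdens_close L e : 0 < e -> exists2 V0, (L `<=` V0)%fset &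
  forall V, (V0 `<=` V)%fset -> forall o x,
  cdens L o * cpart V (base L o) x <= expR e * cpart V o x /\
  cpart V o x <= expR e * (cdens L o * cpart V (base L o) x).
Proof.
move=> e0; have [V0 LV0 V0e] := cratio_close L e0; exists V0 => // V V0V o x.
have [N VN] := V0e V V0V; split.
  rewrite -ler_pdivlMr//; apply: (cvgn_le (N := N) (@cratio_cvg L o)) => n Nn.
  by rewrite ler_pdivlMr//; exact: (VN n Nn o x).1.
have eZ : 0 < expR e * cpart V (base L o) x by rewrite mulr_gt0 ?expR_gt0.
have : cpart V o x / (expR e * cpart V (base L o) x) <= cdens L o.
  apply: (cvgn_ge (N := N) (@cratio_cvg L o)) => n Nn.
  by rewrite ler_pdivrMr// mulrCA; exact: (VN n Nn o x).2.
by rewrite ler_pdivrMr// mulrCA.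
Qed.

Lemma base_base L V o : (L `<=` V)%fset -> base V (base L o) = base V o.
Proof.
move=> LV; apply/funext => k; rewrite /base /override.
case: ifPn => // kV; case: ifPn => // kL.
by move: kV; rewrite (fsubsetP LV).
Qed.

(** Since the reference for [V] erases that for [L], the quotients telescope in each finite volume
    and the identity passes to the limit. *)
Lemma cdens_cocycle L V o : (L `<=` V)%fset ->
  cdens V o = cdens L o * cdens V (base L o).
Proof.
move=> LV.
have : cratio L ^~ o \* cratio V ^~ (base L o) @ \oo --> cdens L o * cdens V (base L o).
  by apply: cvgM; exact: cratio_cvg.
have -> : cratio L ^~ o \* cratio V ^~ (base L o) = cratio V ^~ o.
  apply/funext => n /=.
  by rewrite /cratio base_base// mulrACA [(cpart _ (base L o) w0)^-1 * _]mulrC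
    mulrACA divff ?mulr1// gt_eqF.
by move=> h; exact: (cvg_lim _ h).
Qed.

(** The partition functions in [V] see the constraint only inside [V], and [cdens] is within a
    factor exp(e / 2) of a quotient of two of them. *)
Lemma cdens_quasilocal L e : 0 < e -> exists V0 : {fset G}, forall o o',
  agree_on [set` V0] o o' -> cdens L o <= expR e * cdens L o'.
Proof.
move=> e0; have e2 : 0 < e / 2 by rewrite divr_gt0.
have [V LV Ve] := cdens_close L e2; exists V => o o' oo'.
have [h1 _] := Ve V (fsubset_refl _) o w0.
have [_ h2] := Ve V (fsubset_refl _) o' w0.
have E : cpart V o = cpart V o' by exact: eq_cpart.
have EB : cpart V (base L o) = cpart V (base L o').
  apply: eq_cpart => k kV; rewrite /base /override; case: ifP => // _; exact: oo'.
rewrite E EB in h1; have := le_trans h1 (ler_wpM2l (expR_ge0 _) h2).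
rewrite !mulrA -expRD -splitr.
by rewrite ler_pM2r.
Qed.

(** The reference configurations of [oa] and [ob] coincide, as do those of [za] and [zb], so the
    denominators on the two sides are equal and the finite-volume bound carries over. *)
Lemma cdens_change L j oa ob za zb : j \notin L ->
  (forall k, k \notin L -> oa k = ob k) -> (forall k, k \notin L -> za k = zb k) ->
  agree_off j oa za -> agree_off j ob zb ->
  cdens L oa * cdens L zb <= expR (2 * osc_rate M kappa L j) * (cdens L za * cdens L ob).
Proof.
move=> jL ab zab oz obz.
have [N VN] := volume_cofinal (j |` L)%fset.
set K := expR _.
have c3 : (fun n => K * (cratio L n za * cratio L n ob) - cratio L n oa * cratio L n zb) @ \oo
    --> K * (cdens L za * cdens L ob) - cdens L oa * cdens L zb.
  apply: cvgB; last by apply: cvgM; exact: cratio_cvg.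
  by apply: cvgM; [exact: cvg_cst|apply: cvgM; exact: cratio_cvg].
rewrite -subr_ge0; apply: (cvgn_ge (N := N) c3) => n Nn /=; rewrite subr_ge0.
have := VN n Nn; rewrite fsubUset fsub1set => /andP[jV LV].
have baseE o o' : (forall k, k \notin L -> o k = o' k) -> base L o = base L o'.
  by move=> oo'; apply/funext => k; rewrite /base /override; case: ifPn => // /oo'.
have h := cpart_change model mA qA A_piece w0 LV jV jL ab zab oz obz.
rewrite /cratio (baseE _ _ ab) (baseE _ _ zab).
set b1 := cpart _ (base L ob) w0; set b2 := cpart _ (base L zb) w0.
have := ler_wpM2r (mulr_ge0 (ltW (_ : 0 < b1^-1)) (ltW (_ : 0 < b2^-1))) h.
rewrite !invr_gt0 !pos -/K => /(_ isT isT).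
by move: (b1^-1) (b2^-1) => u v; congr (_ <= _); lra.
Qed.

End LimitDensity.

(** * Specifications given by densities *)

Section DominatedConvergence.
Context {R : realType} {d : measure_display} {X : measurableType d}.

Lemma mean_dct (P : probability X R) (u : nat -> X -> R) f (K : R) :
  (forall n, bmeas (u n)) -> bmeas f -> (forall n x, `|u n x| <= K) ->
  (forall x, u ^~ x @ \oo --> f x) ->
  (fun n => \int[P]_x u n x) @ \oo --> \int[P]_x f x.
Proof.
move=> bu bf uK uf; apply/fine_cvg; rewrite EFin_mean//.
apply: (@dominated_cvg _ _ _ P setT measurableT _ _ (cst K%:E)) => //.
- by move=> n; apply/measurable_EFinP; exact: (bu n).1.
- by move=> x _; apply: cvg_EFin; [exact: nearW|exact: uf].
- by have := bmeas_int P (bmeas_cst K).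
- by move=> n x _; rewrite lee_fin.
Qed.

End DominatedConvergence.

Lemma site_means_dct {R : realType} {G : countType} {d} {S : measurableType d}
    (PP : G -> probability S R) (V : seq G) (u : nat -> config G S -> R) f (K : R) w :
  (forall n, bmeas (u n)) -> bmeas f -> (forall n x, `|u n x| <= K) ->
  (forall x, u ^~ x @ \oo --> f x) ->
  (fun n => site_means PP V (u n) w) @ \oo --> site_means PP V f w.
Proof.
move=> bu bf uK uf; elim: V w => [|k V IH] w /=; first exact: uf.
apply: (mean_dct (u := fun n s => site_means PP V (u n) (update w k s)) (K := K)).
- by move=> n; apply: bmeas_update; exact: bmeas_site_means.
- by apply: bmeas_update; exact: bmeas_site_means.
- move=> n s; rewrite ler_norml; apply/andP; split.
    apply: ge_site_means_cst => // x _; have := uK n x.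
    by rewrite ler_norml => /andP[].
  apply: le_site_means_cst => // x _; have := uK n x.
  by rewrite ler_norml => /andP[].
- by move=> s; exact: IH.
Qed.

Section FunctionalProbability.
Context {R : realType} {d : measure_display} {X : measurableType d}.

(** Daniell's conditions for an integral against a probability; [mf_cvg] yields countable
    additivity. *)
Record mean_functional (F : (X -> R) -> R) : Prop := {
  mf_pl : positive_linear F ;
  mf_1 : F (cst 1) = 1 ;
  mf_cvg : forall (u : nat -> X -> R) f, (forall n, bmeas (u n)) -> bmeas f ->
    (forall n x, 0 <= u n x <= 1) -> (forall x, u ^~ x @ \oo --> f x) ->
    (fun n => F (u n)) @ \oo --> F f }.

(* The maximum makes the set function nonnegative on non-measurable sets. *)
Definition functional_measure F of mean_functional F : set X -> \bar R :=
  fun B => (Num.max 0 (F (\1_B : X -> R)))%:E.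

Variables (F : (X -> R) -> R) (mF : mean_functional F).

Let pF := mf_pl mF.

Lemma functional_measureE B : measurable B ->
  functional_measure mF B = (F (\1_B : X -> R))%:E.
Proof.
move=> mB; congr (_%:E); apply/max_idPr; rewrite -(pl0 pF).
by apply: (pl_le pF) => //; [exact: bmeas_cst|exact: bmeas_indic].
Qed.

Let fm0 : functional_measure mF set0 = 0%E.
Proof.
rewrite functional_measureE//; congr (_%:E); rewrite -[RHS](pl0 pF).
by congr F; apply/funext => x; rewrite indic0.
Qed.

Let fm_ge0 B : (0 <= functional_measure mF B)%E.
Proof. by rewrite lee_fin le_max lexx. Qed.

Let fm_sigma_additive : semi_sigma_additive (functional_measure mF).
Proof.
move=> B mB tB mUB; rewrite functional_measureE//.
pose u n (x : X) : R := \sum_(k < n) \1_(B k) x.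
have [bu Fu] : (forall n, bmeas (u n)) /\ (forall n, F (u n) = \sum_(k < n) F \1_(B k)).
  have h n := pl_sum n pF (u := fun k => \1_(B k) : X -> R) (fun k => bmeas_indic (mB k)).
  by split => n; have [] := h n.
rewrite (_ : (fun n => _) = fun n => (F (u n))%:E); last first.
  apply/funext => n; rewrite Fu -sumEFin big_mkord.
  by apply: eq_bigr => k _; rewrite functional_measureE.
have uE n x : u n x = \1_(\bigcup_(k < n) B k) x.
  rewrite /u !indicE; case: (boolP (x \in _)) => [/set_mem[k /= kn Bkx]|nB].
    rewrite (bigD1 (Ordinal kn))//= indicE mem_set// big1 ?addr0// => i ik.
    rewrite indicE memNset// => Bix; case/eqP: ik; apply: val_inj => /=.
    by apply: (tB _ _ Logic.I Logic.I); exists x.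
  rewrite big1// => i _; rewrite indicE memNset// => Bix.
  by case/negP: nB; apply/mem_set; exists (nat_of_ord i) => /=.
apply: cvg_EFin; first exact: nearW.
apply: (mf_cvg mF) => //; first exact: bmeas_indic.
  by move=> n x; rewrite uE indicE; case: (_ \in _); rewrite /= ?lexx ?ler01.
move=> x; have [[k _ Bkx]|nB] := pselect ((\bigcup_k B k) x).
  apply: cvg_near_cst; exists k.+1 => // n /= kn.
  rewrite uE !indicE !mem_set//; first by exists k.
  by exists k.
apply: cvg_near_cst; exists 0%N => // n _.
rewrite uE !indicE !memNset// => -[k _ Bkx]; by apply: nB; exists k.
Qed.

HB.instance Definition _ :=
  isMeasure.Build _ _ _ (functional_measure mF) fm0 fm_ge0 fm_sigma_additive.

Let fm_setT : functional_measure mF setT = 1%E.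
Proof. by rewrite functional_measureE// indicT (mf_1 mF). Qed.

HB.instance Definition _ :=
  Measure_isProbability.Build _ _ _ (functional_measure mF) fm_setT.

Definition functional_prob : probability X R := functional_measure mF.

Lemma mean_functional_prob f : bmeas f -> \int[functional_prob]_x f x = F f.
Proof.
apply: (eq_positive_linear (F := fun f => \int[functional_prob]_x f x) _ pF).
  split => [f1 g1 ? ?|c f1 ?|f1 g1 ? ? ?]; [exact: meanD|exact: meanZ|exact: le_mean].
move=> B mB; apply: EFin_inj.
by rewrite (mean_indic functional_prob mB) -functional_measureE.
Qed.

End FunctionalProbability.

Lemma override_indep {R : realType} {G : countType} {d} {S : measurableType d}
    (V : seq G) (s : config G S) (f : config G S -> R) w :
  (forall k, k \in V -> indep k f) -> f (override V s w) = f w.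
Proof.
elim: V => [|k V IH] fV; first by congr f.
have -> : override (k :: V) s w = update (override V s w) k (s k).
  apply/funext => i; rewrite /override /update inE.
  by case: (eqVneq i k) => [->|].
rewrite fV ?mem_head// IH// => j jV; apply: fV.
by rewrite inE jV orbT.
Qed.

(** The sets insensitive to an update at [k] form a sigma-algebra that contains all cylinders off
    [L]. *)
Lemma measurable_off_indep {R : realType} {G : countType} {d} {S : measurableType d}
    (L : {fset G}) (E : set (config G S)) k :
  measurable (E : set (config_off L S)) -> k \in L -> indep k (\1_E : config G S -> R).
Proof.
move=> mE kL w s.
suff h : E (update w k s) <-> E w.
  by rewrite !indicE; congr ((nat_of_bool _)%:R); apply/idP/idP => /set_mem Ew;
    apply/mem_set/h.
have := mE; rewrite /measurable/=.
pose inv := [set B : set (config G S) | B (update w k s) <-> B w].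
suff : <<s (cylinders S (~` [set` L])) >> `<=` inv by move=> /(_ E).
apply: smallest_sub.
  split => /=.
  - by [].
  - move=> B hB; have [h1 h2] : B (update w k s) <-> B w := hB.
    rewrite /inv/=; split => -[_ nB]; split => //; [by move/h2|by move/h1].
  - by move=> B hB; rewrite /inv/=; split=> -[n _ Bn]; exists n => //; exact/hB.
move=> _ [i iL [B mB <-]] /=; rewrite /inv /= /preimage/= /update.
case: eqP => // ik; exfalso; apply: iL; rewrite ik; exact: kL.
Qed.

Lemma measurable_off_full {G : countType} {d} {S : measurableType d}
    (L : {fset G}) (E : set (config G S)) :
  measurable (E : set (config_off L S)) -> measurable E.
Proof.
suff : <<s cylinders S (~` [set` L]) >> `<=` <<s cylinders S setT >> by move=> /(_ E).
apply: smallest_sub; first exact: smallest_sigma_algebra.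
by move=> _ [i _ [B mB <-]]; apply: sub_sigma_algebra; exists i => //; exists B.
Qed.

Section TiltedSpecification.
Context {R : realType} {G : countType} {d : measure_display}.
Context {S : measurableType d}.
Variables (P : probability S R) (s0 : S) (g : {fset G} -> config G S -> R).
Hypothesis bg : forall L, bmeas (g L).
Hypothesis g_lb : forall L, exists2 c : R, 0 < c & forall o, c <= g L o.
Hypothesis g_cocycle : forall (L V : {fset G}) o, (L `<=` V)%fset ->
  g V o = g L o * g V (base s0 L o).
Hypothesis g_ql : forall L (e : R), 0 < e -> exists V0 : {fset G}, forall o o',
  agree_on [set` V0] o o' -> g L o <= expR e * g L o'.
Implicit Types (L V : {fset G}) (f : config G S -> R) (o : config G S).

Local Notation JJ L := (site_means (fun=> P) (enum_fset L)).

Definition tilt L f o : R := JJ L (fun x => f x * g L x) o / JJ L (g L) o.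

Let g_gt0 L o : 0 < g L o.
Proof. by have [c c0 cg] := g_lb L; exact: lt_le_trans (cg o). Qed.

Lemma JJg_lb L : exists2 c : R, 0 < c & forall o, c <= JJ L (g L) o.
Proof.
have [c c0 cg] := g_lb L; exists c => // o.
by apply: ge_site_means_cst.
Qed.

Lemma JJg_gt0 L o : 0 < JJ L (g L) o.
Proof. by have [c c0 cg] := JJg_lb L; exact: lt_le_trans (cg o). Qed.

Lemma bmeas_tilt L f : bmeas f -> bmeas (tilt L f).
Proof.
move=> bf; have [c c0 cg] := JJg_lb L.
apply: bmeasM; first by apply: bmeas_site_means; exact: bmeasM.
by apply: (bmeas_inv c0) => //; exact: bmeas_site_means.
Qed.

Lemma tilt_mean_functional L o : mean_functional (tilt L ^~ o).
Proof.
have bm1 f : bmeas f -> bmeas (fun x => f x * g L x) by move=> bf; exact: bmeasM.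
split; first split.
- move=> f h bf bh; rewrite /tilt -mulrDl -site_meansD; try exact: bm1.
  by congr (site_means _ _ _ o / _); apply/funext => x; rewrite mulrDl.
- move=> a f bf; rewrite /tilt mulrA -site_meansZ; last exact: bm1.
  by congr (site_means _ _ _ o / _); apply/funext => x; rewrite mulrA.
- move=> f h bf bh fh; rewrite ler_pM2r ?invr_gt0 ?JJg_gt0//.
  apply: le_site_means => [||x _]; try exact: bm1.
  by rewrite ler_wpM2r// ltW.
- rewrite /tilt; under [X in site_means _ _ X]funext do rewrite mul1r.
  by rewrite divff// gt_eqF// JJg_gt0.
- move=> u f bu bf u01 uf; apply: cvgM; last exact: cvg_cst.
  have [K gK] := (bg L).2.
  apply: (site_means_dct (u := fun n x => u n x * g L x) (K := K)).
  + by move=> n; exact: bm1.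
  + exact: bm1.
  + move=> n x; have /andP[u0 u1] := u01 n x.
    by rewrite normrM ger0_norm// (le_trans _ (gK x))// ler_piMl.
  + by move=> x; apply: cvgM; [exact: uf|exact: cvg_cst].
Qed.

Lemma indep_tilt L f k : k \in L -> indep k (tilt L f).
Proof.
by move=> kL w s; rewrite /tilt !indep_site_means//; left.
Qed.

Lemma tilt_base L f o : tilt L f (base s0 L o) = tilt L f o.
Proof. by apply: override_indep => k kL; exact: indep_tilt. Qed.

Lemma tiltMl L h f o : (forall k, k \in L -> indep k h) -> bmeas f ->
  tilt L (fun x => h x * f x) o = h o * tilt L f o.
Proof.
move=> ih bf; rewrite /tilt mulrA; congr (_ / _).
rewrite -[RHS](congr1 (fun F => F o) (site_meansMl _ (V := enum_fset L) (g := h) ih _)).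
  by congr (site_means _ _ _ o); apply/funext => x; rewrite mulrA.
exact: bmeasM.
Qed.

Lemma tilt_indep L f o : (forall k, k \in L -> indep k f) -> tilt L f o = f o.
Proof.
move=> fi; rewrite -[X in tilt L X](_ : (fun x => f x * cst 1 x) = f).
  by rewrite tiltMl ?(mf_1 (tilt_mean_functional L o)) ?mulr1//; exact: bmeas_cst.
by apply/funext => x; rewrite mulr1.
Qed.

(** By the cocycle identity [g V] is [g L] times a factor constant in the spins of [L]. This factor
    cancels when the density [g V] is conditioned on the outside of [L]. *)
Lemma tilt_tilt L V f o : (L `<=` V)%fset -> bmeas f -> tilt V (tilt L f) o = tilt V f o.
Proof.
move=> LV bf; rewrite /tilt; congr (_ / _).
have LV' : {subset enum_fset L <= enum_fset V} by exact: fsubsetP.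
have bt : bmeas (tilt L f) by exact: bmeas_tilt.
have bgV : bmeas (fun x => g V (base s0 L x)).
  exact: (bmeas_comp (measurable_base s0 L) (bg V)).
have igV k : k \in enum_fset L -> indep k (fun x => g V (base s0 L x)).
  by move=> kL w s; rewrite /base override_updateK.
rewrite -(site_means_sub _ (W := enum_fset L)) ?fset_uniq//; last exact: bmeasM.
rewrite -[in RHS](site_means_sub _ (W := enum_fset L)) ?fset_uniq//; last exact: bmeasM.
congr (site_means _ _ _ o).
have gE h : (fun x => h x * g V x) = fun x => g V (base s0 L x) * (h x * g L x).
  by apply/funext => x; rewrite (g_cocycle x LV); lra.
rewrite !gE !(site_meansMl _ igV); try exact: bmeasM.
apply/funext => x; congr (_ * _).
have h : tilt L (tilt L f) x = tilt L f x by apply: tilt_indep => k; exact: indep_tilt.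
have Z0 : (JJ L (g L) x)^-1 != 0 by rewrite invr_eq0 gt_eqF// JJg_gt0.
exact: (mulIf Z0 h).
Qed.

Definition tilt_prob L o : probability (config G S) R :=
  functional_prob (tilt_mean_functional L o).

Lemma mean_tilt L o f : bmeas f -> \int[tilt_prob L o]_x f x = tilt L f o.
Proof. exact: mean_functional_prob. Qed.

Lemma tilt_probE L o B : measurable B -> tilt_prob L o B = (tilt L \1_B o)%:E.
Proof. by move=> mB; exact: functional_measureE. Qed.

Lemma measurable_tilt_prob L B : measurable B ->
  measurable_fun setT (fun o => tilt_prob L o B).
Proof.
move=> mB; have -> : (fun o => tilt_prob L o B) = fun o => (tilt L \1_B o)%:E.
  by apply/funext => o; exact: tilt_probE.
by apply/measurable_EFinP; exact: (bmeas_tilt L (bmeas_indic mB)).1.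
Qed.

Definition tilt_kernel L : R.-pker (config G S) ~> (config G S) :=
  prob_family (measurable_tilt_prob L).

Lemma tilt_quasilocal L f : bmeas f -> local_fun f -> quasilocal (tilt L f).
Proof.
move=> bf [V fV] e e0; have [K fK] := bf.2.
pose B := `|K| + 1; have B0 : 0 < B by rewrite ltr_pwDr.
have KB : K <= B by rewrite (le_trans (ler_norm _))// lerDl.
(* Numerator and denominator of [tilt] each cost a factor exp a. The shifted function f + B is
   nonnegative with average at most 2 B, so exp(a + a) = 1 + e / (2 B) gives an additive error of at
   most e. *)
pose a := ln (1 + e / (2 * B)) / 2.
have eB : 0 < e / (2 * B) by rewrite divr_gt0// mulr_gt0.
have ea : expR (a + a) = 1 + e / (2 * B) by rewrite -splitr lnK// posrE; lra.
have a0 : 0 < a.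
  have : 1 < expR (a + a) by rewrite ea; lra.
  by rewrite expR_gt1; lra.
have [V1 gV1] := g_ql L a0.
exists (V `|` V1)%fset => w w' ww'.
have bh : bmeas (fun x => f x + B) by apply: bmeasD => //; exact: bmeas_cst.
have h0 x : 0 <= f x + B.
  by have := fK x; rewrite ler_norml => /andP[? _]; lra.
have pl := mf_pl (tilt_mean_functional L _).
have tE o : tilt L f o = tilt L (fun x => f x + B) o - B.
  have cB : tilt L (cst B) o = B by exact: tilt_indep.
  by rewrite (plD (pl o) bf (bmeas_cst B)) [X in _ + X - _]cB addrK.
have t2B o : tilt L (fun x => f x + B) o <= 2 * B.
  have c2 : tilt L (cst (2 * B)) o = 2 * B by exact: tilt_indep.
  rewrite -[leRHS]c2.
  apply: (pl_le (pl o)) => //; first exact: bmeas_cst.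
  by move=> x /=; have := fK x; rewrite ler_norml => /andP[_ ?]; lra.
have key o o' : agree_on [set` (V `|` V1)%fset] o o' ->
    tilt L (fun x => f x + B) o <= expR (a + a) * tilt L (fun x => f x + B) o'.
  move=> oo'.
  have agr x x' : (forall k, k \notin enum_fset L -> x k = o k) ->
      (forall k, k \notin enum_fset L -> x' k = o' k) ->
      (forall k, k \in enum_fset L -> x k = x' k) ->
      agree_on [set` V] x x' /\ agree_on [set` V1] x x'.
    move=> xo x'o' xx'.
    have agrV V2 : (V2 `<=` V `|` V1)%fset -> agree_on [set` V2] x x'.
      move=> sV k /= kV; have [|kL] := boolP (k \in enum_fset L); first exact: xx'.
      by rewrite xo// x'o'//; apply: oo'; exact: (fsubsetP sV).
    by split; apply: agrV; [exact: fsubsetUl|exact: fsubsetUr].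
  have n1 : JJ L (fun x => (f x + B) * g L x) o <=
      expR a * JJ L (fun x => (f x + B) * g L x) o'.
    rewrite -site_meansZ; last exact: bmeasM.
    apply: le_site_means2 => [||x x' h1 h2 h3]; first exact: bmeasM.
      by apply: bmeasZ; exact: bmeasM.
    have [xV xV1] := agr x x' h1 h2 h3.
    by rewrite (fV _ _ xV) mulrCA ler_wpM2l// gV1.
  have n2 : JJ L (g L) o' <= expR a * JJ L (g L) o.
    rewrite -site_meansZ//.
    apply: le_site_means2 => [||x x' h1 h2 h3] //; first exact: bmeasZ.
    apply: gV1 => k kV; apply/esym.
    have h3' j : j \in enum_fset L -> x' j = x j by move=> /h3.
    by have [_ ->] := agr x' x h2 h1 h3'.
  rewrite /tilt ler_pdivrMr ?JJg_gt0// (le_trans n1)//.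
  rewrite expRD -!mulrA ler_wpM2l ?expR_ge0//.
  rewrite mulrCA -[leLHS]mulr1 ler_wpM2l//.
    by apply: ge_site_means_cst => [|x _]; [exact: bmeasM|rewrite mulr_ge0// ltW].
  by rewrite mulrCA ler_pdivlMl ?JJg_gt0// mulr1.
rewrite !tE opprB addrA subrK ler_norml; have := key _ _ ww'.
have w'w : agree_on [set` (V `|` V1)%fset] w' w by move=> k kV; rewrite ww'.
have := key _ _ w'w; rewrite ea.
have u1 := ler_wpM2l (ltW eB) (t2B w); have u2 := ler_wpM2l (ltW eB) (t2B w').
have E : e / (2 * B) * (2 * B) = e by rewrite divfK// gt_eqF// mulr_gt0.
rewrite E in u1 u2 => h1 h2.
by apply/andP; split; lra.
Qed.

Lemma tilt_specification : specification tilt_kernel.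
Proof.
split.
- move=> L B mB.
  (* Inserting [base s0 L], which reads only sites off [L], exhibits measurability with respect to
     the smaller sigma-algebra. *)
  have -> : tilt_kernel L ^~ B = (fun o => (tilt L \1_B o)%:E) \o (base s0 L).
    by apply/funext => o; rewrite /= tilt_base; exact: tilt_probE.
  apply: (measurableT_comp (f := fun o : config G S => (tilt L \1_B o)%:E)).
    by apply/measurable_EFinP; exact: (bmeas_tilt L (bmeas_indic mB)).1.
  apply: measurable_config => i; rewrite /base /override.
  case: (boolP (i \in enum_fset L)) => iL; first exact: measurable_cst.
  move=> _ C mC; rewrite setTI; apply: sub_sigma_algebra; exists i => /=.
    exact/negP.
  by exists C => //; rewrite setTI.
- move=> L E w mE; rewrite [LHS]tilt_probE; last exact: measurable_off_full mE.
  by rewrite tilt_indep// => k; exact: measurable_off_indep.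
- move=> L V w B LV mB.
  rewrite [RHS]tilt_probE// -(tilt_tilt _ LV); last exact: bmeas_indic.
  rewrite -mean_tilt; last by apply: bmeas_tilt; exact: bmeas_indic.
  rewrite EFin_mean; last by apply: bmeas_tilt; exact: bmeas_indic.
  by apply: eq_integral => o _; exact: tilt_probE.
- move=> L f mf sf lf.
  have bf : bmeas f.
    split => //; exists (fine (supnorm f)) => x.
    rewrite -lee_fin fineK; first by apply: ereal_sup_ubound; exists x.
    rewrite ge0_fin_numE//; apply: le_trans (ereal_sup_ubound _); last by exists x.
    by rewrite lee_fin.
  rewrite (_ : (fun w => _) = tilt L f); first exact: tilt_quasilocal.
  by apply/funext => w; exact: mean_tilt.
Qed.

End TiltedSpecification.

(** * The image of a Gibbs measure *)

Section Disintegration.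
Context {R : realType} {d d' : measure_display}.
Context {S : measurableType d} {S' : measurableType d'}.

(** Here [q s'] is carried by the fiber of [s'] only for almost every [s']. The Dobrushin estimates
    instead use, for every [s'], a set of full measure inside a single piece; it appears separately
    as [A]. *)
Record disintegration (alpha : probability S R) (alpha' : probability S' R)
    (T : S -> S') (q : S' -> probability S R) : Prop := {
  di_T : measurable_fun setT T ;
  di_q : forall U, measurable U -> measurable_fun setT (fun s' => q s' U) ;
  di_mean : forall U, measurable U -> alpha U = (\int[alpha']_s' q s' U)%E ;
  di_fiber : exists N, [/\ measurable N, alpha' N = 1%E &
    forall s', N s' -> exists D, [/\ measurable D, q s' D = 1%E &
      forall s, D s -> T s = s']] }.

Variables (alpha : probability S R) (alpha' : probability S' R).
Variables (T : S -> S') (q : S' -> probability S R).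
Hypothesis dq : disintegration alpha alpha' T q.

Let bmeas_q (f : S' * S -> R) : bmeas f -> bmeas (fun s' => \int[q s']_s f (s', s)).
Proof. exact: bmeas_kernel_mean (di_q dq) f. Qed.

Lemma disintegration_mean (h : S -> R) : bmeas h ->
  \int[alpha]_s h s = \int[alpha']_s' \int[q s']_s h s.
Proof.
move: h.
have bq k : bmeas k -> bmeas (fun s' => \int[q s']_s k s).
  move=> bk; apply: (bmeas_q (f := fun z : S' * S => k z.2)).
  exact: (bmeas_comp measurable_snd bk).
apply: (eq_positive_linear (F := fun h => \int[alpha]_s h s)
  (H := fun h => \int[alpha']_s' \int[q s']_s h s)).
- by split => [f g ? ?|c f ?|f g ? ? ?]; [exact: meanD|exact: meanZ|exact: le_mean].
- split => [f g bf bg|c f bf|f g bf bg fg].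
  + rewrite -meanD; [|exact: bq|exact: bq].
    by apply: eq_Rintegral => s' _; exact: meanD.
  + rewrite -meanZ; last exact: bq.
    by apply: eq_Rintegral => s' _; exact: meanZ.
  + apply: le_mean; [exact: bq|exact: bq|move=> s'; exact: le_mean].
move=> U mU; apply: EFin_inj; rewrite (mean_indic alpha mU) (di_mean dq mU).
rewrite EFin_mean; last by apply: bq; exact: bmeas_indic.
by apply: eq_integral => s' _; rewrite (mean_indic (q s') mU).
Qed.

(** Almost every [q s'] is carried by the fiber of [s'], where [T s] may be replaced by [s']. *)
Lemma disintegration_mean2 (f : S' * S -> R) : bmeas f ->
  \int[alpha]_s f (T s, s) = \int[alpha']_s' \int[q s']_s f (s', s).
Proof.
move=> bf.
have bh : bmeas (fun s => f (T s, s)).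
  apply: (bmeas_comp (h := fun s => (T s, s)) _ bf).
  by apply: measurable_fun_pair; [exact: (di_T dq)|exact: measurable_id].
rewrite disintegration_mean//; have [N [mN aN Nfib]] := di_fiber dq.
have bhq : bmeas (fun s' => \int[q s']_s f (T s, s)).
  apply: (bmeas_q (f := fun z : S' * S => f (T z.2, z.2))).
  exact: (bmeas_comp (h := snd) measurable_snd bh).
rewrite (mean_restrict mN aN bhq) (mean_restrict mN aN (bmeas_q bf)).
apply: eq_Rintegral => s' _; rewrite !indicE.
have [/set_mem Ns'|_] := boolP (s' \in N); last by rewrite !mulr0.
congr (_ * _); have [D [mD qD DT]] := Nfib _ Ns'.
rewrite (mean_restrict mD qD bh) (mean_restrict mD qD (bmeas_section s' bf)).
apply: eq_Rintegral => s _; rewrite indicE.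
by have [/set_mem/DT ->|_] := boolP (s \in D); last rewrite !mulr0.
Qed.

End Disintegration.

Section ImageIntegral.
Context {R : realType} {G : countType} {d d' : measure_display}.
Context {S : measurableType d} {S' : measurableType d'}.
Variables (alpha : probability S R) (alpha' : probability S' R).
Variables (T : {mfun S >-> S'}) (q : S' -> probability S R).
Hypothesis dq : disintegration alpha alpha' T q.

Lemma eq_site_means_local (PP : G -> probability S' R) (V : seq G) (f g : config G S' -> R) o :
  (forall x, (forall k, k \notin V -> x k = o k) -> f x = g x) ->
  site_means PP V f o = site_means PP V g o.
Proof.
elim: V o => [|k V IH] o fg /=; first exact: fg.
apply: eq_Rintegral => s _; apply: IH => x xo; apply: fg => i.
by rewrite inE negb_or => /andP[ik iV]; rewrite xo// /update (negbTE ik).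
Qed.

Lemma bmeas_site_means_param {dX} {X : measurableType dX} (V : seq G)
    (f : config G S' * X -> R) : bmeas f ->
  bmeas (fun z : config G S' * X => site_means (fun=> alpha') V (fun v => f (v, z.2)) z.1).
Proof.
move=> bf; elim: V => [|i V IH] /=; first by rewrite (_ : (fun z => _) = f)//; apply/funext => -[].
apply: (bmeas_mean alpha' (f := fun y : (config G S' * X) * S' =>
  site_means (fun=> alpha') V (fun v => f (v, y.1.2)) (update y.1.1 i y.2))).
apply: (bmeas_comp (h := fun y : (config G S' * X) * S' => (update y.1.1 i y.2, y.1.2)) _ IH).
apply: measurable_fun_pair.
  apply: (measurableT_comp (measurable_update i)
    (g := fun y : (config G S' * X) * S' => (y.1.1, y.2))).
  apply: measurable_fun_pair; last exact: measurable_snd.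
  exact: (measurableT_comp measurable_fst measurable_fst).
exact: (measurableT_comp measurable_snd measurable_fst).
Qed.

Lemma site_means_mean {dX} {X : measurableType dX} (P : probability X R)
    (V : seq G) (f : config G S' * X -> R) o : bmeas f ->
  \int[P]_x site_means (fun=> alpha') V (fun z => f (z, x)) o =
  site_means (fun=> alpha') V (fun z => \int[P]_x f (z, x)) o.
Proof.
move=> bf; elim: V o => //= k V IH o.
rewrite /site_mean; transitivity (\int[alpha']_s \int[P]_x
    site_means (fun=> alpha') V (fun z => f (z, x)) (update o k s)); last first.
  by apply: eq_Rintegral => s _; rewrite IH.
apply: (mean_swap P alpha'
  (f := fun z => site_means (fun=> alpha') V (fun v => f (v, z.1)) (update o k z.2))).
apply: (bmeas_comp (h := fun z : X * S' => (update o k z.2, z.1)) _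
  (bmeas_site_means_param V bf)).
apply: measurable_fun_pair; last exact: measurable_fst.
exact: (measurableT_comp (measurable_update1 o k) measurable_snd).
Qed.

Lemma sitewise_update (w : config G S) k s : sitewise T (update w k s) = update (sitewise T w) k (T s).
Proof. by apply/funext => i; rewrite /sitewise /update; case: eqP. Qed.

(** Induction on the sites: the average over [alpha] at [k] is split into a constraint drawn from
    [alpha'] and a spin drawn from [q]. The spin average is then moved past the constraints of the
    remaining sites by Fubini, which is why joint measurability in constraint and spin is needed. *)
Lemma image_site_means (V : seq G) (f : config G S' -> R) (h : config G S -> R) w :
  uniq V -> bmeas f -> bmeas h ->
  site_means (fun=> alpha) V (fun x => f (sitewise T x) * h x) w =
  site_means (fun=> alpha') V
    (fun o => f o * site_means (fun k => q (o k)) V h w) (sitewise T w).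
Proof.
move=> + bf bh; elim: V w => //= k V IH w /andP[kV uV].
have bm2 : bmeas (fun z : config G S' * config G S =>
    site_means (fun k => q ((z.1 : config G S') k)) V h z.2).
  exact: (bmeas_site_means_kernel (di_q dq)).
pose F (z : (S' * S) * config G S') : R := f z.2 * site_means (fun k => q (z.2 k)) V h (update w k z.1.2).
have bF : bmeas F.
  apply: bmeasM; first exact: (bmeas_comp (h := snd) measurable_snd bf).
  apply: (bmeas_comp (h := fun z : (S' * S) * config G S' => (z.2, update w k z.1.2)) _ bm2).
  apply: measurable_fun_pair; first exact: measurable_snd.
  apply: (measurableT_comp (measurable_update1 w k) (g := fun z : (S' * S) * config G S' => z.1.2)).
  exact: (measurableT_comp measurable_snd measurable_fst).
rewrite /site_mean.
have -> : (fun s => site_means (fun=> alpha) V (fun x => f (sitewise T x) * h x) (update w k s))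
  = fun s => site_means (fun=> alpha') V (fun o => F (T s, s, o)) (update (sitewise T w) k (T s)).
  by apply/funext => s; rewrite IH// sitewise_update.
have bJ : bmeas (fun z : S' * S => site_means (fun=> alpha') V (fun o => F (z, o))
    (update (sitewise T w) k z.1)).
  have bF' : bmeas (fun y : config G S' * (S' * S) => F (y.2, y.1)).
    apply: (bmeas_comp (h := fun y : config G S' * (S' * S) => (y.2, y.1)) _ bF).
    exact: measurable_fun_pair measurable_snd measurable_fst.
  apply: (bmeas_comp (h := fun z : S' * S => (update (sitewise T w) k z.1, z)) _
    (bmeas_site_means_param V bF')).
  apply: measurable_fun_pair; last exact: measurable_id.
  exact: (measurableT_comp (measurable_update1 (sitewise T w) k) measurable_fst).
rewrite (disintegration_mean2 dq (f := fun z => site_means (fun=> alpha') V (fun o => F (z, o))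
    (update (sitewise T w) k z.1)) bJ).
apply: eq_Rintegral => s' _ /=.
have bFs : bmeas (fun y : config G S' * S => F ((s', y.2), y.1)).
  apply: (bmeas_comp (h := fun y : config G S' * S => ((s', y.2), y.1)) _ bF).
  apply: measurable_fun_pair; last exact: measurable_fst.
  by apply: measurable_fun_pair; [exact: measurable_cst|exact: measurable_snd].
rewrite (site_means_mean (q s') V (update (sitewise T w) k s') bFs).
apply: eq_site_means_local => x xo.
have -> : x k = s' by rewrite xo// /update eqxx.
by rewrite /F/= meanZ//; apply: bmeas_update; exact: bmeas_site_means.
Qed.

End ImageIntegral.

Section ImageGibbs.
Context {R : realType} {G : countType} {d d' : measure_display}.
Context {S : measurableType d} {S' : measurableType d'} {same_piece : S -> S -> Prop}.
Context {H : {fset G} -> config G S -> R}.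
Context {C D : G -> G -> R} {c : R} {M : {fset G} -> R}.
Context {Delta kappa : {fset G} -> G -> R}.
Hypothesis model : dobrushin_model same_piece H C D c M Delta kappa.
Variables (alpha : probability S R) (alpha' : probability S' R).
Variables (T : {mfun S >-> S'}) (q : S' -> probability S R) (A : S' -> set S).
Hypothesis dq : disintegration alpha alpha' T q.
Hypotheses (mA : forall s', measurable (A s')) (qA : forall s', q s' (A s') = 1%E).
Hypothesis A_piece : forall s' s t, A s' s -> A s' t -> same_piece s t.
Variables (w0 : config G S) (s0 : S').
Implicit Types (V L : {fset G}) (f : config G S' -> R) (w : config G S).

Local Notation g := (cdens (H := H) q w0 s0).
Local Notation cpart := (cpart (H := H) q).
Local Notation JJ V := (site_means (fun=> alpha') (enum_fset V)).
Local Notation tilt := (tilt alpha' g).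

Let mq := di_q dq.
Let bg L : bmeas (g L). Proof. exact: (bmeas_cdens model mq mA qA A_piece w0 s0 L). Qed.
Let g_lb L : exists2 a : R, 0 < a & forall o, a <= g L o.
Proof.
exists (expR (- (4 * M L))); first exact: expR_gt0.
by move=> o; have /andP[] := cdens_bound model mA qA A_piece w0 s0 L o.
Qed.

Variable mu : probability (config G S) R.
Hypothesis mu_gibbs : forall V B, measurable B ->
  mu B = (\int[mu]_w (gibbs_mean (fun=> alpha) (H V) (enum_fset V) (\1_B : config G S -> R) w)%:E)%E.

Lemma gibbs_mean_pl V w :
  positive_linear (fun F => gibbs_mean (fun=> alpha) (H V) (enum_fset V) F w).
Proof.
have bB := bmeas_expNH model V.
have bm1 F : bmeas F -> bmeas (fun x : config G S => F x * boltzmann (H V) x).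
  by move=> bF; exact: bmeasM.
split=> [F F' bF bF'|a F bF|F F' bF bF' FF'].
- rewrite /gibbs_mean -mulrDl -site_meansD; try exact: bm1.
  by congr (site_means _ _ _ w / _); apply/funext => x; rewrite mulrDl.
- rewrite /gibbs_mean mulrA -site_meansZ; last exact: bm1.
  by congr (site_means _ _ _ w / _); apply/funext => x; rewrite mulrA.
- rewrite ler_pM2r ?invr_gt0 ?(partition_gt0 _ (dm_meas model V))//.
  apply: le_site_means => [||x _]; try exact: bm1.
  by rewrite ler_wpM2r ?expR_ge0.
Qed.

Lemma mu_gibbs_mean V F : bmeas F ->
  \int[mu]_w F w = \int[mu]_w gibbs_mean (fun=> alpha) (H V) (enum_fset V) F w.
Proof.
have bG F' : bmeas F' -> bmeas (gibbs_mean (fun=> alpha) (H V) (enum_fset V) F').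
  by move=> bF; exact: (bmeas_gibbs_mean _ (dm_meas model V)).
move: F; apply: (eq_positive_linear (F := fun F => \int[mu]_w F w)
  (H := fun F => \int[mu]_w gibbs_mean (fun=> alpha) (H V) (enum_fset V) F w)).
- by split => [f f' ? ?|a f ?|f f' ? ? ?]; [exact: meanD|exact: meanZ|exact: le_mean].
- split => [f f' bf bf'|a f bf|f f' bf bf' ff'].
  + rewrite -meanD; [|exact: bG|exact: bG].
    by apply: eq_Rintegral => w _; exact: (plD (gibbs_mean_pl V w)).
  + rewrite -meanZ; last exact: bG.
    by apply: eq_Rintegral => w _; exact: (plZ (gibbs_mean_pl V w)).
  + apply: le_mean; [exact: bG|exact: bG|move=> w; exact: (pl_le (gibbs_mean_pl V w))].
move=> B mB; apply: EFin_inj; rewrite (mean_indic mu mB) (mu_gibbs V mB).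
by rewrite EFin_mean//; apply: bG; exact: bmeas_indic.
Qed.

Lemma measurable_sitewise' : measurable_fun setT (sitewise (G := G) T).
Proof. exact: measurable_sitewise. Qed.

(* Both sides are images of the Gibbs kernel in V; under it the law of the image of the
   sites in V has density [cpart V], which is close to [g L] as a function of the sites
   in L. *)
Lemma gibbs_mean_image L e : 0 < e -> exists V : {fset G}, forall f w, bmeas f ->
  (forall o, 0 <= f o) ->
  let K F := gibbs_mean (fun=> alpha) (H V) (enum_fset V) (fun x => F (sitewise T x)) w in
  K f <= expR e * K (tilt L f) /\ K (tilt L f) <= expR e * K f.
Proof.
move=> e0; have e2 : 0 < e / 2 by rewrite divr_gt0.
have [V LV Vclose] := cdens_close model mA qA A_piece w0 s0 L e2; exists V => f w bf f0 K.
pose Z o := cpart V o w.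
have bZ : bmeas Z by exact: (bmeas_cpart_left model mq).
have Z0 o : 0 < Z o by exact: (cpart_gt0 model).
have KE F : bmeas F -> K F = JJ V (fun o => F o * Z o) (sitewise T w) /
    JJ V Z (sitewise T w).
  move=> bF; rewrite /K /gibbs_mean; congr (_ / _).
    exact: (image_site_means dq w (fset_uniq V) bF (bmeas_expNH model V)).
  have b1 : bmeas (cst 1 : config G S' -> R) by exact: bmeas_cst.
  have := image_site_means dq w (fset_uniq V) b1 (bmeas_expNH model V).
  rewrite (_ : (fun x : config G S => cst 1 (sitewise T x) * expR (- H V x)) =
    boltzmann (H V)); last first.
    by apply/funext => x; rewrite mul1r.
  by move=> ->; congr (site_means _ _ _ _); apply/funext => o; rewrite mul1r.
have bt : bmeas (tilt L f) by exact: bmeas_tilt.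
have bfZ : bmeas (fun o => f o * Z o) by exact: bmeasM.
have btZ : bmeas (fun o => tilt L f o * Z o) by exact: bmeasM.
have bfg : bmeas (fun o => f o * g L o) by exact: bmeasM.
have LV' : {subset enum_fset L <= enum_fset V} by exact: fsubsetP.
have JLg o : 0 < JJ L (g L) o by exact: (JJg_gt0 alpha' bg g_lb).
have JV0 : 0 < JJ V Z (sitewise T w).
  apply: lt_le_trans (expR_gt0 (- M V)) _; apply: ge_site_means_cst => // o _.
  apply: ge_site_means_cst => [|x _]; first exact: (bmeas_expNH model).
  by rewrite ler_expR lerN2 (le_trans (ler_norm _))// (dm_bound model).
have tiltE o : JJ L (fun x => tilt L f x * Z x) o = tilt L f o * JJ L Z o.
  rewrite (site_meansMl _ (g := tilt L f))// => k kL.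
  exact: indep_tilt.
have baseL o x : (forall k, k \notin enum_fset L -> x k = o k) -> base s0 L x = base s0 L o.
  by move=> xo; apply/funext => k; rewrite /base /override; case: ifPn => // /xo.
have h0 o : 0 <= JJ L (fun x => f x * g L x) o.
  apply: ge_site_means_cst => // x _; rewrite mulr_ge0//.
  by have [a a0 ag] := g_lb L; exact: le_trans (ltW a0) (ag x).
have inner o : JJ L (fun x => f x * Z x) o <= expR e * (tilt L f o * JJ L Z o) /\
    tilt L f o * JJ L Z o <= expR e * JJ L (fun x => f x * Z x) o.
  pose b := cpart V (base s0 L o) w.
  have b0 : 0 < b by exact: (cpart_gt0 model).
  have c1 x : (forall k, k \notin enum_fset L -> x k = o k) ->
      g L x * b <= expR (e / 2) * Z x /\ Z x <= expR (e / 2) * (g L x * b).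
    by move=> xo; rewrite /b -(baseL _ _ xo); exact: Vclose.
  (* As functions of the sites in [L], [Z] and [b] times [g L] agree up to a factor exp(e / 2): [n1]
     and [n2] use this in the numerator of [tilt], [n3] and [n4] in its normalization. *)
  have n1 : JJ L (fun x => f x * Z x) o <= expR (e / 2) * b * JJ L (fun x => f x * g L x) o.
    rewrite -site_meansZ//; apply: le_site_means => // [|x xo]; first exact: bmeasZ.
    by have := ler_wpM2l (f0 x) (c1 x xo).2; lra.
  have n2 : b * JJ L (fun x => f x * g L x) o <= expR (e / 2) * JJ L (fun x => f x * Z x) o.
    rewrite -!site_meansZ//; apply: le_site_means => [||x xo]; try exact: bmeasZ.
    by have := ler_wpM2l (f0 x) (c1 x xo).1; lra.
  have n3 : JJ L Z o <= expR (e / 2) * b * JJ L (g L) o.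
    rewrite -site_meansZ//; apply: le_site_means => // [|x xo]; first exact: bmeasZ.
    by have := (c1 x xo).2; lra.
  have n4 : b * JJ L (g L) o <= expR (e / 2) * JJ L Z o.
    rewrite -!site_meansZ//; apply: le_site_means => [||x xo]; try exact: bmeasZ.
    by have := (c1 x xo).1; lra.
  have ee : expR e = expR (e / 2) * expR (e / 2) by rewrite -expRD -splitr.
  have t0 : 0 <= tilt L f o by rewrite /tilt mulr_ge0// invr_ge0 ltW.
  have tE : JJ L (fun x => f x * g L x) o = tilt L f o * JJ L (g L) o.
    by rewrite /tilt divfK// gt_eqF.
  rewrite tE in n1 n2; split.
    apply: (le_trans n1); have := ler_wpM2l (mulr_ge0 (expR_ge0 (e / 2)) t0) n4.
    by rewrite ee; lra.
  have := ler_wpM2l t0 n3; have := ler_wpM2l (expR_ge0 (e / 2)) n2.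
  by rewrite ee; lra.
rewrite !KE// !mulrA; split.
  rewrite ler_wpM2r ?invr_ge0 ?(ltW JV0)//.
  rewrite -(site_means_sub _ (W := enum_fset L)) ?fset_uniq//.
  rewrite -[in leRHS](site_means_sub _ (W := enum_fset L)) ?fset_uniq//.
  rewrite -site_meansZ; last exact: bmeas_site_means.
  apply: le_site_means => [||x _]; [exact: bmeas_site_means|apply: bmeasZ; exact: bmeas_site_means|].
  by rewrite tiltE; exact: (inner x).1.
rewrite ler_wpM2r ?invr_ge0 ?(ltW JV0)//.
rewrite -(site_means_sub _ (W := enum_fset L)) ?fset_uniq//.
rewrite -[in leRHS](site_means_sub _ (W := enum_fset L)) ?fset_uniq//.
rewrite -site_meansZ; last exact: bmeas_site_means.
apply: le_site_means => [||x _]; [exact: bmeas_site_means|apply: bmeasZ; exact: bmeas_site_means|].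
by rewrite tiltE; exact: (inner x).2.
Qed.

(** The volume of the comparison depends on e, but the Gibbs property removes it on integration over
    [mu], so e may tend to 0. *)
Lemma image_tilt_mean L f : bmeas f -> (forall o, 0 <= f o) ->
  \int[mu]_w f (sitewise T w) = \int[mu]_w tilt L f (sitewise T w).
Proof.
move=> bf f0.
have bt : bmeas (tilt L f) by exact: bmeas_tilt.
have bfT : bmeas (fun w => f (sitewise T w)) by exact: (bmeas_comp measurable_sitewise' bf).
have btT : bmeas (fun w => tilt L f (sitewise T w)).
  exact: (bmeas_comp measurable_sitewise' bt).
set a := LHS; set b := RHS.
have key e : 0 < e -> a <= expR e * b /\ b <= expR e * a.
  move=> e0; have [V Ve] := gibbs_mean_image L e0.
  have bG F : bmeas F -> bmeas (gibbs_mean (fun=> alpha) (H V) (enum_fset V) F).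
    by move=> bF; exact: (bmeas_gibbs_mean _ (dm_meas model V)).
  rewrite /a /b (mu_gibbs_mean V bfT) (mu_gibbs_mean V btT).
  rewrite -!meanZ; try exact: bG.
  split; apply: le_mean => [||w]; try exact: bG; try (by apply: bmeasZ; exact: bG).
    exact: (Ve f w bf f0).1.
  exact: (Ve f w bf f0).2.
have a0 : 0 <= a by rewrite -(mean_cst mu 0); apply: le_mean => //; exact: bmeas_cst.
have lim (x y : R) : 0 <= x -> (forall e, 0 < e -> y <= expR e * x) -> y <= x.
  move=> x0 h; apply/ler_addgt0Pr => e e0.
  have p : 0 < e / (x + 1) by rewrite divr_gt0// ltr_wpDl.
  have q0 : 0 < ln (1 + e / (x + 1)).
    by rewrite -expR_gt1 lnK ?posrE; lra.
  apply: le_trans (h _ q0) _; rewrite lnK ?posrE; last lra.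
  rewrite mulrDl mul1r lerD2l -mulrA ler_piMr ?(ltW e0)//.
  by rewrite mulrC ler_pdivrMr ?ltr_wpDl// mul1r lerDl.
have b0 : 0 <= b.
  have [_ h] := key 1 ltr01.
  have [h' _] := key 1 ltr01.
  have : 0 <= expR 1 * b by exact: le_trans h'.
  by rewrite pmulr_rge0// expR_gt0.
apply/eqP; rewrite eq_le; apply/andP; split; apply: lim => // e e0.
  exact: (key e e0).1.
exact: (key e e0).2.
Qed.

End ImageGibbs.

(** Split the integral at the set where h1 >= h2: each part is a difference of measures of one set,
    hence at most K, and half of the sum is at most K. *)
Lemma tv_dist_le {R : realType} {d} {X : measurableType d} (nu1 nu2 : set X -> \bar R) (K : R) :
  (forall B, measurable B -> (nu1 B <= nu2 B + K%:E)%E) ->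
  (forall B, measurable B -> (nu2 B <= nu1 B + K%:E)%E) ->
  (tv_dist nu1 nu2 <= K%:E)%E.
Proof.
move=> h12 h21; apply: ge_ereal_sup => t [la [h1 [h2 [i1 i2 E1 E2 ->]]]].
pose P := [set x | h2 x <= h1 x].
have mh1 : measurable_fun setT h1 by apply/measurable_EFinP; have /integrableP[] := i1.
have mh2 : measurable_fun setT h2 by apply/measurable_EFinP; have /integrableP[] := i2.
have mP : measurable P.
  by rewrite -[X in measurable X]setTI; exact: measurable_fun_le.
have mPC : measurable (~` P) by exact: measurableC.
have mabs : measurable_fun setT (fun x => `|h1 x - h2 x|%:E : \bar R).
  by apply/measurable_EFinP; apply: measurableT_comp => //; exact: measurable_funB.
have iS f D : measurable D -> la.-integrable setT f -> la.-integrable D f.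
  by move=> mD; apply: integrableS.
have fin f D : measurable D -> la.-integrable setT (EFin \o f) ->
    (\int[la]_(x in D) (f x)%:E)%E \is a fin_num.
  by move=> mD fi; apply: integrable_fin_num => //; exact: iS.
rewrite -(setUv P) ge0_integral_setU//; last 2 first.
- by rewrite setUv.
- exact/disj_setPCl.
have -> : (\int[la]_(x in P) `|h1 x - h2 x|%:E = nu1 P - nu2 P)%E.
  rewrite E1// E2// -integralB_EFin//; [|exact: iS|exact: iS].
  by apply: eq_integral => x /set_mem Px; rewrite ger0_norm ?subr_ge0// EFinB.
have -> : (\int[la]_(x in ~` P) `|h1 x - h2 x|%:E = nu2 (~` P) - nu1 (~` P))%E.
  rewrite E1// E2// -integralB_EFin//; [|exact: iS|exact: iS].
  apply: eq_integral => x /set_mem /negP; rewrite -ltNge => Px.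
  by rewrite distrC gtr0_norm ?subr_gt0// EFinB.
have k1 : (nu1 P - nu2 P <= K%:E)%E.
  by rewrite leeBlDl ?E2 ?fin// -E2//; exact: h12.
have k2 : (nu2 (~` P) - nu1 (~` P) <= K%:E)%E.
  by rewrite leeBlDl ?E1 ?fin// -E1//; exact: h21.
apply: le_trans (lee_wpmul2l _ (leeD k1 k2)) _; first by rewrite lee_fin invr_ge0.
by rewrite -EFinD -EFinM lee_fin; lra.
Qed.

Section SingleSiteVariation.
Context {R : realType} {G : countType} {d : measure_display}.
Context {S : measurableType d}.
Variables (P : probability S R) (s0 : S) (g : {fset G} -> config G S -> R).
Hypothesis bg : forall L, bmeas (g L).
Hypothesis g_lb : forall L, exists2 c : R, 0 < c & forall o, c <= g L o.

Lemma tilt1E i (f : config G S -> R) w : tilt P g [fset i]%fset f w =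
  (\int[P]_s (f (update w i s) * g [fset i]%fset (update w i s))) /
  \int[P]_s g [fset i]%fset (update w i s).
Proof. by rewrite /tilt enum_fset1E. Qed.

(** For [j] different from [i], integrating the cross ratio bound gives p <= e^K p' for the
    probabilities of any set, hence p' >= e^{-K} p >= (1 - K) p >= p - K. For j = i the two kernels
    coincide. *)
Lemma dobrushin_tilt_le i j (K : R) : 0 <= K ->
  (j != i -> forall w w' s t, agree_off j w w' ->
    g [fset i]%fset (update w i s) * g [fset i]%fset (update w' i t) <=
    expR K * (g [fset i]%fset (update w' i s) * g [fset i]%fset (update w i t))) ->
  (dobrushin_matrix (tilt_kernel P bg g_lb) i j <= K%:E)%E.
Proof.
move=> K0 gK; apply: ge_ereal_sup => _ [[w w'] /= ww' ->].
pose gi := g [fset i]%fset.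
have bu (f : config G S -> R) v : bmeas f -> bmeas (fun s => f (update v i s)).
  exact: bmeas_update.
have bgi v : bmeas (fun s => gi (update v i s)) by exact: (bu gi v (bg _)).
have gi0 x : 0 < gi x by have [a a0 ag] := g_lb [fset i]%fset; exact: lt_le_trans (ag x).
have mB (B : set S) : measurable B -> measurable [set v : config G S | B (v i)].
  by move=> mB; rewrite -[X in measurable X]setTI; exact: measurable_coord.
have Z0 v : 0 < \int[P]_s gi (update v i s).
  have [a a0 ag] := g_lb [fset i]%fset; apply: (lt_le_trans a0).
  have := le_mean P (bmeas_cst a) (bu gi v (bg _)) (fun s => ag _).
  by rewrite mean_cst.
have key B v v' : measurable B -> agree_off j v v' ->
    (single_site (tilt_kernel P bg g_lb) i v B <=
     single_site (tilt_kernel P bg g_lb) i v' B + K%:E)%E.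
  move=> mB' vv'; rewrite /single_site.
  rewrite [X in (X <= _)%E](tilt_probE _ bg g_lb _ _ (mB _ mB')).
  rewrite [X in (_ <= X + _)%E](tilt_probE _ bg g_lb _ _ (mB _ mB')).
  rewrite -EFinD lee_fin !tilt1E.
  have iE u s : (\1_[set v : config G S | B (v i)] (update u i s) : R) = \1_B s.
    by rewrite !indicE; congr ((nat_of_bool _)%:R); apply/idP/idP => /set_mem h;
      apply/mem_set; move: h; rewrite /= /update eqxx.
  have E1 u : (fun s => \1_[set v : config G S | B (v i)] (update u i s) *
      g [fset i]%fset (update u i s)) = fun s => \1_B s * gi (update u i s).
    by apply/funext => s; rewrite iE.
  rewrite !E1 -/gi.
  have bN u : bmeas (fun s => \1_B s * gi (update u i s)).
    by apply: bmeasM; [exact: bmeas_indic|exact: bgi].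
  have N1 u : (\int[P]_s (\1_B s * gi (update u i s))) / \int[P]_s gi (update u i s) <= 1.
    rewrite ler_pdivrMr// mul1r; apply: le_mean => [||s]; [exact: bN|exact: bgi|].
    by rewrite ler_piMl ?(ltW (gi0 _))// indicE; case: (s \in B).
  have N0 u : 0 <= (\int[P]_s (\1_B s * gi (update u i s))) / \int[P]_s gi (update u i s).
    rewrite divr_ge0 ?(ltW (Z0 _))// -(mean_cst P 0); apply: le_mean => [||s]; [exact: bmeas_cst| |].
      exact: bN.
    by rewrite mulr_ge0 ?(ltW (gi0 _)).
  have [ji|ji] := eqVneq j i.
    have E s : update v i s = update v' i s.
      by apply/funext => k; rewrite /update; case: (eqVneq k i) => // ki; apply: vv'; rewrite /= ji.
    under eq_Rintegral do rewrite E.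
    under [X in _ / X <= _]eq_Rintegral do rewrite E.
    by rewrite lerDl.
  have h : (\int[P]_s (\1_B s * gi (update v i s))) / (\int[P]_s gi (update v i s)) <=
      expR K * ((\int[P]_s (\1_B s * gi (update v' i s))) / (\int[P]_s gi (update v' i s))).
    set Zv := \int[P]_s gi (update v i s); set Zv' := \int[P]_s gi (update v' i s).
    have Zv0 : 0 < Zv by exact: Z0.
    have Zv'0 : 0 < Zv' by exact: Z0.
    rewrite ler_pdivrMr// mulrA mulrAC ler_pdivlMr//.
    have mZ a (f : config G S -> R) u : bmeas f ->
        a * \int[P]_t f (update u i t) = \int[P]_t (a * f (update u i t)).
      by move=> bf; rewrite meanZ//; exact: bu.
    have inner s : gi (update v i s) * Zv' <= expR K * Zv * gi (update v' i s).
      rewrite [leRHS]mulrAC /Zv /Zv' !(mZ _ gi _ (bg _)).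
      apply: le_mean => [||t]; try by (apply: bmeasZ; exact: bgi).
      by have := gK ji _ _ s t vv'; rewrite -/gi; lr.
    have -> : (\int[P]_s (\1_B s * gi (update v i s))) * Zv' =
        \int[P]_s (Zv' * (\1_B s * gi (update v i s))) by rewrite (meanZ _ _ (bN _)) mulrC.
    have -> : expR K * (\int[P]_s (\1_B s * gi (update v' i s))) * Zv =
        \int[P]_s (expR K * Zv * (\1_B s * gi (update v' i s))) by rewrite (meanZ _ _ (bN _)) mulrAC.
    apply: le_mean => [||s]; try by (apply: bmeasZ; exact: bN).
    by rewrite mulrCA [leRHS]mulrCA ler_wpM2l// mulrC.
  have e1 : 1 - K <= expR (- K) by have := expR_ge1Dx (- K).
  set p := _ / _ in h *; set p' := (X in _ <= X + _).
  rewrite -/p' in h.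
  have : expR (- K) * p <= p'.
    by rewrite expRN mulrC ler_pdivrMr ?expR_gt0// mulrC.
  have := ler_wpM2r (N0 v) e1; rewrite -/p.
  have : K * p <= K * 1 by rewrite ler_wpM2l// N1.
  lra.
apply: tv_dist_le => B mB'; apply: key => //.
by move=> k kj; rewrite ww'.
Qed.

End SingleSiteVariation.

(** * Disintegration in standard Borel spaces *)

Section TernaryCode.
Context {R : realType}.
Implicit Types (b : nat -> bool) (r : R).

(* Ternary digits 0 and 2 only, so that comparison with 1/2 recovers the leading digit. *)
Definition code_sum b k N : R := \sum_(n < N) (2 * (b (k + n)%N)%:R) / 3 ^+ n.+1.

Definition code b k : R := limn (code_sum b k).

(** Deletes the leading ternary digit, which comparison with 1/2 identifies as 0 or 2. *)
Definition code_shift r : R := 3 * r - 2 * ((2^-1 <= r)%R)%:R.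

Definition digit n r : bool := 2^-1 <= iter n code_shift r.

Lemma code_sum_nd b k : nondecreasing_seq (code_sum b k).
Proof.
apply/nondecreasing_seqP => n; rewrite /code_sum big_ord_recr/= lerDl.
by rewrite divr_ge0 ?mulr_ge0// exprn_ge0.
Qed.

Lemma code_sum_le1 b k N : code_sum b k N <= 1.
Proof.
suff h : code_sum b k N <= 1 - 3 ^- N.
  have h3 : 0 <= 3 ^- N :> R by rewrite invr_ge0 exprn_ge0.
  by apply: (le_trans h); rewrite gerBl.
elim: N => [|N IH]; first by rewrite /code_sum big_ord0 expr0 invr1 subrr.
rewrite /code_sum big_ord_recr/= -/(code_sum b k N).
have t0 : 0 < 3 ^+ N.+1 :> R by rewrite exprn_gt0.
have e : 3 ^- N = 3 * 3 ^- N.+1 :> R by rewrite exprS invfM mulrA divff ?mul1r ?pnatr_eq0.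
have : (2 * (b (k + N)%N)%:R) / 3 ^+ N.+1 <= 2 * 3 ^- N.+1 :> R.
  rewrite ler_wpM2r ?invr_ge0 ?(ltW t0)//; case: (b _) => /=; lra.
by move: IH; rewrite e => h1 h2; lra.
Qed.

Lemma code_sumS b k N :
  code_sum b k N.+1 = 2 / 3 * (b k)%:R + 3^-1 * code_sum b k.+1 N.
Proof.
rewrite /code_sum big_ord_recl/= addn0 expr1; congr (_ + _); first by rewrite mulrAC.
rewrite mulr_sumr; apply: eq_bigr => n _ /=.
by rewrite /bump/= add1n addSnnS [in LHS]exprS invfM mulrCA.
Qed.

Lemma code_cvg b k : code_sum b k @ \oo --> code b k.
Proof.
apply: nondecreasing_is_cvgn; first exact: code_sum_nd.
by exists 1 => _ [N _ <-]; exact: code_sum_le1.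
Qed.

Lemma code_ge0 b k : 0 <= code b k.
Proof.
apply: (cvgn_ge (N := 0%N) (@code_cvg b k)) => N _.
by apply: sumr_ge0 => n _; rewrite divr_ge0 ?mulr_ge0// exprn_ge0.
Qed.

Lemma code_le1 b k : code b k <= 1.
Proof.
by apply: (cvgn_le (N := 0%N) (@code_cvg b k)) => N _; exact: code_sum_le1.
Qed.

Lemma codeS b k : code b k = 2 / 3 * (b k)%:R + 3^-1 * code b k.+1.
Proof.
have h : (fun N => code_sum b k (N + 1)) @ \oo --> code b k.
  by rewrite (cvg_shiftn 1 (code_sum b k)); exact: code_cvg.
have h' : (fun N => 2 / 3 * (b k)%:R + 3^-1 * code_sum b k.+1 N) @ \oo -->
    2 / 3 * (b k)%:R + 3^-1 * code b k.+1.
  apply: cvgD; first exact: cvg_cst.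
  by apply: cvgM; [exact: cvg_cst|exact: code_cvg].
rewrite -(cvg_lim _ h)// -(cvg_lim _ h')//; congr (limn _).
by apply/funext => N; rewrite addn1 code_sumS.
Qed.

(** The later digits contribute between 0 and 1/3, so the code is at least 2/3 or at most 1/3
    according to the leading digit. *)
Lemma code_half b k : (2^-1 <= code b k) = b k.
Proof.
have := code_ge0 b k.+1; have := code_le1 b k.+1; rewrite (codeS b k) => c1 c0.
by case: (b k) => /=; [apply/idP|apply/negbTE; rewrite -ltNge]; lra.
Qed.

Lemma iter_code_shift b n : iter n code_shift (code b 0) = code b n.
Proof.
elim: n => //= n ->; rewrite /code_shift code_half (codeS b n).
by lra.
Qed.

Lemma digit_code b n : digit n (code b 0) = b n.
Proof. by rewrite /digit iter_code_shift code_half. Qed.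

Lemma measurable_digit n : measurable [set r | digit n r].
Proof.
have mb : measurable_fun setT (fun r : R => 2^-1 <= r).
  by apply: measurable_fun_ler; [exact: measurable_cst|exact: measurable_id].
have ms : measurable_fun setT code_shift.
  apply: measurable_funB; first by apply: measurable_funM.
  apply: measurable_funM => //.
  rewrite (_ : (fun r => _) = \1_[set r : R | 2^-1 <= r]).
    apply: measurable_indic; rewrite -[X in measurable X]setTI.
    by apply: measurable_fun_le.
  by apply/funext => r; rewrite indicE; congr ((nat_of_bool _)%:R); apply/idP/idP; rewrite inE.
have mi : measurable_fun setT (iter n code_shift).
  elim: n => [|n IH]; first exact: measurable_id.
  exact: (measurableT_comp ms IH).
by rewrite -[X in measurable X]setTI; apply: measurable_fun_le.
Qed.

Lemma measurable_code {d} {X : measurableType d} (b : X -> nat -> bool) :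
  (forall n, measurable [set x | b x n]) -> measurable_fun setT (fun x => code (b x) 0).
Proof.
move=> mb; apply: (measurable_fun_cvg (h := fun N x => code_sum (b x) 0 N)) => [N|x _].
  apply: measurable_sum => n; apply: measurable_funM => //; apply: measurable_funM => //.
  rewrite (_ : (fun x => _) = \1_[set x | b x (0 + n)%N]).
    by apply: measurable_indic; exact: mb.
  by apply/funext => x; rewrite indicE; congr ((nat_of_bool _)%:R); apply/idP/idP; rewrite inE.
exact: code_cvg.
Qed.

End TernaryCode.

Section DigitCoding.
Context {R : realType} (P : completePseudoMetricType R).
Hypothesis hP : hausdorff_space P.
Variable U : nat -> set P.
Hypothesis oU : forall n, open (U n).
Hypothesis bU : forall x O, nbhs x O -> exists n, U n x /\ U n `<=` O.

(* By completeness, these are exactly the indicators of the sets of basic open sets that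
   contain a given point; as they only involve countably many digits, the set of codes of
   points is Borel. *)
Record coherent (d : nat -> bool) : Prop := {
  coh_small : forall j : nat, exists n, d n /\ exists y, U n `<=` ball y (j.+1%:R^-1 : R) ;
  coh_meet : forall n m, d n -> d m -> U n `&` U m !=set0 ;
  coh_closure : forall n, d n <-> exists m, d m /\ closure (U m) `<=` U n }.

Definition codes (d : nat -> bool) (x : P) : Prop := forall n, d n <-> U n x.

Lemma codes_uniq d x y : codes d x -> codes d y -> x = y.
Proof.
move=> dx dy; apply: hP => A B xA yB; have [n [Unx UA]] := bU xA.
exists y; split; first by apply: UA; apply/dy/dx.
exact: nbhs_singleton.
Qed.

Lemma codes_coherent d x : codes d x -> coherent d.
Proof.
move=> dx; split.
- move=> j; have j0 : 0 < j.+1%:R^-1 :> R by rewrite invr_gt0.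
  have [n [Unx UB]] := bU (nbhsx_ballx x _ j0).
  by exists n; split; [exact/dx|exists x].
- by move=> n m /dx Unx /dx Umx; exists x.
- move=> n; split => [/dx Unx|[m [/dx Umx UmUn]]]; last first.
    by apply/dx; apply: UmUn; exact: subset_closure.
  have [V xV VU] : filter_from (nbhs x) closure (U n).
    by apply: uniform_regular; exact: open_nbhs_nbhs.
  have [m [Umx UmV]] := bU xV; exists m; split; first exact/dx.
  exact: subset_trans (closureS UmV) VU.
Qed.

(** Points chosen in ever smaller sets of the family form a Cauchy sequence because the sets meet
    pairwise. [coh_closure] works in both directions: the limit lies in the closure of a coded set
    contained in [U n], and around the limit a small coded set has its closure inside [U n]. *)
Lemma coherent_codes d : coherent d -> exists x, codes d x.
Proof.
move=> cd.
have /choice[N NE] : forall j : nat, exists n, d n /\ exists y, U n `<=` ball y (j.+1%:R^-1 : R).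
  exact: coh_small cd.
have dN j : d (N j) by have [] := NE j.
have /choice[p pE] : forall j, exists x, U (N j) x.
  by move=> j; have [x []] := coh_meet cd (dN j) (dN j); exists x.
have near j x y : U (N j) x -> U (N j) y -> ball x (2 * j.+1%:R^-1 : R) y.
  move=> Ux Uy; have [_ [z UB]] := NE j.
  rewrite mulr_natl mulr2n; apply: (@ball_triangle _ _ z); last exact: UB.
  by apply: ball_sym; exact: UB.
have small (e : R) : 0 < e -> exists J : nat, forall j, (J <= j)%N -> 2 * j.+1%:R^-1 <= e.
  move=> e0; exists (Num.trunc (2 / e)) => j Jj.
  rewrite ler_pdivrMr// mulrC -ler_pdivrMr// ltW//.
  by apply: lt_le_trans (truncnS_gt (2 / e)) _; rewrite ler_nat ltnS.
have cp : cvg (p @ \oo).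
  apply: cauchy_cvg; apply: cauchy_exP => e e0.
  have e2 : 0 < e / 2 by rewrite divr_gt0.
  have [J Je] := small _ e2; exists (p J); exists J => // j /= Jj.
  have [z [Uz Uz']] := coh_meet cd (dN J) (dN j).
  rewrite [e]splitr; apply: (@ball_triangle _ _ z).
    by apply: le_ball (near J _ _ (pE J) Uz); exact: Je.
  by apply: le_ball (near j _ _ Uz' (pE j)); exact: Je.
pose x := lim (p @ \oo).
have px (e : R) : 0 < e -> exists J : nat, forall j, (J <= j)%N -> ball x e (p j).
  by move=> e0; have [J _ Jx] := cvg_ball cp e0; exists J => j Jj; exact: Jx.
exists x => n; split => [|Unx].
  move=> /(coh_closure cd)[m [dm UmUn]]; apply: UmUn => B /nbhs_ballP[e /= e0 eB].
  have e2 : 0 < e / 2 by rewrite divr_gt0.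
  have [J Jx] := px _ e2; have [J' Je] := small _ e2.
  pose j := maxn J J'.
  have [z [Uz Umz]] := coh_meet cd (dN j) dm; exists z; split => //; apply: eB.
  rewrite [e]splitr; apply: (@ball_triangle _ _ (p j)); first by apply: Jx; exact: leq_maxl.
  by apply: le_ball (near j _ _ (pE j) Uz); apply: Je; exact: leq_maxr.
apply/(coh_closure cd).
have /nbhs_ballP[e /= e0 eU] : nbhs x (U n) by exact: open_nbhs_nbhs.
have e2 : 0 < e / 2 by rewrite divr_gt0.
have e4 : 0 < e / 2 / 2 by rewrite divr_gt0.
have [J Jx] := px _ e2; have [J' Je] := small _ e4.
pose j := maxn J J'; exists (N j); split => // z cz; apply: eU.
have [y [Uy zy]] := cz _ (nbhsx_ballx z _ e4).
rewrite [e]splitr; apply: (@ball_triangle _ _ (p j)); first by apply: Jx; exact: leq_maxl.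
rewrite [e / 2]splitr; apply: (@ball_triangle _ _ y); last exact: ball_sym.
by apply: le_ball (near j _ _ (pE j) Uy); apply: Je; exact: leq_maxr.
Qed.

Let mdig n : measurable [set r : R | digit n r] := measurable_digit n.

Let mdigP n (Q : Prop) : measurable [set r : R | digit n r /\ Q].
Proof.
have [HQ|HQ] := pselect Q.
  by rewrite (_ : [set _ | _] = [set r : R | digit n r])//; apply/seteqP; split => r //= [].
by rewrite (_ : [set _ | _] = set0)//; apply/seteqP; split => r //= [].
Qed.

Lemma measurable_coherent : measurable [set r : R | coherent (digit ^~ r)].
Proof.
pose A1 := \bigcap_(j in [set: nat]) \bigcup_(n in [set: nat])
  [set r : R | digit n r /\ exists y, U n `<=` ball y (j.+1%:R^-1 : R)].
pose A2 := \bigcap_(n in [set: nat]) \bigcap_(m in [set: nat])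
  (~` [set r : R | digit n r /\ ~ (U n `&` U m !=set0)] `|` ~` [set r : R | digit m r]).
pose F n := \bigcup_(m in [set: nat]) [set r : R | digit m r /\ closure (U m) `<=` U n].
pose E n := [set r : R | digit n r].
pose A3 := \bigcap_(n in [set: nat]) ((E n `&` F n) `|` (~` E n `&` ~` F n)).
have mF n : measurable (F n) by apply: bigcupT_measurable => m; exact: mdigP.
have -> : [set r : R | coherent (digit ^~ r)] = A1 `&` A2 `&` A3.
  apply/seteqP; split => r /=.
    move=> cr; split; first split.
    - by move=> j _; have [n] := coh_small cr j; exists n.
    - move=> n _ m _; have [dm|dm] := boolP (digit m r); last by right; exact/negP.
      by left => -[dn nm]; apply: nm; exact: (coh_meet cr dn dm).
    - move=> n _; have [dn|dn] := boolP (digit n r); [left|right].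
        by split => //; have /(coh_closure cr)[m] := dn; exists m.
      split; first exact/negP.
      move=> [m _ hm]; move/negP: dn; apply; apply/(coh_closure cr).
      by exists m.
  move=> [[h1 h2] h3]; split.
  - by move=> j; have [n _] := h1 j Logic.I; exists n.
  - move=> n m dn dm; have [h|h] := h2 n Logic.I m Logic.I; last by case: h.
    by apply: contrapT => h'; apply: h; split.
  - move=> n; have [[En [m _ Fm]]|[En Fn]] := h3 n Logic.I.
      by split => // _; exists m.
    by split => [/En//|[m hm]]; case: Fn; exists m.
apply: measurableI; first apply: measurableI.
- by apply: bigcapT_measurable => j; apply: bigcupT_measurable => n; exact: mdigP.
- apply: bigcapT_measurable => n; apply: bigcapT_measurable => m.
  by apply: measurableU; apply: measurableC => //; exact: mdigP.
- apply: bigcapT_measurable => n; apply: measurableU; apply: measurableI.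
  + exact: mdig.
  + exact: mF.
  + by apply: measurableC; exact: mdig.
  + by apply: measurableC; exact: mF.
Qed.

(** The sets with measurable image form a sigma-algebra; for complements, a coherent sequence that
    codes no point of a set codes a point outside it. This is the Lusin-Souslin theorem for this
    particular injection. *)
Lemma measurable_coded (B : set P) : <<s [set O : set P | open O] >> B ->
  measurable [set r : R | exists x, codes (digit ^~ r) x /\ B x].
Proof.
pose CC := [set B : set P | measurable [set r : R | exists x, codes (digit ^~ r) x /\ B x]].
suff : <<s [set O : set P | open O] >> `<=` CC by move=> /(_ B).
apply: smallest_sub.
  split.
  - rewrite /CC/= (_ : [set r | _] = set0)//.
    by apply/seteqP; split => r //= -[x []].
  - move=> A mA; rewrite /CC/=.
    rewrite (_ : [set r | _] = [set r : R | coherent (digit ^~ r)] `\`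
        [set r : R | exists x, codes (digit ^~ r) x /\ A x]).
      by apply: measurableD => //; exact: measurable_coherent.
    apply/seteqP; split => r /=.
      move=> [x [cx [_ nA]]]; split; first exact: codes_coherent cx.
      by move=> [y [cy Ay]]; apply: nA; rewrite (codes_uniq cx cy).
    move=> [/coherent_codes[x cx] nA]; exists x; split => //; split => // Ax.
    by apply: nA; exists x.
  - move=> A mA; rewrite /CC/=.
    rewrite (_ : [set r | _] = \bigcup_n [set r : R | exists x, codes (digit ^~ r) x /\ A n x]).
      by apply: bigcupT_measurable => n; exact: mA.
    apply/seteqP; split => r /=.
      by move=> [x [cx [n _ An]]]; exists n => //; exists x.
    by move=> [n _ [x [cx An]]]; exists x; split => //; exists n.
move=> O oO; rewrite /CC/=.
rewrite (_ : [set r | _] = [set r : R | coherent (digit ^~ r)] `&`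
    \bigcup_n [set r : R | digit n r /\ U n `<=` O]).
  apply: measurableI; first exact: measurable_coherent.
  by apply: bigcupT_measurable => n; exact: mdigP.
apply/seteqP; split => r /=.
  move=> [x [cx Ox]]; split; first exact: codes_coherent cx.
  have [n [Unx UO]] := bU (open_nbhs_nbhs (conj oO Ox)).
  by exists n => //; split => //; exact/cx.
move=> [/coherent_codes[x cx] [n _ [dn UO]]]; exists x; split => //.
by apply: UO; exact/cx.
Qed.

End DigitCoding.

Lemma second_countable_seq {T : topologicalType} (x0 : T) : @second_countable T ->
  exists U : nat -> set T, (forall n, open (U n)) /\
    forall x O, nbhs x O -> exists n, U n x /\ U n `<=` O.
Proof.
move=> [B cB [Bo Bb]].
have /pfcard_geP[B0|[f]] := cB.
  by have [V [BV _] _] := Bb x0 _ filterT; move: BV; rewrite B0.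
exists f; split => [n|x O xO]; first by apply: Bo; exact: funS.
have [V [BV Vx] VO] := Bb x _ xO.
by have [n _ fn] := @surj _ _ _ _ f _ BV; exists n; rewrite fn.
Qed.

(** A measurable map with a measurable left inverse: laws on [0, 1] can be transported to [S], and
    conditioning on [S] reduces to distribution functions. *)
Lemma standard_borel_coding {R : realType} {d} {S : measurableType d} (s0 : S) :
  standard_borel R S -> exists (psi : S -> R) (theta : R -> S),
  [/\ measurable_fun setT psi, measurable_fun setT theta,
      forall s, theta (psi s) = s & forall s, 0 <= psi s <= 1].
Proof.
move=> [P [f [hP sP [g fK gK] mS]]].
have [U [oU bU]] := second_countable_seq (f s0) sP.
pose b s n := `[< U n (f s) >].
pose psi s : R := code (b s) 0.
have dpsi s n : digit n (psi s) = b s n by exact: digit_code.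
have cpsi s : codes U (digit ^~ (psi s)) (f s).
  by move=> n; rewrite /= dpsi; split => /asboolP.
have mf (B : set P) : <<s [set O : set P | open O] >> B -> measurable (f @^-1` B).
  by move=> mB; apply/mS; exists B.
pose theta (r : R) := if pselect (exists x, codes U (digit ^~ r) x) is left e then g (projT1 (cid e)) else s0.
have thetaE r x : codes U (digit ^~ r) x -> theta r = g x.
  move=> cx; rewrite /theta; case: pselect => [e|[]]; last by exists x.
  by congr g; case: cid => y cy /=; exact: (codes_uniq hP bU cy cx).
exists psi, theta; split.
- apply: measurable_code => n.
  rewrite (_ : [set s | _] = f @^-1` (U n)); first by apply: mf; apply: sub_sigma_algebra; exact: oU.
  by apply/seteqP; split => s; rewrite /b /= => /asboolP.
- move=> _ A mA; rewrite setTI; have [B mB AE] := (mS A).1 mA.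
  pose W := [set r : R | coherent U (digit ^~ r)].
  rewrite (_ : theta @^-1` A = [set r : R | exists x, codes U (digit ^~ r) x /\ B x] `|`
      (if `[< A s0 >] then ~` W else set0)).
    apply: measurableU; first exact: measurable_coded.
    by case: asboolP => // _; apply: measurableC; exact: measurable_coherent.
  apply/seteqP; split => r /=.
    have [[x cx]|nx] := pselect (exists x, codes U (digit ^~ r) x).
      by rewrite (thetaE _ _ cx) AE /= gK => Bx; left; exists x.
    rewrite /theta; case: pselect => // _ As0; right; rewrite asboolT//= => cr.
    exact: nx (coherent_codes oU cr).
  move=> [[x [cx Bx]]|]; first by rewrite (thetaE _ _ cx) AE /= gK.
  case: asboolP => //= As0 nW; rewrite /theta; case: pselect => // -[x cx].
  by case: nW; exact: (codes_coherent oU bU cx).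
- by move=> s; rewrite (thetaE _ _ (cpsi s)).
- by move=> s; rewrite code_ge0 code_le1.
Qed.

Lemma probability_inhabited {R : realType} {d} {X : measurableType d}
    (P : probability X R) : exists x : X, True.
Proof.
apply: contrapT => nX; have := probability_setT P.
rewrite (_ : setT = set0) ?measure0; first by move/eqP; rewrite eq_sym onee_eq0.
by apply/seteqP; split => x // _; apply: nX; exists x.
Qed.

(** * Conditional probabilities and quantile functions *)

Section ConditionalProbability.
Context {R : realType} {d d' : measure_display}.
Context {S : measurableType d} {S' : measurableType d'}.
Variables (alpha : probability S R) (T : {mfun S >-> S'}).

Let mT B : measurable B -> measurable (T @^-1` B).
Proof. by move=> mB; rewrite -[X in measurable X]setTI; exact: (@measurable_funPT _ _ _ _ T). Qed.

Definition restricted_image (U : set S) of measurable U : set S' -> \bar R :=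
  fun B => alpha (T @^-1` B `&` U).

Section Measure.
Variables (U : set S) (mU : measurable U).

Let restricted_image0 : restricted_image mU set0 = 0%E.
Proof. by rewrite /restricted_image preimage_set0 set0I measure0. Qed.

Let restricted_image_ge0 B : (0 <= restricted_image mU B)%E.
Proof. exact: measure_ge0. Qed.

Let restricted_image_sigma_additive : semi_sigma_additive (restricted_image mU).
Proof.
move=> F mF tF mUF; rewrite /restricted_image preimage_bigcup setI_bigcupl.
have mTF n : measurable (T @^-1` F n `&` U) by apply: measurableI => //; exact: mT.
apply: measure_semi_sigma_additive => //; last exact: bigcupT_measurable.
apply/trivIsetP => i j _ _ ij; rewrite setIACA -preimage_setI.
by move/trivIsetP : tF => /(_ _ _ I I ij) ->; rewrite preimage_set0 set0I.
Qed.

HB.instance Definition _ := isMeasure.Build _ _ _ (restricted_image mU)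
  restricted_image0 restricted_image_ge0 restricted_image_sigma_additive.

Let restricted_image_fin : fin_num_fun (restricted_image mU).
Proof. by move=> B mB; apply: fin_num_measure; apply: measurableI => //; exact: mT. Qed.

HB.instance Definition _ := @Measure_isFinite.Build _ _ _ (restricted_image mU)
  restricted_image_fin.

End Measure.

Let alpha' : probability S' R := distribution alpha T.

(** Testing with the set where F > F' gives a nonnegative function with integral at most 0, so that
    set is null. *)
Lemma ae_le_mean (F F' : S' -> R) : bmeas F -> bmeas F' ->
  (forall B, measurable B ->
    \int[alpha']_s (\1_B s * F s) <= \int[alpha']_s (\1_B s * F' s)) ->
  exists N, [/\ measurable N, alpha' N = 1%E & forall s, N s -> F s <= F' s].
Proof.
move=> bF bF' FF'; pose N := [set s | F s <= F' s].
have mN : measurable N.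
  rewrite (_ : N = (fun s => F s - F' s) @^-1` `]-oo, 0]).
    by rewrite -[X in measurable X]setTI; apply: (bmeasB bF bF').1.
  by apply/seteqP; split => s; rewrite /N/= in_itv/= subr_le0.
exists N; split => //.
pose h s : R := \1_(~` N) s * (F s - F' s).
have bC : bmeas (\1_(~` N) : S' -> R) by apply: bmeas_indic; exact: measurableC.
have bh : bmeas h by apply: bmeasM => //; exact: bmeasB.
have h0 s : 0 <= h s.
  rewrite /h indicE in_setC; case: (boolP (s \in N)) => [_|/negP sN]; first by rewrite mul0r.
  rewrite mul1r subr_ge0 leNgt; apply/negP => /ltW lt.
  by apply: sN; rewrite inE.
have ih : (\int[alpha']_s `|(h s)%:E|)%E = 0%E.
  transitivity (\int[alpha']_s h s)%:E.
    by rewrite EFin_mean//; apply: eq_integral => s _; rewrite gee0_abs ?lee_fin.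
  congr _%:E; apply/eqP; rewrite eq_le; apply/andP; split; last first.
    by rewrite -(mean_cst alpha' 0); apply: le_mean => //; exact: bmeas_cst.
  have := FF' _ (measurableC mN); rewrite -subr_le0 -meanB; [|exact: bmeasM|exact: bmeasM].
  rewrite (_ : (fun s => _) = h)//; apply/funext => s; rewrite /h; lra.
have mh : measurable_fun setT (EFin \o h) by apply/measurable_EFinP; exact: bh.1.
have /(ae_eq_integral_abs alpha' measurableT mh)[Z [mZ Z0 ZN]] := ih.
have NZ : ~` N `<=` Z.
  move=> s sN; apply: ZN => /= /(_ I) -[] hs0.
  have {}hs0 : h s = 0 by [].
  apply: sN; rewrite /N/=; move: hs0; rewrite /h indicE in_setC.
  by case: (boolP (s \in N)) => [/set_mem//|_]; rewrite mul1r => /eqP; rewrite subr_eq0 => /eqP ->.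
rewrite -[N]setCK (probability_setC alpha' (measurableC mN)).
suff -> : alpha' (~` N) = 0%E by rewrite sube0.
apply/eqP; rewrite -measure_le0 -Z0; apply: le_measure; rewrite ?inE//.
exact: measurableC.
Qed.

Lemma cond_prob_exists (U : set S) : measurable U ->
  exists F : S' -> R, [/\ bmeas F, forall s, 0 <= F s <= 1 & forall B, measurable B ->
    alpha (T @^-1` B `&` U) = (\int[alpha']_s (\1_B s * F s))%:E].
Proof.
move=> mU.
have dom : restricted_image mU `<< alpha'.
  apply/null_content_dominatesP => B mB B0.
  apply/eqP; rewrite -measure_le0 -B0; apply: le_measure; rewrite ?inE//; last exact: mT.
  by apply: measurableI => //; exact: mT.
have [f [f0 ffin fint fE]] := radon_nikodym_sigma_finite dom.
have mf := measurable_int _ fint.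
(* The Radon-Nikodym derivative is at most 1 only almost everywhere. Capping it gives the bound
   everywhere, and the set [Z] below, where the cap acts, is null. *)
pose F s := Num.min 1 (fine (f s)).
have fF s : f s = (fine (f s))%:E by rewrite fineK.
have mff : measurable_fun setT (fun s => fine (f s)).
  by apply/measurable_EFinP; rewrite (_ : EFin \o _ = f)//; apply/funext => s /=; rewrite fineK.
have F01 s : 0 <= F s <= 1.
  by rewrite /F le_min ler01 ge_min lexx/= andbT -lee_fin -fF f0.
have bF : bmeas F.
  split; first by apply: measurable_minr.
  by exists 1 => s; have /andP[? ?] := F01 s; rewrite ger0_norm.
exists F; split => // B mB.
pose Z := [set s | (1 < f s)%E].
have mZ : measurable Z by rewrite -[Z]setTI; apply: emeasurable_fun_o_infty.
have Z0 : alpha' Z = 0%E.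
  have fZ : alpha'.-integrable Z f by apply: (integrableS measurableT mZ _ fint).
  have cZ : alpha'.-integrable Z (cst 1%E).
    exact: (finite_measure_integrable_cst alpha' 1 mZ).
  have iZ : (\int[alpha']_(s in Z) `|(f \- cst 1) s|)%E = 0%E.
    transitivity (\int[alpha']_(s in Z) (f s - 1))%E.
      by apply: eq_integral => s /set_mem sZ; rewrite gee0_abs// sube_ge0//= ltW.
    rewrite integralB// integral_cst// mul1e; apply/eqP; rewrite eq_le; apply/andP; split.
      rewrite -(fE _ mZ) sube_le0; apply: le_measure; rewrite ?inE//; last exact: mT.
      by apply: measurableI => //; exact: mT.
    rewrite sube_ge0 ?fin_num_measure//.
    rewrite -[leLHS]mul1e -(integral_cst alpha' mZ); apply: ge0_le_integral => //.
      by apply: measurable_funTS.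
    by move=> s Zs; exact: ltW.
  have [N [mN N0 ZN]] : ae_eq alpha' Z (f \- cst 1)%E (cst 0%E).
    by apply/ae_eq_integral_abs => //; apply: emeasurable_funB => //; exact: measurable_funTS.
  apply/eqP; rewrite -measure_le0 -N0; apply: le_measure; rewrite ?inE// => s Zs.
  apply: ZN => /= /(_ Zs); move: Zs; rewrite /Z/= fF lte_fin -EFinB => f1 [] f10.
  by move: f1; rewrite -subr_gt0 f10 ltxx.
have fae : ae_eq alpha' B f (EFin \o F).
  exists Z; split => // s /= /not_implyP[Bs fF']; rewrite /Z/= ltNge; apply/negP => f1; apply: fF'.
  by rewrite fF /F; congr _%:E; apply/esym/min_idPr; rewrite -lee_fin -fF.
have mFE : measurable_fun setT (EFin \o F) by apply/measurable_EFinP; exact: bF.1.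
have -> : alpha (T @^-1` B `&` U) = (\int[alpha']_(s in B) f s)%E := fE _ mB.
rewrite (@ae_eq_integral _ _ _ alpha' B (EFin \o F) f) //; [|exact: measurable_funTS..].
rewrite EFin_mean; last by apply: bmeasM => //; exact: bmeas_indic.
rewrite integral_mkcond; apply: eq_integral => s _.
by rewrite epatch_indic/= EFinM muleC.
Qed.

End ConditionalProbability.

Lemma probability_bigcap {R : realType} {d} {X : measurableType d} (P : probability X R)
    (N : nat -> set X) : (forall n, measurable (N n)) -> (forall n, P (N n) = 1%E) ->
  P (\bigcap_n N n) = 1%E.
Proof.
move=> mN PN; have mC n : measurable (~` N n) by exact: measurableC.
have mU : measurable (\bigcup_n ~` N n) by exact: bigcupT_measurable.
rewrite -[\bigcap_n N n]setCK setC_bigcap (probability_setC P mU).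
suff -> : P (\bigcup_n ~` N n) = 0%E by rewrite sube0.
apply/(negligibleP P mU)/negligible_bigcup => n; apply/(negligibleP P (mC n)).
by have := probability_setC P (mN n); rewrite PN subee.
Qed.

Section Quantile.
Context {R : realType} {d d' : measure_display}.
Context {S : measurableType d} {S' : measurableType d'}.
Variables (alpha : probability S R) (T : {mfun S >-> S'}).
Variables (psi : S -> R) (theta : R -> S).
Hypotheses (mpsi : measurable_fun setT psi) (mtheta : measurable_fun setT theta).
Hypotheses (psiK : forall s, theta (psi s) = s) (psi01 : forall s, 0 <= psi s <= 1).

Let alpha' : probability S' R := distribution alpha T.

Let lam : probability (measurableTypeR R) R := uniform_prob (@ltr01 R).

Let mean_ray (c : R) : 0 <= c <= 1 -> \int[lam]_u \1_(`]-oo, c[) u = c.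
Proof.
move=> /andP[c0 c1]; apply: EFin_inj; rewrite mean_indic//.
have := integral_uniform (@ltr01 R) (f := EFin \o \1_(`]-oo, c[)).
rewrite integral_indic// setIT => ->.
- rewrite subr0 invr1 mul1e integral_indic//.
  rewrite (_ : _ `&` _ = `[0, c[%classic).
    by apply: (etrans (lebesgue_measure_itv _)); rewrite /= lte_fin; case: ltP => [_|c0']; [rewrite sube0|congr _%:E; lra].
  apply/seteqP; split => u /=; rewrite !in_itv/=; first by move=> [uc /andP[-> _]].
  by move=> /andP[-> uc]; split => //; exact: ltW (lt_le_trans uc c1).
- by apply/measurable_EFinP; exact: measurable_indic.
- by move=> u; rewrite lee_fin.
Qed.

Let rr (n : nat) : R := ratr (odflt 0 (choice.unpickle n : option rat)).

Let rr_dense x y : x < y -> exists n, x < rr n < y.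
Proof.
move=> /rat_in_itvoo[q]; rewrite in_itv/= => qxy.
by exists (choice.pickle q); rewrite /rr choice.pickleK.
Qed.

Let mpsi_ray (c : R) : measurable (psi @^-1` `]-oo, c]).
Proof. by rewrite -[X in measurable X]setTI; exact: mpsi. Qed.

Let mT B : measurable B -> measurable (T @^-1` B).
Proof. by move=> mB; rewrite -[X in measurable X]setTI; exact: (@measurable_funPT _ _ _ _ T). Qed.

Variable F : nat -> S' -> R.
Hypotheses (bF : forall n, bmeas (F n)) (F01 : forall n s, 0 <= F n s <= 1).
Hypothesis FE : forall n B, measurable B ->
  alpha (T @^-1` B `&` psi @^-1` `]-oo, rr n]) = (\int[alpha']_s (\1_B s * F n s))%:E.

(* [F n s'] is the conditional distribution function of psi given T = s', at the rational
   [rr n]; [X (s', .)] below is its quantile function, and [q s'] the law of theta (X (s', u))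
   for u uniform in [0, 1].  The level 1 keeps the infimum away from the empty set. *)
Let levels (z : S' * R) : set R :=
  [set r | exists n, [/\ 0 <= rr n, r = rr n & z.2 < F n z.1]] `|` [set 1].

Let X (z : S' * R) : R := inf (levels z).

Let levels_lb z : has_lbound (levels z).
Proof. by exists 0 => r [[n [r0 -> _]]|->]. Qed.

Let levels_neq0 z : levels z !=set0. Proof. by exists 1; right. Qed.

Let X_ge0 z : 0 <= X z.
Proof. by apply: lb_le_inf => // r [[n [r0 -> _]]|->]. Qed.

Let X_le1 z : X z <= 1. Proof. by apply: ge_inf => //; right. Qed.

(** An infimum lies strictly below x exactly when some level does, and for x <= 1 this cannot be the
    artificial level 1. *)
Let X_lt x z : x <= 1 -> X z < x <-> exists n, [/\ 0 <= rr n, rr n < x & z.2 < F n z.1].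
Proof.
move=> x1; split => [/inf_lt[//|r [[n [r0 -> zF]]|->]]|[n [r0 rx zF]]].
- by exists n.
- by rewrite ltNge x1.
- by apply: le_lt_trans rx; apply: ge_inf => //; left; exists n.
Qed.

Let mX : measurable_fun setT X.
Proof.
apply: (measurability _ (RGenInftyO.measurableE R)) => _ [_ [x ->] <-]; rewrite setTI.
have [x1|x1] := leP x 1; last first.
  rewrite (_ : _ @^-1` _ = setT)//; apply/seteqP; split => // z _ /=.
  by rewrite in_itv/=; exact: le_lt_trans x1.
rewrite (_ : _ @^-1` _ = \bigcup_n (if (0 <= rr n) && (rr n < x)
    then (fun z : S' * R => z.2 - F n z.1) @^-1` `]-oo, 0[ else set0)); last first.
  apply/seteqP; split => z /=; rewrite in_itv/=.
    by move=> /(X_lt _ x1)[n [r0 rx zF]]; exists n => //; rewrite r0 rx/= in_itv/= subr_lt0.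
  move=> [n _]; case: ifP => // /andP[r0 rx] /=; rewrite in_itv/= subr_lt0 => zF.
  by apply/X_lt => //; exists n.
apply: bigcupT_measurable => n; case: ifP => // _.
have mB : measurable_fun setT (fun z : S' * R => z.2 - F n z.1).
  apply: measurable_funB; first exact: measurable_snd.
  exact: (measurableT_comp (bF n).1 measurable_fst).
by rewrite -[Y in measurable Y]setTI; exact: mB.
Qed.

Let pX (s : S') (A : set R) : R := \int[lam]_u \1_A (X (s, u)).

Let mX1 s : measurable_fun setT (fun u => X (s, u)).
Proof. by apply: (measurableT_comp mX); exact: measurable_fun_pair. Qed.

Let bmeas_pX A : measurable A -> bmeas (pX ^~ A).
Proof.
move=> mA; apply: (bmeas_mean lam (f := fun z : S' * R => \1_A (X z))).
by apply: (bmeas_comp (h := X)) => //; exact: bmeas_indic.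
Qed.

Let bpX s A : measurable A -> bmeas (fun u => \1_A (X (s, u)) : R).
Proof. by move=> mA; apply: (bmeas_comp (h := fun u => X (s, u))) => //; exact: bmeas_indic. Qed.

(** Each inequality between two rational levels holds off a null set, and the pairs of levels are
    countable. *)
Let F_mono : exists N, [/\ measurable N, alpha' N = 1%E &
  forall s, N s -> forall n m, rr n <= rr m -> F n s <= F m s].
Proof.
have /choice[N NE] : forall k : nat, exists N, [/\ measurable N, alpha' N = 1%E &
    forall s, N s -> forall n m, choice.unpickle k = Some (n, m) -> rr n <= rr m -> F n s <= F m s].
  move=> k; case E : (choice.unpickle k : option (nat * nat)) => [[n m]|]; last first.
    by exists setT; split => //; exact: probability_setT.
  have [nm|nm] := leP (rr n) (rr m); last first.
    exists setT; split => //; first exact: probability_setT.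
    by move=> s _ _ _ [<- <-]; rewrite leNgt nm.
  have [B mB|N [mN N1 NF]] := @ae_le_mean _ _ _ _ _ alpha T _ _ (bF n) (bF m).
    rewrite -lee_fin -!FE//; apply: le_measure; rewrite ?inE; try by apply: measurableI => //; exact: mT.
    by apply: setIS => s /=; rewrite !in_itv/= => /le_trans; exact.
  by exists N; split => // s Ns _ _ [<- <-] _; exact: NF.
exists (\bigcap_k N k); split.
- by apply: bigcapT_measurable => k; have [] := NE k.
- by apply: probability_bigcap => k; have [] := NE k.
- move=> s Ns n m nm; have [_ _ h] := NE (choice.pickle (n, m)).
  by apply: h nm; [exact: Ns|rewrite choice.pickleK].
Qed.

(** For almost every [s], the event X < x is the increasing union of the events u < F_n(s) along
    rationals increasing to x, so its probability is the limit of these F_n(s). *)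
Let pX_ray x : 0 < x <= 1 -> exists n : nat -> nat, exists N,
  [/\ forall k, 0 <= rr (n k), forall k, rr (n k) < x,
      forall k l, (k <= l)%N -> rr (n k) <= rr (n l) &
      forall y, y < x -> exists K, forall k, (K <= k)%N -> y <= rr (n k)] /\
  [/\ measurable N, alpha' N = 1%E &
      forall s, N s -> F (n k) s @[k --> \oo] --> pX s `]-oo, x[].
Proof.
move=> /andP[x0 x1]; have [N [mN N1 NF]] := F_mono.
(* These points increase from 0 to x. One rational is picked in each gap, which makes the rationals
   nonnegative, increasing and convergent to x. *)
pose a (k : nat) : R := x - x * k.+1%:R^-1.
have ai k l : (k <= l)%N -> a k <= a l.
  by move=> kl; rewrite lerD2l lerN2 ler_wpM2l ?(ltW x0)// lef_pV2 ?posrE// ler_nat ltnS.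
have aS k : a k < a k.+1.
  by rewrite ltrD2l ltrN2 ltr_pM2l// ltf_pV2 ?posrE// ltr_nat.
have ax k : a k < x by rewrite ltrBlDr ltrDl mulr_gt0 ?invr_gt0.
have a0 k : 0 <= a k by have := ai 0%N k isT; rewrite {1}/a invr1 mulr1 subrr.
have /choice[n nE] : forall k, exists n, a k < rr n < a k.+1 by move=> k; exact: rr_dense.
have n0 k : 0 <= rr (n k) by have /andP[/ltW h _] := nE k; exact: le_trans h.
have nx k : rr (n k) < x by have /andP[_ h] := nE k; exact: lt_trans h _.
have ni k l : (k <= l)%N -> rr (n k) <= rr (n l).
  rewrite leq_eqVlt => /orP[/eqP -> //|kl].
  have /andP[_ /ltW h] := nE k; have /andP[/ltW h' _] := nE l.
  exact: le_trans h (le_trans (ai _ _ kl) h').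
have ny y : y < x -> exists K, forall k, (K <= k)%N -> y <= rr (n k).
  move=> yx; have xy : 0 < x - y by rewrite subr_gt0.
  exists (Num.trunc (x / (x - y))) => k Kk; have /andP[/ltW h _] := nE k.
  apply: le_trans h; rewrite /a lerBrDr addrC -lerBrDr ler_pdivrMr// mulrC -ler_pdivrMr// ltW//.
  by apply: lt_le_trans (truncnS_gt _) _; rewrite ler_nat ltnS.
exists n, N; split; split => // s Ns.
rewrite (_ : (fun k => F (n k) s) = fun k => \int[lam]_u \1_(`]-oo, F (n k) s[) u); last first.
  by apply/funext => k; rewrite mean_ray.
apply: (@mean_dct _ _ _ lam (fun k u => \1_(`]-oo, F (n k) s[) u) _ 1).
- by move=> k; exact: bmeas_indic.
- exact: bpX.
- by move=> k u; rewrite indicE; case: (_ \in _); rewrite ?normr1 ?normr0.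
move=> u; have [Xx|Xx] := ltP (X (s, u)) x.
  have /(X_lt _ x1)[m [m0 mx um]] := Xx; have [K Kn] := ny _ mx.
  apply: cvg_near_cst; exists K => // k /= Kk.
  rewrite !indicE !mem_set//= in_itv//=.
  by apply: lt_le_trans um _; apply: NF => //; exact: Kn.
apply: cvg_near_cst; apply: nearW => k.
rewrite !indicE !memNset//= in_itv/= ?ltNge ?Xx//.
apply/negP; rewrite negbK leNgt; apply/negP => uF.
by move: Xx; rewrite leNgt => /negP; apply; apply/X_lt => //; exists (n k).
Qed.

(** An open ray is the increasing union of closed rays at rational endpoints, where the law is known
    by hypothesis. Outside 0 < x <= 1 both sides are trivial because [psi] and [X] take values in
    [0, 1]. *)
Let ray_law B x : measurable B -> alpha (T @^-1` B `&` psi @^-1` `]-oo, x[) =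
  (\int[alpha']_s (\1_B s * pX s `]-oo, x[))%:E.
Proof.
move=> mB; have [x0|x0] := leP x 0.
  rewrite (_ : _ `&` _ = set0); last first.
    apply/seteqP; split => s //= [_]; rewrite in_itv/= => /lt_le_trans/(_ x0).
    by rewrite ltNge; have /andP[->] := psi01 s.
  rewrite measure0 (_ : (fun s => _) = fun=> 0) ?mean_cst//; apply/funext => s.
  rewrite /pX (_ : (fun u => _) = fun=> 0) ?mean_cst ?mulr0//; apply/funext => u.
  by rewrite indicE memNset//= in_itv/=; apply/negP; rewrite -leNgt (le_trans x0).
have [x1|x1] := leP x 1; last first.
  rewrite (_ : psi @^-1` _ = setT) ?setIT; last first.
    apply/seteqP; split => s //= _; rewrite in_itv/=; apply: le_lt_trans x1.
    by have /andP[] := psi01 s.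
  rewrite -[LHS](mean_indic alpha' mB); congr _%:E; apply: eq_Rintegral => s _.
  rewrite /pX (_ : (fun u => _) = fun=> 1) ?mean_cst ?mulr1//; apply/funext => u.
  by rewrite indicE mem_set//= in_itv/=; exact: le_lt_trans x1.
have x01 : 0 < x <= 1 by rewrite x0.
have [n [N [[n0 nx ni ny] [mN N1 NF]]]] := pX_ray x01.
have mTB := mT mB; have b1 := @bmeas_indic R _ _ _ mB; have bN := @bmeas_indic R _ _ _ mN.
have bp : bmeas (pX ^~ `]-oo, x[%classic) by exact: bmeas_pX.
have L1 : (\int[alpha']_s (\1_B s * F (n k) s))%:E @[k --> \oo] -->
    alpha (T @^-1` B `&` psi @^-1` `]-oo, x[).
  rewrite (_ : T @^-1` B `&` _ = \bigcup_k (T @^-1` B `&` psi @^-1` `]-oo, rr (n k)])).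
    rewrite (_ : (fun k => _) = alpha \o (fun k => T @^-1` B `&` psi @^-1` `]-oo, rr (n k)])).
      apply: nondecreasing_cvg_mu => [k||].
      - by apply: measurableI.
      - by apply: bigcupT_measurable => k; apply: measurableI.
      - move=> k l kl; rewrite subsetEset; apply: setIS => s /=; rewrite !in_itv/= => h.
        exact: le_trans h (ni _ _ kl).
    by apply/funext => k /=; rewrite FE.
  apply/seteqP; split => s /=.
    rewrite in_itv/= => -[Bs /ny[K]] /(_ K (leqnn K)) h.
    by exists K => //; split => //=; rewrite in_itv.
  move=> [k _ [Bs /=]]; rewrite !in_itv/= => h; split => //.
  exact: le_lt_trans h (nx k).
have L2 : \int[alpha']_s (\1_B s * F (n k) s * \1_N s) @[k --> \oo] -->
    \int[alpha']_s (\1_B s * pX s `]-oo, x[ * \1_N s).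
  apply: (@mean_dct _ _ _ alpha' (fun k s => \1_B s * F (n k) s * \1_N s) _ 1).
  - by move=> k; do 2 apply: bmeasM => //.
  - by do 2 apply: bmeasM => //.
  - move=> k s; have /andP[F0 F1] := F01 (n k) s; rewrite !indicE.
    by case: (s \in B); case: (s \in N);
      rewrite ?mul1r ?mul0r ?mulr1 ?mulr0 ?normr0 ?ler01// ger0_norm.
  - move=> s; rewrite !indicE; have [sN|sN] := boolP (s \in N); last first.
      rewrite mulr0 (_ : (fun k => _) = fun=> 0); first exact: cvg_cst.
      by apply/funext => k; rewrite mulr0.
    rewrite mulr1 (_ : (fun k => _) = fun k => (s \in B)%:R * F (n k) s).
      by apply: cvgMr; apply: NF; exact/set_mem.
    by apply/funext => k; rewrite mulr1.
rewrite (mean_restrict mN N1 (bmeasM b1 bp)).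
have L2' : (\int[alpha']_s (\1_B s * F (n k) s))%:E @[k --> \oo] -->
    (\int[alpha']_s (\1_B s * pX s `]-oo, x[ * \1_N s))%:E.
  rewrite (_ : (fun k => _) = EFin \o fun k => \int[alpha']_s (\1_B s * F (n k) s * \1_N s)).
    by apply: cvg_EFin; [exact: nearW|exact: L2].
  by apply/funext => k /=; rewrite -mean_restrict//; exact: bmeasM.
by rewrite -(cvg_lim _ L1)// -(cvg_lim _ L2').
Qed.

(** Open rays are stable under intersection and generate the Borel sets, so Dynkin's theorem
    applies. Disjoint unions pass through by dominated convergence, in [u] and then in [s]. *)
Let joint_law B A : measurable B -> measurable A -> alpha (T @^-1` B `&` psi @^-1` A) =
  (\int[alpha']_s (\1_B s * pX s A))%:E.
Proof.
move=> mB; have mTB := mT mB; have b1 := @bmeas_indic R _ _ _ mB.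
have mpA C : measurable C -> measurable (psi @^-1` C).
  by move=> mC; rewrite -[Y in measurable Y]setTI; exact: mpsi.
have full : alpha (T @^-1` B) = (\int[alpha']_s \1_B s)%:E by rewrite mean_indic.
pose Q (A : set R) := alpha (T @^-1` B `&` psi @^-1` A) = (\int[alpha']_s (\1_B s * pX s A))%:E.
move=> mA; have {mA} : <<s @RGenInftyO.G R >> A.
  by have E := RGenInftyO.measurableE R; have : (@RGenInftyO.G R).-sigma.-measurable A by rewrite -E.
move: A; apply: (@dynkin_induction _ R _ Q (RGenInftyO.measurableE R)).
- move=> _ _ [x ->] [y ->]; exists (Num.min x y).
  by apply/seteqP; split => u /=; rewrite !in_itv/= lt_min; [move=> [-> ->]|move=> /andP].
- rewrite /Q preimage_setT setIT full; congr _%:E; apply: eq_Rintegral => s _.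
  rewrite /pX (_ : (fun u => _) = fun=> 1) ?mean_cst ?mulr1//.
  by apply/funext => u; rewrite indicT.
- by move=> _ [x ->]; exact: ray_law.
- move=> C mC QC; rewrite /Q preimage_setC -setDE.
  have -> : alpha (T @^-1` B `\` psi @^-1` C) =
      (alpha (T @^-1` B) - alpha (T @^-1` B `&` psi @^-1` C))%E.
    by apply: measureD => //; [exact: mpA|rewrite -ge0_fin_numE// fin_num_measure].
  rewrite full QC -EFinB; congr _%:E.
  have bC := bmeas_pX mC.
  rewrite -meanB//; last exact: bmeasM.
  apply: eq_Rintegral => s _; rewrite -[X in X - _]mulr1 -mulrBr; congr (_ * _).
  rewrite -(mean_cst lam 1) -meanB; [|exact: bmeas_cst|exact: bpX].
  apply: eq_Rintegral => u _; rewrite /= !indicE in_setC.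
  by case: (_ \in _); rewrite ?subrr ?subr0.
move=> E mE tE QE; rewrite /Q preimage_bigcup setI_bigcupr.
have bE k := bmeas_pX (mE k).
have mEU : measurable (\bigcup_k E k) by exact: bigcupT_measurable.
have bEU := bmeas_pX mEU.
have L1 : (\sum_(0 <= k < n) alpha (T @^-1` B `&` psi @^-1` E k))%E @[n --> \oo] -->
    alpha (\bigcup_k (T @^-1` B `&` psi @^-1` E k)).
  apply: measure_semi_sigma_additive => //.
  - by move=> k; apply: measurableI; [exact: mTB|exact: mpA].
  - apply/trivIsetP => i j _ _ ij; rewrite setIACA setIid -preimage_setI.
    by move/trivIsetP : tE => /(_ _ _ I I ij) ->; rewrite preimage_set0 setI0.
  - by apply: bigcupT_measurable => k; apply: measurableI; [exact: mTB|exact: mpA].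
have sumE s n : \sum_(0 <= k < n) pX s (E k) = pX s (\big[setU/set0]_(k < n) E k).
  elim: n => [|n IH].
    rewrite big_geq// big_ord0 /pX (_ : (fun u => _) = fun=> 0) ?mean_cst//.
    by apply/funext => u; rewrite indic0.
  rewrite big_nat_recr//= IH big_ord_recr/= /pX.
  have mU : measurable (\big[setU/set0]_(k < n) E k) by exact: bigsetU_measurable.
  rewrite -meanD; [|exact: bpX|exact: bpX].
  apply: eq_Rintegral => u _; rewrite !indicE in_setU.
  have dj : ~ ((X (s, u) \in \big[setU/set0]_(k < n) E k) /\ X (s, u) \in E n).
    rewrite !inE => -[]; rewrite -bigcup_mkord => -[k /= kn Ek] En.
    move/trivIsetP : tE => /(_ k n I I); rewrite neq_ltn kn => /(_ isT) /seteqP[h _].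
    by apply: (h (X (s, u))); split.
  move: dj; case: (X (s, u) \in _); case: (X (s, u) \in _) => h /=; rewrite ?addr0 ?add0r//.
  by case: h.
have mu n : measurable (\big[setU/set0]_(k < n) E k) by exact: bigsetU_measurable.
have bu n := bmeas_pX (mu n).
have pX01 s A' : measurable A' -> `|pX s A'| <= 1.
  move=> mA'; apply: norm_mean; first exact: bpX.
  by move=> u; rewrite indicE; case: (_ \in _); rewrite ?normr1 ?normr0.
have L2 : \int[alpha']_s (\1_B s * pX s (\big[setU/set0]_(k < n) E k)) @[n --> \oo] -->
    \int[alpha']_s (\1_B s * pX s (\bigcup_k E k)).
  apply: (@mean_dct _ _ _ alpha' (fun n s => \1_B s * pX s (\big[setU/set0]_(k < n) E k)) _ 1).
  - by move=> n; exact: bmeasM.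
  - exact: bmeasM.
  - move=> n s; rewrite normrM -[leRHS]mulr1; apply: ler_pM => //; last exact: pX01.
    by rewrite indicE; case: (_ \in _); rewrite ?normr1 ?normr0.
  - move=> s; apply: cvgMr.
    apply: (@mean_dct _ _ _ lam (fun n u => \1_(\big[setU/set0]_(k < n) E k) (X (s, u))) _ 1).
    + by move=> n; exact: bpX.
    + exact: bpX.
    + by move=> n u; rewrite indicE; case: (_ \in _); rewrite ?normr1 ?normr0.
    + move=> u; have [[K _ EK]|nE] := pselect ((\bigcup_k E k) (X (s, u))).
        apply: cvg_near_cst; exists K.+1 => // n /= Kn.
        rewrite !indicE !mem_set//; first by exists K.
        by rewrite -bigcup_mkord; exists K.
      apply: cvg_near_cst; apply: nearW => n; rewrite !indicE !memNset//.
      by rewrite -bigcup_mkord => -[k _ Ek]; apply: nE; exists k.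
have L2' : (\sum_(0 <= k < n) alpha (T @^-1` B `&` psi @^-1` E k))%E @[n --> \oo] -->
    (\int[alpha']_s (\1_B s * pX s (\bigcup_k E k)))%:E.
  rewrite (_ : (fun n => _) = EFin \o
      fun n => \int[alpha']_s (\1_B s * pX s (\big[setU/set0]_(k < n) E k))).
    by apply: cvg_EFin; [exact: nearW|exact: L2].
  apply/funext => n /=; elim: n => [|n IH].
    rewrite big_geq//; congr _%:E; rewrite (_ : (fun s => _) = fun=> 0) ?mean_cst//.
    by apply/funext => s; rewrite -sumE big_geq// mulr0.
  have -> : \int[alpha']_s (\1_B s * pX s (\big[setU/set0]_(k < n.+1) E k)) =
      \int[alpha']_s (\1_B s * pX s (\big[setU/set0]_(k < n) E k)) +
      \int[alpha']_s (\1_B s * pX s (E n)).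
    rewrite -meanD; [|exact: (bmeasM b1 (bu n))|exact: (bmeasM b1 (bE n))].
    by apply: eq_Rintegral => s _; rewrite -!sumE big_nat_recr//= mulrDr.
  by rewrite EFinD big_nat_recr//=; congr (_ + _)%E; [exact: IH|exact: (QE n)].
by rewrite -(cvg_lim _ L1)// -(cvg_lim _ L2').
Qed.

(** A regular conditional probability given [T], pulled back from the real line through [theta]. *)
Lemma quantile_kernel : exists q : S' -> probability S R,
  (forall U, measurable U -> bmeas (fun s => fine (q s U))) /\
  forall B U, measurable B -> measurable U ->
    alpha (T @^-1` B `&` U) = (\int[alpha']_s (\1_B s * fine (q s U)))%:E.
Proof.
have mY s : measurable_fun setT (fun u : measurableTypeR R => theta (X (s, u))).
  exact: (measurableT_comp mtheta (mX1 s)).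
pose Y s : {mfun measurableTypeR R >-> S} := HB.pack (fun u => theta (X (s, u)))
  (isMeasurableFun.Build _ _ _ _ _ (mY s)).
have mtU U : measurable U -> measurable (theta @^-1` U).
  by move=> mU; rewrite -[Z in measurable Z]setTI; exact: mtheta.
have qE s U : measurable U -> fine (distribution lam (Y s) U) = pX s (theta @^-1` U).
  move=> mU; have mXU := mtU _ mU.
  rewrite /pX (_ : (fun u => _) = \1_((fun u => X (s, u)) @^-1` (theta @^-1` U))); last first.
    by apply/funext => u; rewrite !indicE; congr ((nat_of_bool _)%:R); apply/idP/idP; rewrite !inE.
  rewrite -[RHS]/(fine _%:E) mean_indic// -[Z in measurable Z]setTI.
  exact: mX1.
exists (fun s => distribution lam (Y s)); split => [U mU|B U mB mU].
  rewrite (_ : (fun s => _) = pX ^~ (theta @^-1` U)); first by apply: bmeas_pX; exact: mtU.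
  by apply/funext => s; exact: qE.
have -> : U = psi @^-1` (theta @^-1` U).
  by apply/seteqP; split => s; rewrite /= psiK.
rewrite (joint_law mB (mtU _ mU)).
congr _%:E; apply: eq_Rintegral => s _.
by rewrite qE//; rewrite (_ : psi @^-1` _ = U)//; apply/seteqP; split => z; rewrite /= psiK.
Qed.

End Quantile.

Lemma disintegration_exists {R : realType} {d d'} {S : measurableType d}
    {S' : measurableType d'} (alpha : probability S R) (T : {mfun S >-> S'}) :
  standard_borel R S -> standard_borel R S' ->
  exists (q : S' -> probability S R) (A : S' -> set S),
    disintegration alpha (distribution alpha T) T q /\
    forall s', [/\ measurable (A s'), q s' (A s') = 1%E &
      forall s t, A s' s -> A s' t -> T s = T t].
Proof.
move=> bS bS'; pose alpha' : probability S' R := distribution alpha T.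
have [s0 _] := probability_inhabited alpha.
have [psi [theta [mpsi mtheta psiK psi01]]] := standard_borel_coding s0 bS.
have [psi' [theta' [mpsi' mtheta' psiK' psi01']]] := standard_borel_coding (T s0) bS'.
have mT B : measurable B -> measurable (T @^-1` B).
  by move=> mB; rewrite -[X in measurable X]setTI; exact: (@measurable_funPT _ _ _ _ T).
have mpt (s : S) : measurable [set s].
  rewrite (_ : [set s] = psi @^-1` [set psi s]).
    by rewrite -[X in measurable X]setTI; apply: mpsi => //; exact: measurable_set1.
  by apply/seteqP; split => t /= h; rewrite ?h// -(psiK t) h psiK.
have mpt' (s : S') : measurable [set s].
  rewrite (_ : [set s] = psi' @^-1` [set psi' s]).
    by rewrite -[X in measurable X]setTI; apply: mpsi' => //; exact: measurable_set1.
  by apply/seteqP; split => t /= h; rewrite ?h// -(psiK' t) h psiK'.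
pose rr (n : nat) : R := ratr (odflt 0 (choice.unpickle n : option rat)).
have rr_dense x y : x < y -> exists n, x < rr n < y.
  move=> /rat_in_itvoo[r]; rewrite in_itv/= => rxy.
  by exists (choice.pickle r); rewrite /rr choice.pickleK.
have /choice[F FE] : forall n, exists F : S' -> R, [/\ bmeas F, forall s, 0 <= F s <= 1 &
    forall B, measurable B -> alpha (T @^-1` B `&` psi @^-1` `]-oo, rr n]) =
      (\int[alpha']_s (\1_B s * F s))%:E].
  move=> n; apply: cond_prob_exists.
  by rewrite -[X in measurable X]setTI; exact: mpsi.
have [q [bq qE]] := quantile_kernel mpsi mtheta psiK psi01
  (fun n => let: And3 h _ _ := FE n in h) (fun n => let: And3 _ h _ := FE n in h)
  (fun n => let: And3 _ _ h := FE n in h).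
(* Rational half-lines and their complements, told apart by the parity of m, form a countable family
   separating the points of [S']. *)
pose C (m : nat) : set S' := let: n := m./2 in
  if odd m then psi' @^-1` `]-oo, rr n] else ~` (psi' @^-1` `]-oo, rr n]).
have mC m : measurable (C m).
  have mP : measurable (psi' @^-1` `]-oo, rr m./2]).
    by rewrite -[X in measurable X]setTI; exact: mpsi'.
  by rewrite /C; case: ifP => // _; exact: measurableC.
have bqT B : measurable B -> bmeas (fun s => fine (q s (T @^-1` B))) by move=> mB; exact/bq/mT.
(* For each B, the preimages of B intersected with [C m] and of the complement of [C m] are
   disjoint. Hence for almost every s in [C m] the complement has conditional probability 0. *)
have /choice[N NE] : forall m, exists N, [/\ measurable N, alpha' N = 1%E &
    forall s, N s -> C m s -> q s (T @^-1` C m) = 1%E].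
  move=> m; have mCC := measurableC (mC m).
  have b1 := @bmeas_indic R _ _ _ (mC m).
  have [B mB|N [mN N1 N0]] := @ae_le_mean _ _ _ _ _ alpha T
      (fun s => \1_(C m) s * fine (q s (T @^-1` (~` C m)))) (fun=> 0) (bmeasM b1 (bqT _ mCC))
      (bmeas_cst 0).
    rewrite (_ : (fun s => _ * 0) = fun=> 0) ?mean_cst; last by apply/funext => s; rewrite mulr0.
    rewrite (_ : (fun s => _) = fun s => \1_(B `&` C m) s * fine (q s (T @^-1` (~` C m)))).
      rewrite -lee_fin -qE; [|exact: measurableI|exact: mT].
      rewrite (_ : _ `&` _ = set0) ?measure0//.
      by apply/seteqP; split => s //= [[_ ?]].
    by apply/funext => s; rewrite mulrA indicI.
  exists N; split => // s Ns Cs; have := N0 _ Ns.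
  rewrite indicE mem_set// mul1r preimage_setC (probability_setC (q s) (mT _ (mC m))).
  have fq : q s (T @^-1` C m) \is a fin_num by apply: fin_num_measure; exact: mT.
  rewrite -(fineK fq) -EFinB/= subr_le0 => q1; congr _%:E; apply/eqP.
  by rewrite eq_le q1 -lee_fin fineK// probability_le1//; exact: mT.
pose N0 := \bigcap_m N m.
have mN0 : measurable N0 by apply: bigcapT_measurable => m; have [] := NE m.
have N01 : alpha' N0 = 1%E by apply: probability_bigcap => m; have [] := NE m.
(* The point s is the intersection of the sets [C m] that contain it, so its fiber is a countable
   intersection of sets of conditional probability 1. *)
have fib s : N0 s -> q s (T @^-1` [set s]) = 1%E.
  move=> Ns; pose E m := if `[< C m s >] then C m else setT.
  have mE m : measurable (E m) by rewrite /E; case: ifP.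
  rewrite (_ : [set s] = \bigcap_m E m).
    rewrite preimage_bigcap; apply: probability_bigcap => m; first exact: mT.
    rewrite /E; case: asboolP => Cs; last by rewrite preimage_setT probability_setT.
    by have [_ _ h] := NE m; apply: h => //; exact: Ns.
  apply/seteqP; split => [t -> m _|t tE].
    by rewrite /E; case: asboolP.
  rewrite /= -(psiK' t) -(psiK' s); congr theta'; apply/eqP.
  rewrite eq_le; apply/andP; split; rewrite leNgt; apply/negP => lt.
  - have [n /andP[sr rt]] := rr_dense _ _ lt.
    have := tE n.*2.+1 I; rewrite /E /C /= uphalf_double odd_double /=.
    by rewrite asboolT/= in_itv/= ?(ltW sr)// leNgt rt.
  - have [n /andP[tr rs]] := rr_dense _ _ lt.
    have := tE n.*2 I; rewrite /E /C /= doubleK odd_double /=.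
    rewrite asboolT/= in_itv/=; first by apply; exact: ltW.
    by apply/negP; rewrite -ltNge.
(* Off [N0] a Dirac mass is used. It may miss the fiber of s, but it lies in a single piece, which
   the uniform Dobrushin bounds require at every s. *)
pose q' s : probability S R := if `[< N0 s >] then q s else dirac s0.
pose A s := if `[< N0 s >] then T @^-1` [set s] else [set s0].
exists q', A; split; last first.
  move=> s; rewrite /q' /A; case: asboolP => Ns; split => //.
  - exact: mT.
  - exact: fib.
  - by move=> t u /= -> ->.
  - by rewrite /= /dirac indicE mem_set.
  - by move=> t u /= -> ->.
have q'E U s : measurable U -> q' s U = (\1_N0 s * fine (q s U) + \1_(~` N0) s * \1_U s0)%:E.
  move=> mU; rewrite /q' !indicE in_setC; case: asboolP => Ns.
    by rewrite mem_set//= mul1r mul0r addr0 fineK// fin_num_measure.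
  by rewrite memNset//= mul0r mul1r add0r /dirac indicE.
have bq' U : measurable U -> bmeas (fun s => \1_N0 s * fine (q s U) + \1_(~` N0) s * \1_U s0).
  move=> mU; apply: bmeasD; apply: bmeasM; [exact: bmeas_indic|exact: bq| |exact: bmeas_cst].
  by apply: bmeas_indic; exact: measurableC.
split.
- exact: (@measurable_funPT _ _ _ _ T).
- move=> U mU; rewrite (_ : (fun s => _) = EFin \o
      (fun s => \1_N0 s * fine (q s U) + \1_(~` N0) s * \1_U s0)).
    by apply/measurable_EFinP; exact: (bq' _ mU).1.
  by apply/funext => s; exact: q'E.
- move=> U mU; rewrite -[U in LHS]setTI -(preimage_setT T) (qE _ _ measurableT mU).
  transitivity (\int[alpha']_s (\1_N0 s * fine (q s U) + \1_(~` N0) s * \1_U s0))%:E; last first.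
    rewrite (EFin_mean alpha' (bq' _ mU)); apply: eq_integral => s _ /=.
    by rewrite (q'E _ _ mU).
  have b1 : bmeas (fun s => \1_setT s * fine (q s U)).
    by apply: bmeasM; [exact: bmeas_indic|exact: bq].
  rewrite (mean_restrict mN0 N01 b1) [in RHS](mean_restrict mN0 N01 (bq' _ mU)).
  congr _%:E; apply: eq_Rintegral => s _; rewrite !indicE in_setC in_setT.
  by case: (s \in N0) => /=; rewrite ?mulr0// mul0r addr0.
exists N0; split => // s Ns; exists (T @^-1` [set s]); split => //; first exact: mT.
by rewrite /q' asboolT//; exact: fib.
Qed.

(** * Interaction potentials *)

Section RealSums.
Context {R : realType} {I : choiceType}.
Implicit Types (D : set I) (f g b : I -> R) (F : seq I).
Local Open Scope ereal_scope.

Lemma esum_seq (F : seq I) (a : I -> \bar R) : uniq F -> (forall x, x \in F -> 0 <= a x) ->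
  \esum_(x in [set x | x \in F]) a x = \sum_(x <- F) a x.
Proof.
move=> uF a0; rewrite (fsbig_seq _ _ uF); apply: esum_fset; first exact: finite_seq.
by move=> x; rewrite inE => /a0.
Qed.

Lemma esum_subset D (F : seq I) (a : I -> \bar R) : uniq F -> [set x | x \in F] `<=` D ->
  (forall x, D x -> 0 <= a x) ->
  \esum_(x in D) a x = \sum_(x <- F) a x + \esum_(x in D `\` [set x | x \in F]) a x.
Proof.
move=> uF FD a0; rewrite (esumID [set x | x \in F])//; congr (_ + _).
by rewrite setIidr// esum_seq// => x xF; apply: a0; exact: FD.
Qed.

Lemma esum_mono D D' (a : I -> \bar R) : D' `<=` D -> (forall x, D x -> 0 <= a x) ->
  \esum_(x in D') a x <= \esum_(x in D) a x.
Proof.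
move=> DD a0; rewrite (@esumID _ _ D' D)// setIidr// leeDl//.
by apply: esum_ge0 => x [Dx _]; exact: a0.
Qed.

Lemma le_seq_esum D (F : seq I) (a : I -> \bar R) : uniq F -> [set x | x \in F] `<=` D ->
  (forall x, D x -> 0 <= a x) -> \sum_(x <- F) a x <= \esum_(x in D) a x.
Proof.
move=> uF FD a0; rewrite (esum_subset uF FD a0) leeDl//.
by apply: esum_ge0 => x [Dx _]; exact: a0.
Qed.

Lemma esum_le_seq D (a : I -> \bar R) (c : \bar R) : (forall x, D x -> 0 <= a x) ->
  (forall F, uniq F -> [set x | x \in F] `<=` D -> \sum_(x <- F) a x <= c) ->
  \esum_(x in D) a x <= c.
Proof.
move=> a0 h; apply: ge_ereal_sup => _ [A [fA AD] <-].
rewrite (fsbig_finite _ _ fA)/=; apply: h; first exact: fset_uniq.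
by move=> x /=; rewrite in_fset_set// inE => /AD.
Qed.

Lemma esum_tail D (a : I -> R) (e : R) : (forall x, D x -> (0 <= a x)%R) ->
  \esum_(x in D) (a x)%:E < +oo -> (0 < e)%R ->
  exists F, [/\ uniq F, [set x | x \in F] `<=` D &
    \esum_(x in D `\` [set x | x \in F]) (a x)%:E <= e%:E].
Proof.
move=> a0 afin e0.
have s0 : 0 <= \esum_(x in D) (a x)%:E by apply: esum_ge0 => x /a0; rewrite lee_fin.
have sfin : \esum_(x in D) (a x)%:E \is a fin_num by rewrite ge0_fin_numE.
have [_ [A [fA AD] <-] h] := ub_ereal_sup_adherent e0 sfin.
exists (fset_set A); have uA : uniq (fset_set A) by exact: fset_uniq.
have AD' : [set x | x \in (fset_set A : seq I)] `<=` D.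
  by move=> x /=; rewrite in_fset_set// inE => /AD.
split => //; move: h; rewrite -/(esum D _) (fsbig_finite _ _ fA)/=.
rewrite (esum_subset uA AD'); last by move=> x /a0; rewrite lee_fin.
rewrite sumEFin; set t := esum _ _; set s := (\sum_(x <- _) _)%R.
have t0 : 0 <= t by apply: esum_ge0 => x [/a0]; rewrite lee_fin.
have tfin : t \is a fin_num.
  rewrite ge0_fin_numE//; apply: le_lt_trans afin; apply: esum_mono; first exact: subDsetl.
  by move=> x /a0; rewrite lee_fin.
by rewrite -(fineK tfin) -EFinD lte_fin lee_fin => h; apply: ltW; lra.
Qed.

(** The positive and negative parts of the tail together are at most the tail of [b]. Linearity,
    measurability and quasilocality of [rsum] are all drawn from this comparison with finite
    sums. *)
Lemma rsum_tail D f b (F : seq I) : (forall x, D x -> `|f x| <= b x)%R ->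
  \esum_(x in D) (b x)%:E < +oo -> uniq F -> [set x | x \in F] `<=` D ->
  `|rsum D f - \sum_(x <- F) f x|%:E <= \esum_(x in D `\` [set x | x \in F]) (b x)%:E.
Proof.
move=> fb bfin uF FD; set F' := [set x | x \in F].
have p0 x : 0 <= (EFin \o f)^\+ x by [].
have n0 x : 0 <= (EFin \o f)^\- x by [].
have pnE x : (EFin \o f)^\+ x + (EFin \o f)^\- x = `|f x|%:E.
  by have := congr1 (fun h => h x) (fune_abse (EFin \o f)) => /= <-.
have bT : \esum_(x in D `\` F') (b x)%:E < +oo.
  apply: le_lt_trans bfin; apply: esum_mono; first exact: subDsetl.
  by move=> x /fb h; rewrite lee_fin (le_trans _ h).
have pnb : \esum_(x in D `\` F') (EFin \o f)^\+ x + \esum_(x in D `\` F') (EFin \o f)^\- x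
    <= \esum_(x in D `\` F') (b x)%:E.
  by rewrite -esumD//; apply: le_esum => x [Dx _]; rewrite pnE lee_fin fb.
have P0 : 0 <= \esum_(x in D `\` F') (EFin \o f)^\+ x by apply: esum_ge0.
have N0 : 0 <= \esum_(x in D `\` F') (EFin \o f)^\- x by apply: esum_ge0.
have Pf : \esum_(x in D `\` F') (EFin \o f)^\+ x \is a fin_num.
  by rewrite ge0_fin_numE//; apply: le_lt_trans bT; apply: le_trans pnb; rewrite leeDl.
have Nf : \esum_(x in D `\` F') (EFin \o f)^\- x \is a fin_num.
  by rewrite ge0_fin_numE//; apply: le_lt_trans bT; apply: le_trans pnb; rewrite leeDr.
move: pnb; rewrite /rsum (esum_subset uF FD)// (esum_subset uF FD (a := (EFin \o f)^\-))//.
rewrite -/F' -(fineK Pf) -(fineK Nf); move: P0 N0; rewrite -(fineK Pf) -(fineK Nf) !lee_fin.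
set p := fine _; set n := fine _ => P0 N0.
have pF x : (EFin \o f)^\+ x = (Num.max (f x) 0)%:E by rewrite funeposE/= EFin_max.
have nF x : (EFin \o f)^\- x = (Num.max (- f x) 0)%:E by rewrite funenegE/= EFin_max.
under eq_bigr do rewrite pF; under [X in _ - (X + _)]eq_bigr do rewrite nF.
rewrite !sumEFin -!EFinD /=.
have -> : (\sum_(x <- F) f x = \sum_(x <- F) Num.max (f x) 0 -
    \sum_(x <- F) Num.max (- f x) 0)%R.
  rewrite -sumrB; apply: eq_bigr => x _; apply: EFin_inj; rewrite EFinB -pF -nF.
  by have := congr1 (fun h => h x) (funeposneg (EFin \o f)).
apply: le_trans; rewrite lee_fin ler_norml; apply/andP; split; lra.
Qed.

Local Open Scope ring_scope.

Lemma rsum_norm D f b : (forall x, D x -> `|f x| <= b x) ->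
  (\esum_(x in D) (b x)%:E < +oo)%E ->
  (`|rsum D f|%:E <= \esum_(x in D) (b x)%:E)%E.
Proof.
move=> fb bfin; have := @rsum_tail D f b [::] fb bfin isT; rewrite big_nil subr0.
rewrite (_ : [set x | x \in [::]] = set0) ?setD0; first by apply.
by apply/seteqP; split => x.
Qed.

Lemma rsum_restrict D D' f : D' `<=` D -> (forall x, D x -> ~ D' x -> f x = 0) ->
  rsum D f = rsum D' f.
Proof.
move=> DD f0; rewrite /rsum (@esumID _ _ D' D ((EFin \o f)^\+)%E)// (@esumID _ _ D' D ((EFin \o f)^\-)%E)//.
rewrite !(setIidr DD) !(@esum1 _ _ (D `&` ~` D')) ?adde0// => x [Dx /(f0 _ Dx) h].
  by rewrite funenegE/= h oppr0 maxxx.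
by rewrite funeposE/= h maxxx.
Qed.

Lemma rsumB D f g b : (forall x, D x -> `|f x| <= b x) -> (forall x, D x -> `|g x| <= b x) ->
  (\esum_(x in D) (b x)%:E < +oo)%E ->
  rsum D (fun x => f x - g x) = rsum D f - rsum D g.
Proof.
move=> fb gb bfin.
have b0 x : D x -> 0 <= b x by move=> /fb; exact: le_trans.
have fgb x : D x -> `|f x - g x| <= b x + b x.
  by move=> Dx; apply: le_trans (ler_normB _ _) _; apply: lerD; [exact: fb|exact: gb].
have bbE D' : D' `<=` D -> (\esum_(x in D') (b x + b x)%:E =
    \esum_(x in D') (b x)%:E + \esum_(x in D') (b x)%:E)%E.
  move=> DD; rewrite -esumD; last 2 [by move=> x /DD/b0; rewrite lee_fin].
    by apply: eq_esum => x _; rewrite EFinD.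
  by move=> x /DD/b0; rewrite lee_fin.
have bbfin : (\esum_(x in D) (b x + b x)%:E < +oo)%E by rewrite bbE// lte_add_pinfty.
apply/eqP; rewrite -subr_eq0 -normr_le0; apply/ler_addgt0Pl => e e0.
have e4 : 0 < e / 4 by rewrite divr_gt0.
have [F [uF FD Fe]] := esum_tail b0 bfin e4; rewrite addr0.
have := rsum_tail fb bfin uF FD; move=> /le_trans/(_ Fe).
have := rsum_tail gb bfin uF FD; move=> /le_trans/(_ Fe).
have := rsum_tail fgb bbfin uF FD; rewrite bbE; last exact: subDsetl.
move=> /le_trans/(_ (leeD Fe Fe)); rewrite -EFinD !lee_fin sumrB.
set s := \sum_(x <- F) f x; set t := \sum_(x <- F) g x.
rewrite !ler_norml => /andP[h1 h2] /andP[h3 h4] /andP[h5 h6]; apply/andP; split; lra.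
Qed.

End RealSums.

Lemma bmeas_rsum {R : realType} {I : countType} {d} {X : measurableType d}
    (D : set I) (f : I -> X -> R) (b : I -> R) :
  (forall i, D i -> measurable_fun setT (f i)) ->
  (forall i x, D i -> `|f i x| <= b i) -> (\esum_(i in D) (b i)%:E < +oo)%E ->
  bmeas (fun x => rsum D (f ^~ x)).
Proof.
move=> mf fb bfin; split; last first.
  exists (fine (\esum_(i in D) (b i)%:E)%E) => x.
  have h := @rsum_norm _ _ D (f ^~ x) b (fun i => fb i x) bfin.
  rewrite -lee_fin fineK// ge0_fin_numE// (le_trans _ h)// lee_fin//.
(* A negative bound on [D] is possible only if [X] is empty. *)
have [b0|nb0] := pselect (forall i, D i -> 0 <= b i); last first.
  have X0 (x : X) : False.
    by apply: nb0 => i Di; exact: le_trans (normr_ge0 _) (fb i x Di).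
  rewrite (_ : (fun x => _) = cst 0); first exact: measurable_cst.
  by apply/funext => x; case: (X0 x).
pose F n := [seq i <- pmap choice.pickle_inv (iota 0 n) | i \in D].
have uF n : uniq (F n).
  apply: filter_uniq; apply: (pmap_uniq (@choice.pickle_invK I)); exact: iota_uniq.
have FD n : [set i | i \in F n] `<=` D by move=> i /=; rewrite mem_filter => /andP[/set_mem].
apply: (@measurable_fun_cvg _ _ _ setT (fun n x => \sum_(i <- F n) if i \in D then f i x else 0)).
  move=> n; apply: measurable_sum => i.
  by case: (boolP (i \in D)) => [/set_mem/mf//|_]; exact: measurable_cst.
move=> x _; apply/cvgrPdist_le => e e0.
have [F0 [uF0 F0D F0e]] := esum_tail b0 bfin e0.
exists (\max_(i <- F0) (choice.pickle i).+1)%N => // n /= Fn.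
have -> : \sum_(i <- F n) (if i \in D then f i x else 0) = \sum_(i <- F n) f i x.
  by apply: eq_big_seq => i; rewrite mem_filter => /andP[-> _].
have := @rsum_tail _ _ D (f ^~ x) b (F n) (fun i => fb i x) bfin (uF n) (@FD n).
rewrite -lee_fin => /le_trans; apply; apply: le_trans F0e; apply: esum_mono; last first.
  by move=> i [Di _]; rewrite lee_fin b0.
move=> i [Di iF]; split => // iF0; apply: iF => /=.
rewrite mem_filter mem_set//= mem_pmap; apply/mapP; exists (choice.pickle i).
  rewrite mem_iota add0n; apply: leq_trans Fn.
  exact: (leq_bigmax_seq (F := fun i => (choice.pickle i).+1)).
by rewrite choice.pickleK_inv.
Qed.

(** * Neumann series of a nonnegative matrix *)

Section NeumannSeries.
Context {R : realType}.
Local Open Scope ereal_scope.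

Lemma esum_swap_le {I J : choiceType} (D : set I) (E : set J) (a : I -> J -> \bar R) :
  (forall i j, 0 <= a i j) ->
  \esum_(i in D) \esum_(j in E) a i j <= \esum_(j in E) \esum_(i in D) a i j.
Proof.
move=> a0; apply: esum_le_seq => [i _|F uF FD]; first exact: esum_ge0.
rewrite -esum_sum//; apply: le_esum => j _; exact: le_seq_esum.
Qed.

Lemma esumZ_le {I : choiceType} (D : set I) (c : \bar R) (a : I -> \bar R) :
  0 <= c -> (forall i, 0 <= a i) ->
  \esum_(i in D) (c * a i) <= c * (\esum_(i in D) a i).
Proof.
move=> c0 a0; apply: esum_le_seq => [i _|F uF FD]; first exact: mule_ge0.
by rewrite -ge0_sume_distrr//; apply: lee_wpmul2l => //; exact: le_seq_esum.
Qed.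

Lemma le_Zesum {I : choiceType} (D : set I) (c : R) (a : I -> \bar R) :
  (0 <= c)%R -> (forall i, 0 <= a i) ->
  c%:E * (\esum_(i in D) a i) <= \esum_(i in D) (c%:E * a i).
Proof.
rewrite le_eqVlt => /predU1P[<-|c0] a0.
  by rewrite mul0e; apply: esum_ge0 => i _; rewrite mul0e.
have ci : 0 <= c^-1%:E by rewrite lee_fin invr_ge0 ltW.
have ca0 i : 0 <= c%:E * a i by rewrite mule_ge0// lee_fin ltW.
have cK x : c^-1%:E * (c%:E * x) = x by rewrite muleA -EFinM mulVf ?gt_eqF// mul1e.
have := @esumZ_le _ D _ _ ci ca0; under eq_esum do rewrite cK.
move=> h; have cpos : 0 <= c%:E by rewrite lee_fin ltW.
have := lee_wpmul2l cpos h.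
by rewrite muleA -EFinM mulfV ?gt_eqF// mul1e.
Qed.

Context {G : countType} (C : G -> G -> \bar R) (c : R).
Hypotheses (C0 : forall i j, 0 <= C i j) (c01 : (0 <= c < 1)%R).
Hypothesis C_row : forall i, \esum_(j in setT) C i j <= c%:E.

Definition neumann (i j : G) : \bar R := \sum_(0 <= n <oo) mxpow C n i j.

Let c0 : (0 <= c)%R. Proof. by have /andP[] := c01. Qed.

Lemma mxpow_ge0 n i j : 0 <= mxpow C n i j.
Proof.
elim: n i => [|n IH] i /=; first by rewrite lee_fin.
by apply: esum_ge0 => k _; exact: mule_ge0.
Qed.

Lemma mxpow_row n i : \esum_(j in setT) mxpow C n i j <= (c ^+ n)%:E.
Proof.
elim: n i => [|n IH] i /=.
  rewrite (esumID [set i])// setTI esum_set1 ?lee_fin// eqxx esum1 ?adde0//.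
  by move=> j [_ /eqP]; rewrite eq_sym => /negbTE ->.
apply: le_trans (esum_swap_le _ _ _) _ => [j k|]; first by apply: mule_ge0 => //; exact: mxpow_ge0.
apply: le_trans (_ : \esum_(k in setT) (C i k * (c ^+ n)%:E) <= _).
  apply: le_esum => k _; apply: le_trans (esumZ_le _ _ _) _ => //.
    by move=> j; exact: mxpow_ge0.
  exact: lee_wpmul2l.
rewrite exprS EFinM; under eq_esum do rewrite muleC.
apply: le_trans (esumZ_le _ _ _) _ => //; first by rewrite lee_fin exprn_ge0.
by rewrite muleC; apply: lee_wpmul2r => //; rewrite lee_fin exprn_ge0.
Qed.

Lemma neumannE i j : neumann i j = \esum_(n in setT) mxpow C n i j.
Proof. by rewrite /neumann nneseries_esumT// => n; exact: mxpow_ge0. Qed.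

Lemma neumann_ge0 i j : 0 <= neumann i j.
Proof. by rewrite neumannE; apply: esum_ge0 => n _; exact: mxpow_ge0. Qed.

Lemma neumann_row i : \esum_(j in setT) neumann i j <= ((1 - c)^-1)%:E.
Proof.
under eq_esum do rewrite neumannE.
apply: le_trans (esum_swap_le _ _ _) _ => [j n|]; first exact: mxpow_ge0.
apply: le_trans (_ : \esum_(n in setT) (c ^+ n)%:E <= _).
  by apply: le_esum => n _; exact: mxpow_row.
rewrite -nneseries_esumT; last by move=> n; rewrite lee_fin exprn_ge0.
apply: lime_le; first by apply: is_cvg_nneseries => n _ _; rewrite lee_fin exprn_ge0.
apply: nearW => n; rewrite sumEFin lee_fin.
have /andP[_ c1] := c01; have d0 : (0 < 1 - c)%R by rewrite subr_gt0.
rewrite -[X in (_ <= X)%R]mul1r ler_pdivlMr//.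
have -> : ((\sum_(0 <= i < n) c ^+ i) * (1 - c) = 1 - c ^+ n)%R.
  by rewrite big_mkord -[X in (_ * X)%R]opprB mulrN mulrC -subrX1 opprB.
by rewrite gerBl exprn_ge0.
Qed.

Lemma neumann_fin i j : neumann i j \is a fin_num.
Proof.
rewrite ge0_fin_numE ?neumann_ge0//; apply: le_lt_trans (ltry (1 - c)^-1%R).
apply: le_trans (neumann_row i); rewrite (esumID [set j])//; last by move=> *; exact: neumann_ge0.
rewrite setTI esum_set1 ?neumann_ge0// leeDl//.
by apply: esum_ge0 => k _; exact: neumann_ge0.
Qed.

(** Splitting off the term n = 0 of the series gives D = 1 + C D; restricting the sum over i to a
    finite list leaves an inequality. *)
Lemma neumann_super k j (F : seq G) : uniq F ->
  (k == j)%:R%:E + \sum_(i <- F) C k i * neumann i j <= neumann k j.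
Proof.
move=> uF; rewrite [leRHS]/neumann nneseries_recl//; last by move=> n _; exact: mxpow_ge0.
rewrite leeD2l// -(@nneseries_addn _ _ 1); last by move=> n; exact: mxpow_ge0.
rewrite nneseries_esumT; last by move=> n; exact: mxpow_ge0.
apply: le_trans (_ : \sum_(i <- F) \esum_(n in setT) (C k i * mxpow C n i j) <= _).
  apply: lee_sum => i _; rewrite neumannE.
  have Cf : C k i \is a fin_num.
    rewrite ge0_fin_numE//; apply: le_lt_trans (ltry c); apply: le_trans (C_row k).
    rewrite (esumID [set i])// setTI esum_set1// leeDl//.
    by apply: esum_ge0.
  rewrite -(fineK Cf); apply: le_Zesum; first exact: fine_ge0.
  by move=> n; exact: mxpow_ge0.
rewrite -esum_sum; last by move=> *; apply: mule_ge0 => //; exact: mxpow_ge0.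
apply: le_esum => n _; rewrite addn1 /=; apply: le_seq_esum => //.
by move=> i _; apply: mule_ge0 => //; exact: mxpow_ge0.
Qed.

End NeumannSeries.

Section Hamiltonian.
Context {R : realType} {G : countType} {d : measure_display} {S : measurableType d}.
Variables (Phi : {fset G} -> config G S -> R) (w0 : config G S) (K : R).
Hypothesis pot : interaction_potential Phi.
Hypothesis Phi_K : forall i,
  (\esum_(A in containing i) (#|` A|%:R%:E * supnorm (Phi A)) <= K%:E)%E.
Implicit Types (V L A : {fset G}) (w : config G S).

Definition potential_norm A : R := fine (supnorm (Phi A)).

Lemma supnorm_ge0 A : (0 <= supnorm (Phi A))%E.
Proof.
apply: le_trans (_ : (`|Phi A w0|%:E <= _)%E); first by rewrite lee_fin.
by apply: ereal_sup_ubound; exists w0.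
Qed.

Lemma supnorm_fin A : supnorm (Phi A) \is a fin_num.
Proof.
rewrite ge0_fin_numE ?supnorm_ge0//.
have [->|[i iA]] := fset_0Vmem A.
  apply: le_lt_trans (ltry `|Phi fset0 w0|); apply: ge_ereal_sup => _ [w _ <-].
  by rewrite ((pot fset0).2 w w0)// => i; rewrite /= in_fset0.
apply: le_lt_trans (ltry K); apply: le_trans (Phi_K i).
rewrite (esumID [set A]); last by move=> B _; rewrite mule_ge0 ?supnorm_ge0// lee_fin.
rewrite setIidr; last by move=> _ ->.
rewrite esum_set1; last by rewrite mule_ge0 ?supnorm_ge0// lee_fin.
apply: le_trans (_ : (#|` A|%:R%:E * supnorm (Phi A) <= _)%E); last first.
  by rewrite leeDl//; apply: esum_ge0 => B _; rewrite mule_ge0 ?supnorm_ge0// lee_fin.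
rewrite -[leLHS]mul1e; apply: lee_wpmul2r; first exact: supnorm_ge0.
by rewrite lee_fin ler1n cardfs_gt0; apply/fset0Pn; exists i.
Qed.

Lemma potential_normE A : (potential_norm A)%:E = supnorm (Phi A).
Proof. by rewrite fineK ?supnorm_fin. Qed.

Lemma potential_norm_ge0 A : 0 <= potential_norm A.
Proof. by rewrite -lee_fin potential_normE supnorm_ge0. Qed.

Lemma potential_le A w : `|Phi A w| <= potential_norm A.
Proof. by rewrite -lee_fin potential_normE; apply: ereal_sup_ubound; exists w. Qed.

Let meets V : set {fset G} := [set A | (A `&` V)%fset != fset0].

Let meetsP V A : meets V A -> exists2 i, i \in A & i \in V.
Proof. by move=> /fset0Pn[i]; rewrite in_fsetI => /andP[iA iV]; exists i. Qed.

Let meetsI V A i : i \in A -> i \in V -> meets V A.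
Proof. by move=> iA iV; apply/fset0Pn; exists i; rewrite in_fsetI iA. Qed.

Lemma meets1 i : meets [fset i]%fset = containing i.
Proof.
apply/seteqP; split => A; last by move=> iA; apply: meetsI iA _; rewrite in_fset1.
by move=> /meetsP[k kA]; rewrite in_fset1 => /eqP <-.
Qed.

Lemma esum_meets V :
  (\esum_(A in meets V) (#|` A|%:R * potential_norm A)%:E <= (#|` V|%:R * K)%:E)%E.
Proof.
have nn A : (0 <= (#|` A|%:R * potential_norm A)%:E)%E by rewrite lee_fin mulr_ge0 ?potential_norm_ge0.
apply: esum_le_seq => // F uF FV.
apply: le_trans (_ : (\sum_(A <- F) \sum_(i <- V)
    (if i \in A then (#|` A|%:R * potential_norm A)%:E else 0) <= _)%E).
  rewrite big_seq [leRHS]big_seq; apply: lee_sum => A /FV/meetsP[i iA iV].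
  rewrite (big_rem i)//= iA leeDl//; apply: sume_ge0 => k _; by case: ifP.
rewrite exchange_big/= -sum1_size natr_sum mulr_suml -sumEFin; apply: lee_sum => i _.
rewrite mul1r; apply: le_trans (Phi_K i); rewrite -big_mkcond -big_filter.
rewrite (_ : \esum_(A in _) _ = \esum_(A in containing i) (#|` A|%:R * potential_norm A)%:E)%E; last first.
  by apply: eq_esum => A _; rewrite EFinM potential_normE.
apply: le_seq_esum => //; first exact: filter_uniq.
by move=> A /=; rewrite mem_filter => /andP[].
Qed.

Lemma esum_meets_norm V : (\esum_(A in meets V) (potential_norm A)%:E < +oo)%E.
Proof.
apply: le_lt_trans (ltry _); apply: le_trans (esum_meets V).
apply: le_esum => A /meetsP[i iA _]; rewrite lee_fin ler_peMl ?potential_norm_ge0//.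
by rewrite ler1n cardfs_gt0; apply/fset0Pn; exists i.
Qed.

Let H := hamiltonian Phi.

Lemma bmeas_hamiltonian V : bmeas (H V).
Proof.
apply: (bmeas_rsum (b := potential_norm)).
- by move=> A _; exact: (pot A).1.
- by move=> A w _; exact: potential_le.
- exact: esum_meets_norm.
Qed.

Definition hamiltonian_bound V : R := fine (\esum_(A in meets V) (potential_norm A)%:E)%E.

Lemma hamiltonian_le V w : `|H V w| <= hamiltonian_bound V.
Proof.
have h := rsum_norm (fun A _ => potential_le A w) (esum_meets_norm V).
rewrite -lee_fin fineK// ge0_fin_numE ?esum_meets_norm//.
by apply: esum_ge0 => A _; rewrite lee_fin potential_norm_ge0.
Qed.

Lemma hamiltonian_diff V w w' :
  H V w - H V w' = rsum (meets V) (fun A => Phi A w - Phi A w').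
Proof.
rewrite (rsumB (b := potential_norm))// => [A _|A _|]; try exact: potential_le.
exact: esum_meets_norm.
Qed.

(** Interaction terms that miss [L] do not see the change and cancel in the difference. *)
Lemma hamiltonian_local L V w w' : (L `<=` V)%fset ->
  (forall k, k \notin L -> w k = w' k) -> H V w - H V w' = H L w - H L w'.
Proof.
move=> LV ww'; rewrite !hamiltonian_diff; apply: rsum_restrict.
  by move=> A /meetsP[i iA iL]; apply: meetsI iA _; exact: (fsubsetP LV).
move=> A _ nAL; apply/eqP; rewrite subr_eq0; apply/eqP/(pot A).2 => k /= kA.
by apply: ww'; apply/negP => kL; apply: nAL; exact: meetsI kA kL.
Qed.

Lemma hamiltonian_quasilocal V : quasilocal (H V).
Proof.
move=> e e0; have e2 : 0 < e / 2 by rewrite divr_gt0.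
have [F [uF FV Fe]] := esum_tail (fun A _ => potential_norm_ge0 A) (esum_meets_norm V) e2.
exists (\bigcup_(A <- F) A)%fset => w w' ww'.
have h w1 := rsum_tail (fun A _ => potential_le A w1) (esum_meets_norm V) uF FV.
have {h}h w1 := le_trans (h w1) Fe.
have E : \sum_(A <- F) Phi A w = \sum_(A <- F) Phi A w'.
  apply: eq_big_seq => A AF; apply: (pot A).2 => k /= kA; apply: ww' => /=.
  by apply/bigfcupP; exists A => //; rewrite AF.
have := h w'; have := h w; rewrite E !lee_fin /H /hamiltonian.
set s := \sum_(A <- F) _; rewrite !ler_norml => /andP[? ?] /andP[? ?].
by apply/andP; split; rewrite -/(meets V); lra.
Qed.

Definition hamiltonian_osc V k : R := fine (osc_at k (H V)).

Let variation V k : (\esum_(A in meets V `&` containing k) (potential_norm A)%:E < +oo)%E.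
Proof.
apply: le_lt_trans (esum_meets_norm V); apply: esum_mono; first exact: subIsetl.
by move=> A _; rewrite lee_fin potential_norm_ge0.
Qed.

Lemma hamiltonian_diff_off V k w w' : agree_off k w w' ->
  H V w - H V w' = rsum (meets V `&` containing k) (fun A => Phi A w - Phi A w').
Proof.
move=> ww'; rewrite hamiltonian_diff; apply: rsum_restrict; first exact: subIsetl.
move=> A AV nA; apply/eqP; rewrite subr_eq0; apply/eqP/(pot A).2 => i /= iA.
by apply: ww' => /=; apply/negP => /eqP ik; apply: nA; split => //; rewrite /containing/= -ik.
Qed.

Lemma osc_hamiltonian_le V k : (osc_at k (H V) <=
  \esum_(A in meets V `&` containing k) (potential_norm A + potential_norm A)%:E)%E.
Proof.
apply: ge_ereal_sup => _ [[w w'] /= ww' ->].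
rewrite (@hamiltonian_diff_off V k); last by move=> i ik; rewrite ww'.
apply: rsum_norm => [A _|]; last first.
  under eq_esum do rewrite EFinD.
  by rewrite esumD ?lte_add_pinfty// => A _; rewrite lee_fin potential_norm_ge0.
by apply: le_trans (ler_normB _ _) _; apply: lerD; exact: potential_le.
Qed.

Lemma osc_hamiltonian_ge0 V k : (0 <= osc_at k (H V))%E.
Proof.
apply: le_trans (_ : (`|H V w0 - H V w0|%:E <= _)%E); first by rewrite lee_fin.
by apply: ereal_sup_ubound; exists (w0, w0).
Qed.

Lemma osc_hamiltonian_fin V k : osc_at k (H V) \is a fin_num.
Proof.
rewrite ge0_fin_numE ?osc_hamiltonian_ge0//; apply: le_lt_trans (osc_hamiltonian_le V k) _.
under eq_esum do rewrite EFinD.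
by rewrite esumD ?lte_add_pinfty// => A _; rewrite lee_fin potential_norm_ge0.
Qed.

Lemma hamiltonian_oscE V k : (hamiltonian_osc V k)%:E = osc_at k (H V).
Proof. by rewrite fineK ?osc_hamiltonian_fin. Qed.

Lemma hamiltonian_osc_ge0 V k : 0 <= hamiltonian_osc V k.
Proof. by rewrite -lee_fin hamiltonian_oscE osc_hamiltonian_ge0. Qed.

Lemma hamiltonian_osc_diff V k w w' : agree_off k w w' ->
  `|H V w - H V w'| <= hamiltonian_osc V k.
Proof.
move=> ww'; rewrite -lee_fin hamiltonian_oscE; apply: ereal_sup_ubound.
by exists (w', w) => //= i ik; rewrite ww'.
Qed.

(** Phi_A contributes at most twice its norm to the oscillation at each of the |A| sites of A and
    nothing elsewhere. Here the weight |A| of the summability hypothesis is spent. *)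
Lemma esum_hamiltonian_osc V (D : set G) :
  (\esum_(k in D) (hamiltonian_osc V k)%:E <= (2 * (#|` V|%:R * K))%:E)%E.
Proof.
have n0 A : 0 <= potential_norm A + potential_norm A by rewrite addr_ge0 ?potential_norm_ge0.
apply: le_trans (_ : (\esum_(k in D) \esum_(A in meets V)
    (if k \in A then (potential_norm A + potential_norm A)%:E else 0) <= _)%E).
  apply: le_esum => k _; rewrite hamiltonian_oscE; apply: le_trans (osc_hamiltonian_le V k) _.
  rewrite esum_mkcondr; apply: le_esum => A _.
  by rewrite (_ : (A \in containing k) = (k \in A))//; apply/idP/idP; rewrite inE.
apply: le_trans (esum_swap_le _ _ _) _ => [k A|].
  by case: ifP => // _; rewrite lee_fin n0.
apply: le_trans (_ : (\esum_(A in meets V) ((2%:R)%:E * (#|` A|%:R * potential_norm A)%:E) <= _)%E).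
  apply: le_esum => A _; apply: esum_le_seq => [k _|F uF _].
    by case: ifP => // _; rewrite lee_fin n0.
  rewrite -big_mkcond -big_filter.
  rewrite sumEFin big_const_seq count_predT iter_addr addr0 -EFinM lee_fin.
  rewrite -mulr_natl [leRHS]mulrCA mulr_natl [X in _ * X]mulr_natl mulr2n.
  rewrite -[leLHS]mulr_natl; apply: ler_wpM2r; first exact: n0.
  rewrite ler_nat; apply: uniq_leq_size; first exact: filter_uniq.
  by move=> k; rewrite mem_filter => /andP[].
apply: le_trans (esumZ_le _ _ _) _ => //.
  by move=> A; rewrite lee_fin mulr_ge0 ?potential_norm_ge0.
by rewrite EFinM lee_pmul2l// esum_meets.
Qed.

(** Terms of H_i whose set does not contain [k] cancel under a change at [k], which leaves the form
    of the oscillation that occurs in [Qbound]. *)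
Lemma osc_hamiltonian1 i k : k != i ->
  osc_at k (H [fset i]%fset) = osc_at k (fun w => rsum (containing2 i k) (fun A => Phi A w)).
Proof.
move=> ki; have DE : meets [fset i]%fset `&` containing k = containing2 i k.
  rewrite meets1; apply/seteqP; split => A /=.
    move=> [iA kA]; apply/fsubsetP => x; rewrite !inE => /orP[]/eqP -> //.
  by move=> /fsubsetP h; split; apply: h; rewrite !inE eqxx ?orbT.
have c2 : (\esum_(A in containing2 i k) (potential_norm A)%:E < +oo)%E by rewrite -DE.
have E w w' : agree_off k w w' -> H [fset i]%fset w - H [fset i]%fset w' =
    rsum (containing2 i k) (fun A => Phi A w) - rsum (containing2 i k) (fun A => Phi A w').
  move=> ww'; rewrite (@hamiltonian_diff_off _ k)// DE.
  by rewrite (rsumB (b := potential_norm))// => A _; exact: potential_le.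
rewrite /osc_at; congr ereal_sup; apply/seteqP; split => _ [[w w'] /= ww' ->].
  by exists (w, w') => //=; rewrite E// => j jk; rewrite ww'.
by exists (w, w') => //=; rewrite E// => j jk; rewrite ww'.
Qed.

Lemma osc_le A : (osc (Phi A) <= (potential_norm A + potential_norm A)%:E)%E.
Proof.
apply: ge_ereal_sup => _ [w [w' ->]]; rewrite lee_fin.
by apply: le_trans (ler_normB _ _) _; apply: lerD; exact: potential_le.
Qed.

Lemma osc_ge0 A : (0 <= osc (Phi A))%E.
Proof.
apply: le_trans (_ : (`|Phi A w0 - Phi A w0|%:E <= _)%E); first by rewrite lee_fin.
by apply: ereal_sup_ubound; exists w0, w0.
Qed.

Lemma esum_osc_fin i j : \esum_(A in containing2 i j) osc (Phi A) \is a fin_num.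
Proof.
rewrite ge0_fin_numE; last by apply: esum_ge0 => A _; exact: osc_ge0.
apply: le_lt_trans (_ : (\esum_(A in meets [fset i]%fset) (potential_norm A + potential_norm A)%:E < +oo)%E).
  apply: le_trans (_ : (\esum_(A in containing2 i j) (potential_norm A + potential_norm A)%:E <= _)%E).
    by apply: le_esum => A _; exact: osc_le.
  apply: esum_mono; last by move=> A _; rewrite lee_fin addr_ge0 ?potential_norm_ge0.
  by rewrite meets1 => A /fsubsetP; apply; rewrite !inE eqxx.
under eq_esum do rewrite EFinD.
by rewrite esumD ?lte_add_pinfty ?esum_meets_norm// => A _; rewrite lee_fin potential_norm_ge0.
Qed.

End Hamiltonian.

(** * From the contraction hypothesis to a Dobrushin matrix *)

Section Contraction.
Context {R : realType} {G : countType} {dS dS' : measure_display}.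
Context {S : metricMeasurableType R dS} {S' : measurableType dS'}.
Variables (piece : S' -> set S) (T : S -> S') (s0 : S).
Hypothesis piece_cover : \bigcup_(s' in [set: S']) piece s' = [set: S].
Hypothesis T_piece : forall s' s, piece s' s -> T s = s'.
Variables (Phi : {fset G} -> config G S -> R) (L : G -> G -> R).
Hypothesis osc_fin : forall i j, \esum_(A in containing2 i j) osc (Phi A) \is a fin_num.
Hypothesis L_ge0 : forall (i j : G) (s a : S), 0 <= L i j * mdist s a.

Let rho := fineness piece.

Hypothesis contraction : (rho * (2^-1)%:E
  * ereal_sup [set \esum_(j in [set: G]) weight Phi L i j | i in [set: G]] < 1)%E.

Lemma mdist_le_fineness (s a : S) : T s = T a -> ((mdist s a)%:E <= rho)%E.
Proof.
move=> Tsa; have pT u : piece (T u) u.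
  have : (\bigcup_(s' in [set: S']) piece s') u by rewrite piece_cover.
  by move=> [s' _ s'u]; rewrite (T_piece s'u).
apply: le_trans (_ : (diam (piece (T s)) <= _)%E).
  by apply: ereal_sup_ubound; exists (s, a) => //; split => //=; rewrite Tsa.
by apply: ereal_sup_ubound; exists (T s).
Qed.

Lemma fineness_ge0 : (0 <= rho)%E.
Proof. by have := @mdist_le_fineness s0 s0 erefl; rewrite mdistxx. Qed.

(** The sign is known only for [L i j] times a distance; positive fineness supplies two points at
    positive distance. *)
Lemma fineness_gt0 : (0 < rho)%E -> forall i j, 0 <= L i j.
Proof.
move=> rho0 i j; suff [s [a sa]] : exists s a : S, 0 < mdist s a by have := L_ge0 i j s a; rewrite pmulr_lge0.
apply: contrapT => nsa; move: rho0; rewrite ltNge => /negP; apply.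
apply: ge_ereal_sup => _ [s' _ <-]; apply: ge_ereal_sup => _ [[s a] _ <-].
by rewrite lee_fin leNgt; apply/negP => sa; apply: nsa; exists s, a.
Qed.

Let W i j : R := expR (2^-1 * fine (\esum_(A in containing2 i j) osc (Phi A))%E).

Let weightE i j : weight Phi L i j = (W i j * L i j)%:E.
Proof. by rewrite /weight -(fineK (osc_fin i j)). Qed.

Let W_ge1 i j : 1 <= W i j.
Proof.
rewrite -expR0 ler_expR mulr_ge0 ?invr_ge0// fine_ge0//; apply: esum_ge0 => A _.
have [[w _]|n0] := pselect (exists w : config G S, True).
  apply: le_trans (_ : (`|Phi A w - Phi A w|%:E <= _)%E); first by rewrite lee_fin.
  by apply: ereal_sup_ubound; exists w, w.
by case: n0; exists (fun=> s0).
Qed.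

(** For fineness 0 all distances within pieces vanish; for infinite fineness the hypothesis forces
    every [L i j] to be 0. Otherwise [Cbar] dominates rho L_ij / 2, because the exponential in
    [weight] is at least 1. *)
Lemma contraction_bound : exists c : R,
  [/\ 0 <= c < 1, forall i j, (0 <= Cbar Phi rho L i j)%E,
      forall i, (\esum_(j in [set: G]) Cbar Phi rho L i j <= c%:E)%E &
      forall i j (s a : S), T s = T a -> L i j * mdist s a <= 2 * fine (Cbar Phi rho L i j)].
Proof.
have zero : (forall i j, Cbar Phi rho L i j = 0%E) ->
    (forall i j (s a : S), T s = T a -> L i j * mdist s a <= 0) -> exists c : R,
  [/\ 0 <= c < 1, forall i j, (0 <= Cbar Phi rho L i j)%E,
      forall i, (\esum_(j in [set: G]) Cbar Phi rho L i j <= c%:E)%E &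
      forall i j (s a : S), T s = T a -> L i j * mdist s a <= 2 * fine (Cbar Phi rho L i j)].
  move=> C0 L0; exists 0; split.
  - by rewrite lexx ltr01.
  - by move=> i j; rewrite C0.
  - by move=> i; rewrite esum1.
  - by move=> i j s a /(L0 i j); rewrite C0 mulr0.
have := fineness_ge0; rewrite le_eqVlt => /predU1P[rho0|rho0].
  apply: zero => [i j|i j s a /mdist_le_fineness]; first by rewrite /Cbar -rho0 !mul0e.
  rewrite -rho0 lee_fin => sa.
  by rewrite (_ : mdist s a = 0) ?mulr0//; apply/eqP; rewrite eq_le sa mdist_ge0.
have L0 := fineness_gt0 rho0.
have w0 i j : (0 <= weight Phi L i j)%E.
  by rewrite weightE lee_fin mulr_ge0// (le_trans ler01).
pose Sup := ereal_sup [set \esum_(j in [set: G]) weight Phi L i j | i in [set: G]].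
have rowS i : (\esum_(j in [set: G]) weight Phi L i j <= Sup)%E.
  by apply: ereal_sup_ubound; exists i.
move: contraction; rewrite -/Sup; case E : rho => [r||] //.
- have r0 : 0 < r by move: rho0; rewrite E lte_fin.
  have r20 : 0 <= r * 2^-1 by rewrite mulr_ge0 ?invr_ge0// ltW.
  move=> con; pose p := ((r * 2^-1)%:E * Sup)%E.
  have p1 : (p < 1)%E by rewrite /p EFinM.
  (* The maximum with 0 spares a case distinction on whether [G] is empty, in which case [Sup] is
     -oo. *)
  exists (Num.max 0 (fine p)); split.
  + rewrite le_max lexx/= gt_max ltr01/=.
    by case: p p1 => [q| |]//=.
  + by move=> i j; rewrite /Cbar -EFinM mule_ge0.
  + move=> i; rewrite /Cbar -EFinM.
    have row : (\esum_(j in [set: G]) ((r * 2^-1)%:E * weight Phi L i j) <= p)%E.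
      apply: le_trans (esumZ_le _ _ _) _ => //.
      by apply: lee_wpmul2l => //; rewrite lee_fin.
    have p0 : (0 <= p)%E.
      apply: le_trans row; apply: esum_ge0 => j _; exact: mule_ge0.
    apply: le_trans row _; rewrite EFin_max le_max; apply/orP; right.
    by rewrite fineK// ge0_fin_numE// (lt_trans p1)// ltry.
  + move=> i j s a /mdist_le_fineness; rewrite E lee_fin => sa.
    rewrite /Cbar weightE -!EFinM/=.
    have h1 : L i j * mdist s a <= L i j * r by rewrite ler_wpM2l.
    have h2 : L i j * r <= W i j * (L i j * r) by rewrite ler_peMl// mulr_ge0// ltW.
    apply: le_trans h1 (le_trans h2 _).
    by rewrite (_ : 2 * _ = W i j * (L i j * r))//; lra.
- rewrite gt0_mulye ?lte_fin ?invr_gt0// => con.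
  have S0 : (Sup <= 0)%E.
    by rewrite leNgt; apply/negP => S0; move: con; rewrite gt0_mulye.
  have wz i j : weight Phi L i j = 0%E.
    apply/eqP; rewrite eq_le w0 andbT; apply: le_trans S0; apply: le_trans (rowS i).
    rewrite (esumID [set j])// setTI esum_set1// leeDl//.
    by apply: esum_ge0.
  have Lz i j : L i j = 0.
    have /eqP := wz i j; rewrite weightE eqe mulf_eq0 => /orP[|/eqP//].
    by rewrite gt_eqF// (lt_le_trans ltr01).
  move: zero; rewrite E; apply => [i j|i j s a _]; first by rewrite /Cbar wz mule0.
  by rewrite Lz mul0r.
- by move: rho0; rewrite E.
Qed.

End Contraction.

Section PotentialModel.
Context {R : realType} {G : countType} {d : measure_display} {S : measurableType d}.
Variables (same_piece : S -> S -> Prop).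
Variables (Phi : {fset G} -> config G S -> R) (w0 : config G S) (K : R).
Hypothesis pot : interaction_potential Phi.
Hypothesis Phi_K : forall i,
  (\esum_(A in containing i) (#|` A|%:R%:E * supnorm (Phi A)) <= K%:E)%E.
Variables (C : G -> G -> \bar R) (c : R).
Hypotheses (C0 : forall i j, (0 <= C i j)%E) (c01 : 0 <= c < 1).
Hypothesis C_row : forall i, (\esum_(j in [set: G]) C i j <= c%:E)%E.
Hypothesis C_lip : forall (k l : G) (w w' : config G S) (s t : S), agree_off l w w' -> same_piece s t ->
  `|hamiltonian Phi [fset k]%fset (update w k s) - hamiltonian Phi [fset k]%fset (update w' k s)
    - (hamiltonian Phi [fset k]%fset (update w k t)
       - hamiltonian Phi [fset k]%fset (update w' k t))| <= 2 * fine (C k l).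

Let Delta := hamiltonian_osc Phi.
Let D i j := fine (neumann C i j).

Let D0 i j : 0 <= D i j. Proof. by apply: fine_ge0; exact: neumann_ge0. Qed.

Let DE i j : (D i j)%:E = neumann C i j.
Proof. by rewrite fineK// (neumann_fin C0 c01 C_row). Qed.

Let CE i j : (fine (C i j))%:E = C i j.
Proof.
rewrite fineK// ge0_fin_numE//; apply: le_lt_trans (ltry c); apply: le_trans (C_row i).
rewrite (esumID [set j])// setTI esum_set1// leeDl//.
by apply: esum_ge0.
Qed.

Let Delta0 V k : 0 <= Delta V k. Proof. exact: hamiltonian_osc_ge0 w0 _ pot Phi_K V k. Qed.

Definition total_osc (V : {fset G}) (j : G) : R :=
  fine (\esum_(k in [set k | k \notin V]) (hamiltonian_osc Phi V k * fine (neumann C k j))%:E)%E.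

(** Summing over j first uses the row sums of the Neumann series, at most 1/(1 - c); then the total
    oscillation of [H V] remains. Finiteness of this double sum is what provides small tails. *)
Let sum_total V : (\esum_(j in [set: G]) \esum_(k in [set k | k \notin V]) (Delta V k * D k j)%:E
  <= ((1 - c)^-1 * (2 * (#|` V|%:R * K)))%:E)%E.
Proof.
have d0 : 0 <= (1 - c)^-1 by rewrite invr_ge0 subr_ge0; have /andP[_ /ltW] := c01.
apply: le_trans (esum_swap_le _ _ _) _ => [j k|]; first by rewrite lee_fin mulr_ge0.
apply: le_trans (_ : (\esum_(k in [set k | k \notin V]) ((1 - c)^-1%:E * (Delta V k)%:E) <= _)%E).
  apply: le_esum => k _; under eq_esum do rewrite EFinM.
  apply: le_trans (esumZ_le _ _ _) _; [by rewrite lee_fin|by move=> j; rewrite lee_fin|].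
  rewrite muleC; apply: lee_wpmul2r; first by rewrite lee_fin.
  under eq_esum do rewrite DE.
  exact: neumann_row.
apply: le_trans (esumZ_le _ _ _) _; [by rewrite lee_fin|by move=> k; rewrite lee_fin|].
rewrite EFinM; apply: lee_wpmul2l; first by rewrite lee_fin.
exact: esum_hamiltonian_osc w0 _ pot Phi_K _ _.
Qed.

Let total_ge0 V j : (0 <= \esum_(k in [set k | k \notin V]) (Delta V k * D k j)%:E)%E.
Proof. by apply: esum_ge0 => k _; rewrite lee_fin mulr_ge0. Qed.

Lemma total_oscE V j : (total_osc V j)%:E =
  (\esum_(k in [set k | k \notin V]) (hamiltonian_osc Phi V k * fine (neumann C k j))%:E)%E.
Proof.
rewrite fineK// ge0_fin_numE; last exact: total_ge0.
apply: le_lt_trans (ltry _); apply: le_trans (sum_total V).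
rewrite [leRHS](esumID [set j])// setTI esum_set1// leeDl//.
by apply: esum_ge0.
Qed.

Lemma potential_model : dobrushin_model same_piece (hamiltonian Phi)
  (fun i j => fine (C i j)) D c (hamiltonian_bound Phi) Delta total_osc.
Proof.
split.
- exact: bmeas_hamiltonian w0 _ pot Phi_K.
- by move=> L V w w' LV ww'; exact: (hamiltonian_local w0 pot Phi_K).
- exact: hamiltonian_quasilocal w0 _ pot Phi_K.
- by move=> k l w w' s t _; exact: C_lip.
- by move=> k l; exact: fine_ge0.
- exact: D0.
- exact: c01.
- move=> k F uF; rewrite -lee_fin -sumEFin; under eq_bigr do rewrite CE.
  by apply: le_trans (C_row k); exact: le_seq_esum.
- move=> k j F uF; rewrite -lee_fin EFinD -sumEFin; under eq_bigr do rewrite EFinM CE DE.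
  by rewrite DE; exact: neumann_super C_row _ _ _ uF.
- exact: hamiltonian_le w0 _ pot Phi_K.
- exact: Delta0.
- by move=> V k w w' _; exact: (hamiltonian_osc_diff w0 pot Phi_K).
- move=> V j F uF FV; rewrite -lee_fin total_oscE -sumEFin; apply: le_seq_esum => //.
  by move=> k _; rewrite lee_fin mulr_ge0.
- move=> V e e0.
  have t0 j : [set: G] j -> 0 <= total_osc V j by move=> _; apply: fine_ge0; exact: total_ge0.
  have tfin : (\esum_(j in [set: G]) (total_osc V j)%:E < +oo)%E.
    under eq_esum do rewrite total_oscE.
    exact: le_lt_trans (sum_total V) (ltry _).
  have [F0 [uF0 _ F0e]] := esum_tail t0 tfin e0.
  exists [fset j | j in F0]%fset => F uF FF0; rewrite -lee_fin; apply: le_trans F0e.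
  rewrite -sumEFin; apply: le_seq_esum => //.
    move=> j /= jF; split => // jF0; have := FF0 _ jF.
    by rewrite in_fset /= jF0.
  by move=> j _; rewrite lee_fin t0.
Qed.

End PotentialModel.

Section PotentialGibbs.
Context {R : realType} {G : countType} {d : measure_display} {S : measurableType d}.
Variables (Phi : {fset G} -> config G S -> R) (alpha : probability S R).
Hypothesis bH : forall V, bmeas (hamiltonian Phi V).

Lemma site_integralE (V : {fset G}) (f : config G S -> R) w : bmeas f ->
  site_integral alpha V (fun v => (f v)%:E) w = (site_means (fun=> alpha) (enum_fset V) f w)%:E.
Proof.
move=> bf; rewrite /site_integral; elim: (enum_fset V) w => //= i s IH w.
rewrite /site_mean EFin_mean; first by apply: eq_integral => u _; rewrite IH.
by apply: bmeas_update; exact: bmeas_site_means.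
Qed.

Lemma gibbs_kernelE V w B : measurable B -> gibbs_kernel Phi alpha V w B =
  (gibbs_mean (fun=> alpha) (hamiltonian Phi V) (enum_fset V) (\1_B : config G S -> R) w)%:E.
Proof.
move=> mB; have bE : bmeas (fun v => expR (- hamiltonian Phi V v)).
  by apply: bmeas_exp; exact: bmeasN.
rewrite /gibbs_kernel !site_integralE//; last first.
  by apply: bmeasM => //; exact: bmeas_indic.
by rewrite inver gt_eqF ?EFinM// (partition_gt0 (fun=> alpha) (bH V)).
Qed.

Lemma gibbs_measure_mean (mu : probability (config G S) R) V B : measurable B ->
  gibbs_measure Phi alpha mu -> mu B = (\int[mu]_w
    (gibbs_mean (fun=> alpha) (hamiltonian Phi V) (enum_fset V) (\1_B : config G S -> R) w)%:E)%E.
Proof.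
move=> mB gmu; have := gmu V B setT mB measurableT; rewrite setIT => ->.
by apply: eq_integral => w _; exact: gibbs_kernelE.
Qed.

End PotentialGibbs.

(** * The image measure and its specification *)

Section ImageSpecification.
Context {R : realType} {G : countType} {d d' : measure_display}.
Context {S : measurableType d} {S' : measurableType d'} {same_piece : S -> S -> Prop}.
Context {H : {fset G} -> config G S -> R}.
Context {C D : G -> G -> R} {c : R} {M : {fset G} -> R}.
Context {Delta kappa : {fset G} -> G -> R}.
Hypothesis model : dobrushin_model same_piece H C D c M Delta kappa.
Variables (alpha : probability S R) (T : {mfun S >-> S'}).
Variables (q : S' -> probability S R) (A : S' -> set S).
Hypothesis dq : disintegration alpha (distribution alpha T) T q.
Hypotheses (mA : forall s', measurable (A s')) (qA : forall s', q s' (A s') = 1%E).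
Hypothesis A_piece : forall s' s t, A s' s -> A s' t -> same_piece s t.
Variables (w0 : config G S) (s0 : S').
Variable mu : probability (config G S) R.
Hypothesis mu_gibbs : forall V B, measurable B ->
  mu B = (\int[mu]_w (gibbs_mean (fun=> alpha) (H V) (enum_fset V) (\1_B : config G S -> R) w)%:E)%E.

Lemma image_specification :
  exists gam : {fset G} -> R.-pker (config G S') ~> (config G S'),
    [/\ specification gam,
        gibbs_for (fun V w B => gam V w B) (distribution mu (sitewise T)) &
        forall i j, (dobrushin_matrix gam i j
          <= (2 * osc_rate M kappa [fset i]%fset j)%:E)%E].
Proof.
pose g := cdens (H := H) q w0 s0; pose alpha' : probability S' R := distribution alpha T.
have bg L : bmeas (g L) by exact: (bmeas_cdens model (di_q dq) mA qA A_piece w0 s0 L).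
have g_lb L : exists2 a : R, 0 < a & forall o, a <= g L o.
  exists (expR (- (4 * M L))); first exact: expR_gt0.
  by move=> o; have /andP[] := cdens_bound model mA qA A_piece w0 s0 L o.
exists (tilt_kernel alpha' bg g_lb); split.
- apply: (@tilt_specification _ _ _ _ alpha' s0 g bg g_lb).
    by move=> L V o LV; exact: (cdens_cocycle model mA qA A_piece w0 s0 o LV).
  by move=> L e e0; exact: (cdens_quasilocal model mA qA A_piece w0 s0 L e0).
- move=> L B E mB mEL; have mE := measurable_off_full mEL.
  have mBE : measurable (B `&` E) by exact: measurableI.
  have bB := @bmeas_indic R _ _ _ mB; have bE := @bmeas_indic R _ _ _ mE.
  have bBE := @bmeas_indic R _ _ _ mBE.
  have bt : bmeas (tilt alpha' g L (\1_B : config G S' -> R)) by exact: bmeas_tilt.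
  have mS := measurable_sitewise (G := G) T.
  rewrite -mean_indic//.
  have image f : bmeas f -> (forall o, 0 <= f o) ->
      (\int[distribution mu (sitewise T)]_o (f o)%:E)%E =
      (\int[mu]_w f (sitewise T w))%:E.
    move=> bf f0; rewrite EFin_mean; last exact: bmeas_comp mS bf.
    rewrite ge0_integral_distribution//.
    by apply/measurable_EFinP; exact: bf.1.
  rewrite EFin_mean// image//.
  rewrite (image_tilt_mean model dq mA qA A_piece w0 s0 mu_gibbs L bBE)//.
  have -> : (\int[distribution mu (sitewise T)]_(w in E) tilt_kernel alpha' bg g_lb L w B =
      \int[distribution mu (sitewise T)]_w (\1_E w * tilt alpha' g L \1_B w)%:E)%E.
    rewrite integral_mkcond; apply: eq_integral => w _; rewrite epatch_indic/= EFinM muleC.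
    by congr (_ * _)%E; exact: tilt_probE.
  have tE0 o : 0 <= \1_E o * tilt alpha' g L (\1_B : config G S' -> R) o.
    by apply: mulr_ge0 => //; rewrite -lee_fin -(tilt_probE alpha' bg g_lb).
  rewrite (image _ (bmeasM bE bt) tE0).
  congr _%:E; apply: eq_Rintegral => w _.
  rewrite -tiltMl//.
    by congr (tilt _ _ _ _ _); apply/funext => o; rewrite indicI mulrC.
  by move=> k kL; exact: measurable_off_indep mEL kL.
- move=> i j; apply: dobrushin_tilt_le.
    by rewrite mulr_ge0// mulr_ge0 ?expR_ge0// (kappa_ge0 model).
  move=> ji w w' s t ww'; apply: (cdens_change model mA qA A_piece w0 s0).
  + by rewrite in_fset1.
  + by move=> k; rewrite in_fset1 /update => /negbTE ->.
  + by move=> k; rewrite in_fset1 /update => /negbTE ->.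
  + by move=> k kj; rewrite /update; case: eqP => // _; exact: ww'.
  + by move=> k kj; rewrite /update; case: eqP => // _; exact: ww'.
Qed.

End ImageSpecification.

Theorem theorem2p9 (R : realType) (G : countType) (dS dS' : measure_display)
    (S : metricMeasurableType R dS) (S' : measurableType dS')
    (borelS : standard_borel R S) (borelS' : standard_borel R S')
    (piece : S' -> set S)
    (piece_cover : \bigcup_(s' in [set: S']) piece s' = [set: S])
    (piece_disjoint : trivIset [set: S'] piece)
    (T : {mfun S >-> S'})
    (T_piece : forall (s' : S') (s : S), piece s' s -> T s = s')
    (Phi : {fset G} -> config G S -> R)
    (Phi_potential : interaction_potential Phi)
    (Phi_summable : (ereal_sup [set \esum_(A in containing i)
        (#|` A|%:R%:E * supnorm (Phi A)) | i in [set: G]] < +oo)%E)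
    (L : G -> G -> R)
    (Lipschitz : forall (i j : G) (s a : S),
      (ereal_sup [set t | exists2 ze : config G S * config G S,
         agree_off j ze.1 ze.2 &
         t = `| hamiltonian Phi [fset i]%fset (update ze.1 i s)
              - hamiltonian Phi [fset i]%fset (update ze.2 i s)
              - (hamiltonian Phi [fset i]%fset (update ze.1 i a)
                 - hamiltonian Phi [fset i]%fset (update ze.2 i a)) |%:E]
       <= (L i j * mdist s a)%:E)%E)
    (contraction : (fineness piece * (2^-1)%:E
        * ereal_sup [set \esum_(j in [set: G]) weight Phi L i j | i in [set: G]]
      < 1)%E) :
  forall (alpha : probability S R) (mu : probability (config G S) R),
    gibbs_measure Phi alpha mu ->
    exists gam : {fset G} -> R.-pker (config G S') ~> (config G S'),
      [/\ specification gam,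
          gibbs_for (fun V w B => gam V w B) (distribution mu (sitewise T)) &
          forall i j : G, (dobrushin_matrix gam i j
            <= Qbound Phi (fineness piece) L i j)%E].
Proof.
move=> alpha mu gmu.
have [s0 _] := probability_inhabited alpha.
pose w0 : config G S := fun=> s0.
pose K := fine (ereal_sup [set \esum_(A in containing i)
  (#|` A|%:R%:E * supnorm (Phi A)) | i in [set: G]])%E.
have Phi_K i : (\esum_(A in containing i) (#|` A|%:R%:E * supnorm (Phi A)) <= K%:E)%E.
  have h : (\esum_(A in containing i) (#|` A|%:R%:E * supnorm (Phi A)) <=
      ereal_sup [set \esum_(A in containing i)
        (#|` A|%:R%:E * supnorm (Phi A)) | i in [set: G]])%E.
    by apply: ereal_sup_ubound; exists i.
  rewrite /K fineK// ge0_fin_numE//; apply: le_trans h; apply: esum_ge0 => A _.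
  by apply: mule_ge0; [rewrite lee_fin|exact: supnorm_ge0].
have lip i j (w w' : config G S) (s a : S) : agree_off j w w' ->
    `|hamiltonian Phi [fset i]%fset (update w i s) - hamiltonian Phi [fset i]%fset (update w' i s)
      - (hamiltonian Phi [fset i]%fset (update w i a)
         - hamiltonian Phi [fset i]%fset (update w' i a))| <= L i j * mdist s a.
  move=> ww'; rewrite -lee_fin; apply: le_trans (Lipschitz i j s a).
  by apply: ereal_sup_ubound; exists (w, w').
have L_ge0 i j (s a : S) : 0 <= L i j * mdist s a.
  exact: le_trans (normr_ge0 _) (lip i j w0 w0 s a (fun _ _ => erefl)).
have osc_fin := esum_osc_fin w0 Phi_potential Phi_K.
have [c [c01 C0 C_row C_lip]] :=
  contraction_bound s0 piece_cover T_piece osc_fin L_ge0 contraction.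
(* The pieces are the fibers of [T]. *)
pose same_piece (s t : S) := T s = T t.
have model := potential_model (same_piece := same_piece) w0 Phi_potential Phi_K C0 c01 C_row
  (fun k l w w' s t ww' st => le_trans (lip k l w w' s t ww') (C_lip k l s t st)).
have [q [A [dq qA]]] := disintegration_exists alpha T borelS borelS'.
have [gam [spec gib bound]] := image_specification model dq
  (fun s' => let: And3 h _ _ := qA s' in h) (fun s' => let: And3 _ h _ := qA s' in h)
  (fun s' => let: And3 _ _ h := qA s' in h) w0 (T s0)
  (fun V B mB => gibbs_measure_mean (dm_meas model) V mB gmu).
exists gam; split => // i j; apply: le_trans (bound i j) _.
have ki k : k \notin [fset i]%fset = (k != i) by rewrite in_fset1.
have kappaE : (total_osc Phi (Cbar Phi (fineness piece) L) [fset i]%fset j)%:E =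
    (\esum_(k in [set k | k != i])
       (osc_at k (fun w => rsum (containing2 i k) (fun A => Phi A w))
        * Dbar Phi (fineness piece) L k j))%E.
  rewrite (total_oscE w0 Phi_potential Phi_K C0 c01 C_row).
  rewrite (_ : [set k | k \notin [fset i]%fset] = [set k | k != i]); last first.
    by apply/seteqP; split => k /=; rewrite ki.
  apply: eq_esum => k /= ki'; rewrite EFinM; congr (_ * _)%E.
    by rewrite (hamiltonian_oscE w0 Phi_potential Phi_K) (osc_hamiltonian1 w0 Phi_potential Phi_K).
  by rewrite fineK// (neumann_fin C0 c01 C_row).
have ME : (hamiltonian_bound Phi [fset i]%fset)%:E = (\esum_(A in containing i) supnorm (Phi A))%E.
  have fin := esum_meets_norm w0 Phi_potential Phi_K [fset i]%fset.
  rewrite /hamiltonian_bound fineK; last first.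
    rewrite ge0_fin_numE//; apply: esum_ge0 => B _.
    by rewrite lee_fin; exact: potential_norm_ge0 w0 _ Phi_potential Phi_K B.
  rewrite meets1; apply: eq_esum => B _.
  exact: potential_normE w0 _ Phi_potential Phi_K B.
rewrite /Qbound -kappaE -ME -EFinM/= /osc_rate.
set m := expR _; set k := total_osc _ _ _ _.
have m0 : 0 <= m by exact: expR_ge0.
have k0 : 0 <= k by exact: (kappa_ge0 model).
have e1 : (1 <= expeR (\esum_(A in containing j) osc_at j (Phi A)))%E.
  rewrite -expeR0 lee_expeR; apply: esum_ge0 => B _.
  apply: le_trans (_ : (`|Phi B w0 - Phi B w0|%:E <= _)%E); first by rewrite lee_fin.
  by apply: ereal_sup_ubound; exists (w0, w0).
have mk0 : 0 <= m * k by exact: mulr_ge0.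
(* The bound obtained is 2 m k. It remains to pass to 4 m k and then to multiply by the last
   exponential, which is at least 1 by [e1]. *)
apply: le_trans (_ : ((4 * m * k)%:E * 1 <= _)%E); last first.
  by apply: lee_wpmul2l => //; rewrite lee_fin mulr_ge0// mulr_ge0.
by rewrite mule1 lee_fin; lra.
Qed.
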